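(* For every fixed $\delta>0$ and every fixed $\varepsilon>0$, there is a constant $C=C(\varepsilon,\delta)$ such that, for all $n\ge 1$ and all $H\ge n^{1/2+\delta}$, one has $$M_2(H,n)\le C\,H n^{1+\varepsilon}.$$
   Context: Write $\mathbf{e}(x)=\exp(2\pi i x)$. The notation $x\sim X$ means $X/2\le x\le X$. For an integer $h$ define $S(h,n)=\sum_{a\sim n}\mathbf{e}(h\sqrt a)$, the sum being over integers $a$ with $n/2\le a\le n$, and define $M_2(H,n)=\sum_{h\sim H}|S(h,n)|^2$, the sum being over integers $h$ with $H/2\le h\le H$. *)

(* Defs.v *)
From mathcomp Require Import all_boot all_order all_algebra.
From mathcomp Require Import all_classical all_reals all_analysis.
From mathcomp Require Import complex.

Set Implicit Arguments.
Unset Strict Implicit.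
Unset Printing Implicit Defensive.

Import Order.TTheory GRing.Theory Num.Theory.
Import ComplexField.

Local Open Scope classical_set_scope.
Local Open Scope complex_scope.
Local Open Scope ring_scope.

(* The integers x with X/2 <= x <= X; the range X may be any real number. *)
Definition dyadic (R : realType) (X : R) : set int :=
  [set x : int | X / 2 <= x%:~R <= X].

(* exp(2 pi i x), written with Euler's formula: the libraries in use have no
   exponential on R[i]. *)
Definition expi2pi (R : realType) (x : R) : R[i] :=
  cos (2 * pi * x) +i* sin (2 * pi * x).

(* Sums over a set of integers return 0 when the summand has infinite support
   on that set; finite_dyadic shows that this never happens here. *)
Definition expsum (R : realType) (h : int) (n : R) : R[i] :=
  \sum_(a \in dyadic n) expi2pi (h%:~R * Num.sqrt (a%:~R : R)).

Definition M2 (R : realType) (H n : R) : R :=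
  \sum_(h \in dyadic H) Normc.normc (expsum h n) ^+ 2.

Lemma finite_dyadic (R : realType) (X : R) : finite_set (dyadic X).
Proof.
apply: (@sub_finite_set _ _ (Posz @` `I_(Num.truncn X).+1)); last first.
  exact/finite_image/finite_II.
move=> x /= /andP[Xx xX].
have x0 : 0 <= x.
  rewrite -(@ler0z R); apply: le_trans (Xx); rewrite divr_ge0//.
  rewrite leNgt; apply/negP => X0.
  have : X / 2 <= X by exact: le_trans Xx xX.
  by rewrite ler_pdivrMr// ler_nMr// lern1.
case: x x0 xX {Xx} => // k _ kX; exists k => //=.
have X0 : 0 <= X by exact: le_trans kX.
by rewrite ltnS truncn_ge_nat.
Qed.

(* Main.v *)
Require Import Defs.
From mathcomp Require Import all_boot all_order all_algebra.
From mathcomp Require Import all_classical all_reals all_analysis.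
From mathcomp Require Import complex ring lra zify.

(** Write S(h) for the sum of e(h sqrt a) over an interval J of L consecutive
integers of size N, and P(H) for the sum of |S(h)|^2 over 1 <= h <= H.  The
diagonal alone gives P(H) ~ H L; the point is that for H >= sqrt N nothing much
larger occurs.  The proof is a bootstrap: if P(X) <= B X L for all short
intervals J and all sqrt N <= X <= 4 N, then P(H) <= D (1 + sqrt B) H L in the
same range, with D a power of log N ([improve]).  Since the trivial bound gives
B = N, iterating leaves B <= 16 D^2 ([bootstrap]), which is at most C n^eps.

The self-improvement comes from a functional equation.  Poisson summation in a
replaces S(h) by the integrals I(h, nu) of e(h sqrt x - nu x) over J; the
stationary point is at sqrt x = h / (2 nu), so only 1 <= |nu| <= V with
V ~ 2 H / sqrt N matters, and the remaining nu are estimated by the Kusmin-Landau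
inequality ([main_error_bound]).  For a fixed nu, sum conj(S(h)) I(h, nu) over h
with Fejer weights: this gives the sum over b in J of the integral of
e(- nu x) F(sqrt x - sqrt b), where F is the Fejer kernel.  F concentrates at the
integers, that is at x = (sqrt b + k + u)^2 with k an integer and u of size 1/H,
and then
    nu x = nu b + 2 nu k sqrt b + (slowly varying in b).
As nu b is an integer, the sum over b is again S, at the frequency - 2 nu k
([dual_term_bound]).  Here |k| <= K ~ L / sqrt N, so 2 nu k never exceeds H when
J is short, and P(H) is bounded by H L plus H times the sum of |S(2 nu k)| / nu over
all nu <= V and k <= K, up to logarithms.  Cauchy-Schwarz, with the mean square
of the number of divisors k <= K, turns this into the square root of P
([grid_rmax_bound]).  Partial summation in b forces the maximum over subintervals
of J, which costs only logarithms by the Rademacher-Menshov inequality; this is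
why the induction hypothesis is about every subinterval.

Integrals are replaced by sums over the mesh (1/q) Z with q odd and very large:
the Poisson formula is then an identity between finite sums ([discrete_poisson]).
Likewise F is replaced by a step function with jumps at the multiples of 1/(2Q);
the sum over x between two jumps is geometric, which produces the factor 1/nu and
evaluates e(- nu x) at the end points x = (sqrt b + y)^2.

Finally, intervals of length about N are cut into short ones ([energy_long]).
For H > 2 N the Fejer kernel is nonnegative, so the sum of |S(h)|^2 over any N
consecutive h is at most its analogue centred at 0, which is about N L including
the frequency 0 ([block_energy]); [0, H] is covered by about H / N such blocks. *)

Set Implicit Arguments.
Unset Strict Implicit.
Unset Printing Implicit Defensive.

Import Order.TTheory GRing.Theory Num.Theory.
Import numFieldNormedType.Exports.
Import ComplexField Normc.

Local Open Scope ring_scope.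

Local Notation nrm := Normc.normc.
Local Notation e := (@expi2pi _).
Local Notation conj := conjc.

(** * Modulus and the additive character on R[i] *)

Section Modulus.
Variable R : realType.
Implicit Types (z w : R[i]) (x y : R).

Lemma nrm_normr z : `|z| = (nrm z)%:C%C.
Proof. by []. Qed.

Lemma nrm_ge0 z : 0 <= nrm z.
Proof. by case: z => a b; rewrite sqrtr_ge0. Qed.

Lemma nrmD z w : nrm (z + w) <= nrm z + nrm w.
Proof. by have := ler_normD z w; rewrite !nrm_normr -rmorphD lecR. Qed.

Lemma nrmN z : nrm (- z) = nrm z.
Proof. by case: z => a b /=; rewrite !sqrrN. Qed.

Lemma nrmB z w : nrm (z - w) <= nrm z + nrm w.
Proof. by rewrite (le_trans (nrmD _ _))// nrmN. Qed.

Lemma nrm_subC z w : nrm (z - w) = nrm (w - z).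
Proof. by rewrite -nrmN opprB. Qed.

Lemma nrm_sum (I : Type) (r : seq I) (P : pred I) (F : I -> R[i]) :
  nrm (\sum_(i <- r | P i) F i) <= \sum_(i <- r | P i) nrm (F i).
Proof.
elim/big_rec2: _ => [|i x z _ IH]; first by rewrite normc0.
by rewrite (le_trans (nrmD _ _))// lerD2l.
Qed.

Lemma nrm_conj z : nrm (conj z) = nrm z.
Proof. by case: z => a b /=; rewrite sqrrN. Qed.

Lemma nrm_real x : nrm (x%:C)%C = `|x|.
Proof. by rewrite /= expr0n/= addr0 sqrtr_sqr. Qed.

Lemma mul_conj z : z * conj z = ((nrm z ^+ 2)%:C)%C.
Proof.
case: z => a b /=; rewrite sqr_sqrtr ?addr_ge0 ?sqr_ge0//.
by apply/eqP; rewrite eq_complex /=; apply/andP; split; apply/eqP; ring.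
Qed.

Lemma conj_sum (I : Type) (r : seq I) (P : pred I) (F : I -> R[i]) :
  conj (\sum_(i <- r | P i) F i) = \sum_(i <- r | P i) conj (F i).
Proof. exact: rmorph_sum. Qed.

Lemma nrm_dist z w : `|nrm z - nrm w| <= nrm (z - w).
Proof.
have h1 := nrmD (z - w) w; have h2 := nrmD (w - z) z.
rewrite !subrK in h1 h2; rewrite [nrm (w - z)]nrm_subC in h2.
by rewrite ler_norml; apply/andP; split; lra.
Qed.

Lemma expi0 : e 0 = 1 :> R[i].
Proof. by rewrite /expi2pi mulr0 cos0 sin0. Qed.

Lemma expiD x y : e (x + y) = e x * e y.
Proof.
rewrite /expi2pi mulrDr cosD sinD; apply/eqP; rewrite eq_complex /=.
by apply/andP; split; apply/eqP; ring.
Qed.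

Lemma expiN x : e (- x) = conj (e x).
Proof. by rewrite /expi2pi mulrN cosN sinN. Qed.

Lemma expiB x y : e (x - y) = e x * conj (e y).
Proof. by rewrite expiD expiN. Qed.

Lemma nrm_expi x : nrm (e x) = 1.
Proof. by rewrite /= cos2Dsin2 sqrtr1. Qed.

Lemma expi1 : e 1 = 1 :> R[i].
Proof. by rewrite /expi2pi mulr1 mulr_natl cos2pi sin2pi. Qed.

Lemma expi_nat (n : nat) : e n%:R = 1 :> R[i].
Proof.
elim: n => [|n IH]; first exact: expi0.
by rewrite -natr1 expiD IH expi1 mulr1.
Qed.

Lemma expi_mulrn (n : nat) x : e (n%:R * x) = e x ^+ n.
Proof.
elim: n => [|n IH]; first by rewrite mul0r expi0 expr0.
by rewrite -natr1 mulrDl mul1r expiD IH exprSr.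
Qed.

Lemma sin_le x : 0 <= x -> `|sin x| <= x.
Proof.
move=> x0.
have [->|xn0] := eqVneq x 0; first by rewrite sin0 normr0.
have xgt0 : 0 < x by rewrite lt_def xn0.
have cs : {within `[0, x], continuous (@sin R)}%classic.
  by apply: continuous_subspaceT => y; exact: continuous_sin.
have [c _] := MVT xgt0 (fun y _ => is_derive_sin y) cs.
rewrite sin0 !subr0 => ->; rewrite normrM (gtr0_norm xgt0).
by rewrite ler_piMl// cos_max.
Qed.

Lemma sin_le_norm x : `|sin x| <= `|x|.
Proof.
have [x0|x0] := leP 0 x; first by rewrite [leRHS]ger0_norm// sin_le.
by rewrite -normrN -sinN -[leRHS]normrN [leRHS]ger0_norm ?sin_le// oppr_ge0 ltW.
Qed.

Lemma nrm_expi_sub1 x : nrm (e x - 1) = `|sin (pi * x)| *+ 2.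
Proof.
rewrite /expi2pi; set c := cos _; set s := sin _.
have -> : (c +i* s)%C - 1 = ((c - 1) +i* s)%C :> R[i].
  by apply/eqP; rewrite eq_complex /= subr0 !eqxx.
rewrite /= -[RHS]ger0_norm ?mulrn_wge0// -sqrtr_sqr; congr Num.sqrt.
rewrite -mulr_natr exprMn real_normK ?num_real//.
have cE : c = cos (pi * x) ^+ 2 *+ 2 - 1.
  by rewrite -cos_mulr2n /c; congr cos; ring.
have sE : s ^+ 2 = 1 - c ^+ 2 by rewrite /s sin2cos2.
rewrite sE sin2cos2 cE; ring.
Qed.

Lemma expi_lip x y : nrm (e x - e y) <= 8 * `|x - y|.
Proof.
have -> : e x - e y = e y * (e (x - y) - 1).
  by rewrite mulrBr mulr1 -expiD addrCA subrr addr0.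
rewrite normcM nrm_expi mul1r nrm_expi_sub1.
rewrite -mulr_natr; have := sin_le_norm (pi * (x - y)).
rewrite normrM (gtr0_norm (pi_gt0 R)) => h.
have := pihalf_lt2 R => h2; have := normr_ge0 (x - y) => h3.
nra.
Qed.

Lemma cos_le0_half x : pi / 2 <= x <= pi + pi / 2 -> cos x <= 0.
Proof.
move=> /andP[h1 h2]; rewrite -[x](subrK pi) cosDpi oppr_le0 cos_ge0_pihalf//.
by have p := pi_gt0 R; apply/andP; split; lra.
Qed.

Lemma expi_far x : 4^-1 <= x <= 3 / 4 -> 1 <= nrm (e x - 1).
Proof.
move=> /andP[h1 h2]; have p := pi_gt0 R.
have c0 : cos (2 * pi * x) <= 0.
  by apply: cos_le0_half; apply/andP; split; nra.
rewrite -(@ler_pXn2r _ 2) ?nnegrE ?nrm_ge0// expr1n /expi2pi.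
move: c0; set c := cos _; set s := sin _ => c0.
have -> : (c +i* s)%C - 1 = ((c - 1) +i* s)%C :> R[i].
  by apply/eqP; rewrite eq_complex /= subr0 !eqxx.
rewrite /= sqr_sqrtr ?addr_ge0 ?sqr_ge0//.
have : s ^+ 2 = 1 - c ^+ 2 by rewrite /s sin2cos2.
by move=> ->; nra.
Qed.

(** If m x lies in [1/4, 3/4], then e(m x) is at distance at least 1 from 1, while
e(m x) - 1 is e(x) - 1 times a sum of m unimodular terms; so |e(x) - 1| >= 1/m.
The choice m ~ 1/(4 x) gives a linear lower bound without Jordan's inequality. *)
Lemma expi_lower x : 0 <= x <= 3 / 4 -> x <= nrm (e x - 1).
Proof.
move=> /andP[x0 x34].
have [x14|x14] := leP (4^-1) x.
  by apply: le_trans (expi_far _); rewrite ?x14//; lra.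
have [->|xn0] := eqVneq x 0; first exact: nrm_ge0.
have xgt0 : 0 < x by rewrite lt_def xn0.
(* The least m with m x > 1/4, so that m x <= 1/4 + x < 1/2. *)
pose m := (Num.truncn (4 * x)^-1).+1.
have ix0 : 0 < (4 * x)^-1 by rewrite invr_gt0; lra.
have m1 : m%:R - 1 <= (4 * x)^-1.
  by rewrite /m -natr1 addrK; have /andP[] := truncn_itv (ltW ix0).
have m2 : (4 * x)^-1 < m%:R by have /andP[] := truncn_itv (ltW ix0).
have ixE : (4 * x)^-1 * x = 4^-1 by field.
have f1 : 1 <= nrm (e (m%:R * x) - 1).
  by apply: expi_far; apply/andP; split; nra.
have f2 : nrm (e (m%:R * x) - 1) <= m%:R * nrm (e x - 1).
  rewrite expi_mulrn subrX1 normcM mulrC ler_wpM2r ?nrm_ge0//.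
  apply: (le_trans (nrm_sum _ _ _)).
  rewrite (eq_bigr (fun=> 1)) ?sumr_const ?card_ord// => i _.
  by rewrite -expi_mulrn nrm_expi.
have m0 : 0 < m%:R :> R by rewrite ltr0n.
have n0 := nrm_ge0 (e x - 1).
rewrite leNgt; apply/negP => hc.
have : m%:R * nrm (e x - 1) < 1 by nra.
lra.
Qed.

Lemma nrm_expiN1 x : nrm (e (- x) - 1) = nrm (e x - 1).
Proof. by rewrite expiN -[1]conjc1 -rmorphB nrm_conj conjc1. Qed.

Lemma expi_lower_abs x : `|x| <= 3 / 4 -> `|x| <= nrm (e x - 1).
Proof.
have [x0 h|x0 h] := ger0P x; first by apply: expi_lower; rewrite x0.
by rewrite -nrm_expiN1; apply: expi_lower; rewrite oppr_ge0 ltW.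
Qed.

End Modulus.

(** * Summation by parts, the Kusmin-Landau inequality, harmonic sums *)

Section PartialSummation.
Variable R : realType.

Lemma abel_identity (w g : nat -> R[i]) n :
  \sum_(i < n) w i * g i = (\sum_(i < n) w i) * g n
    - \sum_(i < n) (\sum_(j < i.+1) w j) * (g i.+1 - g i).
Proof.
elim: n => [|n IH]; first by rewrite !big_ord0 mul0r subr0.
pose T i := (\sum_(j < i.+1) w j) * (g i.+1 - g i).
have -> : \sum_(i < n.+1) (\sum_(j < i.+1) w j) * (g i.+1 - g i)
    = \sum_(i < n) T i + T n by rewrite big_ord_recr.
by rewrite big_ord_recr/= IH /T !big_ord_recr/=; ring.
Qed.

(** Summation by parts: a bound for the partial sums of w transfers to w g at the
price of the total variation of g. *)
Lemma abel_bound (w g : nat -> R[i]) n (M G : R) :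
  (forall m, (m <= n)%N -> nrm (\sum_(i < m) w i) <= M) ->
  nrm (g n) <= G ->
  nrm (\sum_(i < n) w i * g i) <= M * (G + \sum_(i < n) nrm (g i.+1 - g i)).
Proof.
move=> hM hG.
have M0 : 0 <= M by apply: le_trans (hM 0%N isT); exact: nrm_ge0.
rewrite abel_identity (le_trans (nrmB _ _))// mulrDr lerD//.
  by rewrite normcM ler_pM ?nrm_ge0 ?hM.
rewrite mulr_sumr (le_trans (nrm_sum _ _ _))//.
apply: ler_sum => i _; rewrite normcM ler_wpM2r ?nrm_ge0 ?hM//.
Qed.

Lemma sum_dist_monotone (u : nat -> R) n :
  (forall i, (i < n)%N -> u i <= u i.+1) \/
  (forall i, (i < n)%N -> u i.+1 <= u i) ->
  \sum_(i < n) `|u i.+1 - u i| = `|u n - u 0%N|.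
Proof.
have mono (v : nat -> R) : (forall i, (i < n)%N -> v i <= v i.+1) ->
    \sum_(i < n) `|v i.+1 - v i| = `|v n - v 0%N|.
  move=> vP.
  have -> : \sum_(i < n) `|v i.+1 - v i| = v n - v 0%N.
    rewrite -telescope_sumr// big_mkord; apply: eq_bigr => i _.
    by rewrite ger0_norm// subr_ge0 vP.
  rewrite ger0_norm// subr_ge0.
  elim: n vP => [//|m IH] vP; apply: (le_trans (IH _)) (vP _ _) => // i im.
  by apply: vP; rewrite ltnS ltnW.
case=> uP; first exact: mono.
rewrite -normrN opprB addrC -[u 0%N]opprK.
rewrite -(mono (fun i => - u i)) => [|i /uP]; last by rewrite lerN2.
by apply: eq_bigr => i _; rewrite -opprD normrN.
Qed.

(** With d i = f i.+1 - f i one has e(f i) = (e(f i.+1) - e(f i)) / (e(d i) - 1): the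
sum is a telescoping sum twisted by 1 / (e(d i) - 1), whose variation is controlled
by that of 1 / d i, and the latter telescopes because d is monotone. *)
Lemma kusmin_landau (f : nat -> R) n (theta : R) : 0 < theta ->
  (forall i, (i <= n)%N -> theta <= f i.+1 - f i <= 3 / 4) ->
  (forall i, (i < n)%N -> f i.+1 - f i <= f i.+2 - f i.+1) \/
  (forall i, (i < n)%N -> f i.+2 - f i.+1 <= f i.+1 - f i) ->
  nrm (\sum_(i < n) e (f i)) <= 18 / theta.
Proof.
move=> theta0 dP dmono.
pose d i := f i.+1 - f i.
pose w i := e (f i.+1) - e (f i).
pose g i := (e (d i) - 1)^-1.
have d0 i : (i <= n)%N -> 0 < d i.
  by move=> /dP/andP[h _]; apply: lt_le_trans h.
have dn i : (i <= n)%N -> d i <= nrm (e (d i) - 1).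
  by move=> ni; apply: expi_lower; rewrite ltW ?d0//=; have /andP[] := dP i ni.
have dn0 i : (i <= n)%N -> e (d i) - 1 != 0.
  move=> ni; apply/eqP => h; have := dn i ni; rewrite h normc0.
  by rewrite leNgt d0.
have wE i : (i <= n)%N -> e (f i) = w i * g i.
  move=> ni; have -> : w i = e (f i) * (e (d i) - 1).
    by rewrite mulrBr mulr1 -expiD /d [f i + _]addrC subrK.
  by rewrite /g mulfK// dn0.
have -> : \sum_(i < n) e (f i) = \sum_(i < n) w i * g i.
  by apply: eq_bigr => i _; apply: wE; exact: ltnW.
have wS m : nrm (\sum_(i < m) w i) <= 2.
  rewrite -(big_mkord xpredT w) telescope_sumr//.
  by rewrite (le_trans (nrmB _ _))// !nrm_expi.
have dV i : (i <= n)%N -> (d i)^-1 <= theta^-1.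
  by move=> ni; rewrite lef_pV2 ?posrE ?d0//; have /andP[] := dP i ni.
have gn : nrm (g n) <= theta^-1.
  by rewrite normcV (le_trans _ (dV n _))// lef_pV2 ?posrE ?d0 ?dn//
     (lt_le_trans (d0 _ _) (dn _ _)).
apply: (le_trans (abel_bound (fun m _ => wS m) gn)).
suff H : \sum_(i < n) nrm (g i.+1 - g i) <= 8 * theta^-1.
  have : 0 < theta^-1 by rewrite invr_gt0.
  by move: (theta^-1) H => t H t0; lra.
have dmonoV : (forall i, (i < n)%N -> (d i)^-1 <= (d i.+1)^-1) \/
  (forall i, (i < n)%N -> (d i.+1)^-1 <= (d i)^-1).
  case: dmono => h; [right|left] => i ni;
    by rewrite lef_pV2 ?posrE ?d0// ?h// ltnW.
have S := sum_dist_monotone dmonoV.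
have b : `|(d n)^-1 - (d 0%N)^-1| <= theta^-1.
  have h1 := dV n (leqnn _); have h2 := dV 0%N (leq0n _).
  have h3 : 0 < (d n)^-1 by rewrite invr_gt0 d0.
  have h4 : 0 < (d 0%N)^-1 by rewrite invr_gt0 d0.
  by rewrite ler_norml; apply/andP; split; lra.
apply: (@le_trans _ _ (8 * \sum_(i < n) `|(d i.+1)^-1 - (d i)^-1|)); last first.
  by rewrite ler_wpM2l// S.
rewrite mulr_sumr; apply: ler_sum => i _.
have ni := ltn_ord i; have ni' := ltnW ni.
have gE : g i.+1 - g i = (e (d i) - e (d i.+1)) / ((e (d i.+1) - 1) * (e (d i) - 1)).
  by rewrite /g; have := dn0 _ ni; have := dn0 _ ni' => h1 h2; field; rewrite h1 h2.
have vE : (d i.+1)^-1 - (d i)^-1 = (d i - d i.+1) / (d i.+1 * d i).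
  by field; rewrite !gt_eqF ?d0.
have p1 := d0 _ ni; have p2 := d0 _ ni'.
rewrite gE vE !normcM normcV normcM normrM normfV normrM !(gtr0_norm (d0 _ _))//.
rewrite mulrA ler_pM ?nrm_ge0 ?invr_ge0 ?mulr_ge0 ?nrm_ge0 ?expi_lip//.
rewrite lef_pV2 ?posrE ?mulr_gt0 ?(lt_le_trans _ (dn _ _))//.
by rewrite ler_pM ?dn// ltW.
Qed.

Definition harm (m : nat) : R := \sum_(i < m) (i.+1%:R)^-1.

Lemma harm_ge0 m : 0 <= harm m.
Proof. by apply: sumr_ge0 => i _; rewrite invr_ge0. Qed.

Lemma harm_mono m n : (m <= n)%N -> harm m <= harm n.
Proof.
move=> mn; rewrite /harm -(subnKC mn) big_split_ord/= lerDl.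
by apply: sumr_ge0 => i _; rewrite invr_ge0.
Qed.

Lemma harm_pow2 t : harm (2 ^ t) <= t.+1%:R.
Proof.
elim: t => [|t IH]; first by rewrite /harm big_ord1 invr1.
rewrite /harm expnS mul2n -addnn big_split_ord/= -[t.+2%:R]natr1 lerD//.
apply: (@le_trans _ _ (\sum_(i < 2 ^ t) ((2 ^ t)%:R)^-1)).
  apply: ler_sum => i _; rewrite lef_pV2 ?posrE ?ltr0n ?expn_gt0// ler_nat.
  by rewrite -addnS leq_addr.
by rewrite sumr_const card_ord -[_ *+ _]mulr_natl mulfV// pnatr_eq0 expn_eq0.
Qed.

End PartialSummation.

(** * Truncated divisor functions and the Rademacher-Menshov inequality *)

Section Arithmetic.
Variable R : realType.

Lemma cauchy_schwarz (I : Type) (r : seq I) (a b : I -> R) :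
  (\sum_(i <- r) a i * b i) ^+ 2 <=
  (\sum_(i <- r) a i ^+ 2) * (\sum_(i <- r) b i ^+ 2).
Proof.
have H : 0 <= \sum_(i <- r) \sum_(j <- r) (a i * b j - a j * b i) ^+ 2.
  by apply: sumr_ge0 => i _; apply: sumr_ge0 => j _; rewrite sqr_ge0.
have E : \sum_(i <- r) \sum_(j <- r) (a i * b j - a j * b i) ^+ 2
  = (\sum_(i <- r) a i ^+ 2) * (\sum_(i <- r) b i ^+ 2) *+ 2
    - (\sum_(i <- r) a i * b i) ^+ 2 *+ 2.
  have -> : \sum_(i <- r) \sum_(j <- r) (a i * b j - a j * b i) ^+ 2 =
     \sum_(i <- r) \sum_(j <- r) a i ^+ 2 * b j ^+ 2
     + \sum_(i <- r) \sum_(j <- r) b i ^+ 2 * a j ^+ 2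
     - (\sum_(i <- r) \sum_(j <- r) (a i * b i) * (a j * b j)) *+ 2.
    rewrite -big_split/= -sumrMnl -sumrB/=; apply: eq_bigr => i _.
    rewrite -big_split/= -sumrMnl -sumrB/=; apply: eq_bigr => j _.
    by rewrite /=; ring.
  rewrite expr2 -!big_distrlr/= [X in _ + X - _]mulrC; ring.
by rewrite E subr_ge0 lerMn2r/= in H.
Qed.

(** Among k.+1 consecutive positive integers ending at a multiple of k.+1, only the
last one is a multiple. *)
Lemma sum_multiples (c : nat -> R) k m :
  \sum_(h < m * k.+1) (k.+1 %| h.+1)%:R * c h.+1
  = \sum_(v < m) c (v.+1 * k.+1)%N.
Proof.
elim: m => [|m IH]; first by rewrite !big_ord0.
rewrite [RHS]big_ord_recr/= -IH mulSn addnC big_split_ord/=; congr (_ + _).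
rewrite big_ord_recr/= big1 ?add0r => [|i _].
  have -> : (m * k.+1 + k).+1 = (m.+1 * k.+1)%N by rewrite mulSn addSn addnC.
  by rewrite dvdn_mull// mul1r mulSn addnC.
by rewrite -addnS dvdn_addr ?dvdn_mull// gtnNdvd ?mul0r// ltnS ltn_ord.
Qed.

Lemma sum_nat_mono (c : nat -> R) m n : (m <= n)%N -> (forall i, 0 <= c i) ->
  \sum_(i < m) c i <= \sum_(i < n) c i.
Proof.
move=> mn c0; rewrite -(subnKC mn) big_split_ord/= lerDl.
by apply: sumr_ge0.
Qed.

Definition tau K h : R := \sum_(k < K) (k.+1 %| h)%:R.

Lemma sum_grid_tau (c : nat -> R) m K : (forall i, 0 <= c i) ->
  \sum_(v < m) \sum_(k < K) c (v.+1 * k.+1)%N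
  <= \sum_(h < m * K) tau K h.+1 * c h.+1.
Proof.
move=> c0; rewrite exchange_big/=.
under [leRHS]eq_bigr do rewrite mulr_suml.
rewrite [leRHS]exchange_big/=; apply: ler_sum => k _.
rewrite -sum_multiples.
apply: (sum_nat_mono (c := fun h => (k.+1 %| h.+1)%:R * c h.+1)).
  by rewrite leq_mul.
by move=> h; rewrite mulr_ge0.
Qed.

Lemma count_multiples l X : (0 < l)%N ->
  \sum_(h < X) (l %| h.+1)%:R = (X %/ l)%:R :> R.
Proof.
move=> l0; elim: X => [|X IH]; first by rewrite big_ord0 div0n.
by rewrite big_ord_recr/= IH divnS// natrD addrC.
Qed.

Lemma sum_inv_multiples K d :
  \sum_(k < K) (d.+1 %| k.+1)%:R / k.+1%:R <= harm R K / d.+1%:R.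
Proof.
apply: (@le_trans _ _
  (\sum_(h < K * d.+1) (d.+1 %| h.+1)%:R * (h.+1%:R)^-1)).
  apply: (sum_nat_mono (c := fun h => (d.+1 %| h.+1)%:R * (h.+1%:R)^-1)).
    by rewrite leq_pmulr.
  by move=> h; rewrite mulr_ge0.
rewrite (sum_multiples (fun h => (h%:R)^-1)) mulr_suml.
by apply: ler_sum => v _; rewrite natrM invfM.
Qed.

(** Opening the square counts the multiples of lcm(k, l) up to X, hence at most
X gcd(k, l) / (k l).  Bounding the gcd by the sum of all common divisors d makes the
double sum over k and l factor for each d, into d (harm K / d)^2. *)
Lemma tau_second_moment K X :
  \sum_(h < X) tau K h.+1 ^+ 2 <= X%:R * harm R K ^+ 3.
Proof.
have step1 : \sum_(h < X) tau K h.+1 ^+ 2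
    = \sum_(k < K) \sum_(l < K) (X %/ lcmn k.+1 l.+1)%:R.
  under eq_bigr do rewrite expr2 big_distrlr/=.
  rewrite exchange_big/=; apply: eq_bigr => k _.
  rewrite exchange_big/=; apply: eq_bigr => l _.
  rewrite -count_multiples ?lcmn_gt0//; apply: eq_bigr => h _.
  by rewrite dvdn_lcm; case: (_ %| _)%N; case: (_ %| _)%N; rewrite ?mulr0 ?mulr1.
rewrite step1.
apply: (@le_trans _ _ (\sum_(k < K) \sum_(l < K) \sum_(d < K)
   X%:R * d.+1%:R * ((d.+1 %| k.+1)%:R / k.+1%:R)
     * ((d.+1 %| l.+1)%:R / l.+1%:R))).
  apply: ler_sum => k _; apply: ler_sum => l _.
  have g0 : (0 < gcdn k.+1 l.+1)%N by rewrite gcdn_gt0.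
  have gK : ((gcdn k.+1 l.+1).-1 < K)%N.
    rewrite prednK//; apply: leq_trans (ltn_ord k).
    by apply: dvdn_leq => //; exact: dvdn_gcdl.
  rewrite (bigD1 (Ordinal gK))//= prednK// dvdn_gcdl dvdn_gcdr.
  apply: ler_wpDr.
    by apply: sumr_ge0 => d _; rewrite !mulr_ge0.
  have l0 : (0 < lcmn k.+1 l.+1)%N by rewrite lcmn_gt0.
  apply: (@le_trans _ _ (X%:R / (lcmn k.+1 l.+1)%:R)).
    by rewrite ler_pdivlMr ?ltr0n// -natrM ler_nat leq_divM.
  have := muln_lcm_gcd k.+1 l.+1 => /(congr1 (fun n => n%:R : R)).
  rewrite !natrM => E.
  have L0 : (lcmn k.+1 l.+1)%:R != 0 :> R by rewrite pnatr_eq0 -lt0n.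
  have k0 : k.+1%:R != 0 :> R by rewrite pnatr_eq0.
  have ll0 : l.+1%:R != 0 :> R by rewrite pnatr_eq0.
  rewrite le_eqVlt; apply/orP; left; apply/eqP.
  have -> : (gcdn k.+1 l.+1)%:R = k.+1%:R * l.+1%:R / (lcmn k.+1 l.+1)%:R :> R.
    by rewrite -E; field.
  rewrite /= !mulr1n; move: (k.+1%:R : R) (l.+1%:R : R) k0 ll0 => x y x0 y0.
  by field; rewrite L0 x0 y0.
apply: (@le_trans _ _ (X%:R * \sum_(d < K) d.+1%:R *
    (\sum_(k < K) (d.+1 %| k.+1)%:R / k.+1%:R) ^+ 2)).
  rewrite le_eqVlt; apply/orP; left; apply/eqP.
  rewrite mulr_sumr.
  under eq_bigr do rewrite exchange_big/=.
  rewrite exchange_big/=; apply: eq_bigr => d _.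
  rewrite expr2 big_distrlr/= !mulr_sumr; apply: eq_bigr => k _.
  by rewrite !mulr_sumr; apply: eq_bigr => l _; rewrite !mulrA.
rewrite ler_wpM2l// exprSr {2}/harm mulr_sumr; apply: ler_sum => d _.
have h0 := harm_ge0 R K.
apply: (@le_trans _ _ (d.+1%:R * (harm R K / d.+1%:R) ^+ 2)).
  rewrite ler_wpM2l// ler_pXn2r ?nnegrE ?divr_ge0 ?sum_inv_multiples//.
  by apply: sumr_ge0 => k _; rewrite divr_ge0.
rewrite le_eqVlt; apply/orP; left; apply/eqP.
by field; rewrite nat1r pnatr_eq0.
Qed.

(** A sum of c over the products v k is a sum over h weighted by at most [tau K h];
Cauchy-Schwarz then loses only the mean square of [tau K], a power of log K. *)
Lemma sum_grid_bound (c : nat -> R) m K : (forall i, 0 <= c i) ->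
  (\sum_(v < m) \sum_(k < K) c (v.+1 * k.+1)%N) ^+ 2
  <= (m * K)%:R * harm R K ^+ 3 * \sum_(h < m * K) c h.+1 ^+ 2.
Proof.
move=> c0; apply: (@le_trans _ _ ((\sum_(h < m * K) tau K h.+1 * c h.+1) ^+ 2)).
  rewrite ler_pXn2r ?nnegrE ?sum_grid_tau//.
    by apply: sumr_ge0 => v _; apply: sumr_ge0.
  by apply: sumr_ge0 => h _; rewrite mulr_ge0 ?sumr_ge0.
apply: (le_trans (cauchy_schwarz _ _ _)).
rewrite ler_wpM2r ?tau_second_moment//.
by apply: sumr_ge0 => h _; rewrite sqr_ge0.
Qed.

End Arithmetic.

Section RademacherMenshov.
Variable R : realType.

(** The sum of F over the blocks obtained from [s, s + L) by r successive halvings,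
all levels included. *)
Fixpoint halvings (F : nat -> nat -> R) r s L : R :=
  if r is r'.+1 then
    F s L + (halvings F r' s L./2 + halvings F r' (s + L./2)%N (L - L./2)%N)
  else F s L.

Lemma halvings_ge (F : nat -> nat -> R) r s L :
  (forall s L, 0 <= F s L) -> F s L <= halvings F r s L.
Proof.
move=> F0; elim: r s L => [//|r IH] s L /=.
by rewrite lerDl addr_ge0// (le_trans _ (IH _ _)).
Qed.

Lemma halvings_sum (I : finType) (F : I -> nat -> nat -> R) r s L :
  \sum_i halvings (F i) r s L = halvings (fun s L => \sum_i F i s L) r s L.
Proof.
elim: r s L => [//|r IH] s L /=.
by rewrite !big_split/= !IH.
Qed.

Lemma halvings_le (F : nat -> nat -> R) c r s L s0 L0 :
  (forall s L, (s0 <= s)%N -> (s + L <= s0 + L0)%N -> F s L <= c * L%:R) ->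
  (s0 <= s)%N -> (s + L <= s0 + L0)%N ->
  halvings F r s L <= c * r.+1%:R * L%:R.
Proof.
move=> Fc; elim: r s L => [|r IH] s L hs hL /=; first by rewrite mulr1 Fc.
have hl : (L./2 <= L)%N by rewrite -divn2 leq_div.
have -> : c * r.+2%:R * L%:R = c * L%:R + (c * r.+1%:R * L./2%:R
    + c * r.+1%:R * (L - L./2)%:R).
  rewrite natrB// -[r.+2%:R]natr1; ring.
by rewrite lerD ?Fc// lerD// IH//; lia.
Qed.

(** An initial segment is a disjoint union of at most one block from each level of
halving.  The weights 1 + t and (1 + t)/t in |X + Y|^2 <= (1 + t)(|X|^2 + |Y|^2 / t),
with t the number of remaining levels, make the loss linear in the number of
levels. *)
Lemma rademacher_menshov (w : nat -> R[i]) r s L m :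
  (L <= 2 ^ r)%N -> (m <= L)%N ->
  nrm (\sum_(i < m) w (s + i)%N) ^+ 2 <=
  r.+1%:R * halvings (fun s L => nrm (\sum_(i < L) w (s + i)%N) ^+ 2) r s L.
Proof.
pose F := fun s L => nrm (\sum_(i < L) w (s + i)%N) ^+ 2.
rewrite -/F.
have F0 s' L' : 0 <= F s' L' by rewrite sqr_ge0.
elim: r s L m => [|r IH] s L m hL hm.
  rewrite mul1r /=; case: L hL hm => [|[|//]] _.
    by rewrite leqn0 => /eqP ->.
  by case: m => [|[|//]] _ //; rewrite big_ord0 normc0 expr0n F0.
have hl : (L./2 <= L)%N by rewrite -divn2 leq_div.
have hl1 : (L./2 <= 2 ^ r)%N by move: hL; rewrite expnS; lia.
have hl2 : (L - L./2 <= 2 ^ r)%N by move: hL; rewrite expnS; lia.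
have H1 := halvings_ge r s L./2 F0.
have H2 := halvings_ge r (s + L./2)%N (L - L./2)%N F0.
have FL := F0 s L; have F1 := F0 s L./2; have F2 := F0 (s + L./2)%N (L - L./2)%N.
have r0 : 0 <= r.+1%:R :> R by [].
rewrite [halvings _ _ _ _]/=.
have -> : r.+2%:R = r.+1%:R + 1 :> R by rewrite natr1.
have [hm2|hm2] := leqP m L./2.
  have := IH s _ _ hl1 hm2.
  move: H1 H2 FL F1 F2.
  move: (halvings _ _ _ _) (halvings _ _ _ _) => x y H1 H2 FL F1 F2 H.
  move: (r.+1%:R : R) r0 H => t t0 H; nra.
have hm3 : (m - L./2 <= L - L./2)%N by rewrite leq_sub2r.
have := IH (s + L./2)%N _ _ hl2 hm3.
set Y := \sum_(i < m - _) _ => HY.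
have -> : \sum_(i < m) w (s + i)%N = \sum_(i < L./2) w (s + i)%N + Y.
  rewrite -[in LHS](subnKC (ltnW hm2)) big_split_ord/=; congr (_ + _).
  by apply: eq_bigr => i _; rewrite addnA.
have : nrm (\sum_(i < L./2) w (s + i)%N) ^+ 2 <= halvings F r s L./2.
  exact: H1.
set X := \sum_(i < L./2) _ => HX.
have tri := nrmD X Y.
have X0 := nrm_ge0 X; have Y0 := nrm_ge0 Y; have XY0 := nrm_ge0 (X + Y).
apply: (@le_trans _ _ ((nrm X + nrm Y) ^+ 2)).
  by rewrite ler_pXn2r ?nnegrE// addr_ge0.
move: H1 H2 F1 F2 HX HY.
move: (halvings _ _ _ _) (halvings _ _ _ _) => y x H1 H2 F1 F2 HX HY.
have t1 : 1 <= r.+1%:R :> R by rewrite ler1n.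
move: (r.+1%:R : R) r0 HY t1 => t t0 HY t1.
move: (nrm X) (nrm Y) X0 Y0 HX HY => u v u0 v0 HX HY.
have k : 2 * t * u * v <= t ^+ 2 * u ^+ 2 + v ^+ 2.
  by have := sqr_ge0 (t * u - v); nra.
(* Multiplied by t, the claim is free of divisions. *)
suff : t * (u + v) ^+ 2 <= t * ((t + 1) * (F s L + (x + y))).
  by rewrite (ler_pM2l (lt_le_trans ltr01 t1)).
apply: (@le_trans _ _ (t * (t + 1) * u ^+ 2 + (t + 1) * v ^+ 2)); first nra.
apply: (@le_trans _ _ (t * (t + 1) * x + (t + 1) * (t * y))).
  by rewrite lerD// ler_wpM2l//; nra.
have t10 : 0 <= t + 1 by lra.
have := mulr_ge0 (mulr_ge0 t0 t10) FL.
move: (F s L) => f f0.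
have -> : t * ((t + 1) * (f + (x + y))) = t * (t + 1) * f
  + (t * (t + 1) * x + (t + 1) * (t * y)) by ring.
by rewrite lerDr.
Qed.

End RademacherMenshov.

(** * Square-root sums, their energy and their maximal functions *)

Section RootSums.
Variable R : realType.
Implicit Types (z : R).

Definition sqrtn (a : nat) : R := Num.sqrt a%:R.

Definition rsum s L z : R[i] := \sum_(i < L) e (z * sqrtn (s + i)%N).

Definition energy s L X : R := \sum_(h < X) nrm (rsum s L h.+1%:R) ^+ 2.

(** The condition 6 L <= N keeps the frequencies 2 nu k created by the dual sum below
the original range of frequencies, and sqrt N <= X is where the diagonal X L
starts to dominate.  The bound is asked of all intervals at once because the argument
passes to subintervals. *)
Definition energy_bound N (B : R) := forall s L X, (N <= s)%N ->
  (s + L <= 4 * N)%N -> (6 * L <= N)%N -> (N <= X ^ 2)%N -> (X <= 4 * N)%N ->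
  energy s L X <= B * X%:R * L%:R.

Definition rmax s L z : R := \big[Num.max/0]_(m < L.+1) nrm (rsum s m z).

Lemma rmax_ge s L z m : (m <= L)%N -> nrm (rsum s m z) <= rmax s L z.
Proof.
move=> mL; have mL' : (m < L.+1)%N by rewrite ltnS.
exact: (le_bigmax_cond _ (fun m : 'I_L.+1 => nrm (rsum s m z)) (j := Ordinal mL')).
Qed.

Lemma rmax_le s L z (c : R) : 0 <= c ->
  (forall m, (m <= L)%N -> nrm (rsum s m z) <= c) -> rmax s L z <= c.
Proof. by move=> c0 h; apply: bigmax_le => // i _; apply: h; rewrite -ltnS. Qed.

Lemma rmax_ge0 s L z : 0 <= rmax s L z.
Proof. by apply: le_trans (rmax_ge s z (leq0n L)); exact: nrm_ge0. Qed.

Lemma rmax_sqr_le s L z (c : R) :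
  (forall m, (m <= L)%N -> nrm (rsum s m z) ^+ 2 <= c) -> rmax s L z ^+ 2 <= c.
Proof.
move=> h; have c0 : 0 <= c by apply: le_trans (h 0%N _); rewrite ?sqr_ge0.
rewrite -[leRHS]sqr_sqrtr// ler_pXn2r ?nnegrE ?rmax_ge0 ?sqrtr_ge0//.
apply: rmax_le; first exact: sqrtr_ge0.
by move=> m mL; rewrite -(ler_pXn2r (n := 2)) ?nnegrE ?nrm_ge0 ?sqrtr_ge0// sqr_sqrtr// h.
Qed.

(** The Rademacher-Menshov inequality, summed over the frequencies: on each level the
lengths of the blocks add up to L, so each level costs one energy bound. *)
Lemma energy_rmax s L X r (c : R) : (L <= 2 ^ r)%N ->
  (forall s' L', (s <= s')%N -> (s' + L' <= s + L)%N ->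
     energy s' L' X <= c * L'%:R) ->
  \sum_(h < X) rmax s L h.+1%:R ^+ 2 <= r.+1%:R ^+ 2 * c * L%:R.
Proof.
move=> hr hE.
pose F (h : 'I_X) s L := nrm (rsum s L h.+1%:R) ^+ 2.
apply: (@le_trans _ _ (\sum_(h < X) r.+1%:R * halvings (F h) r s L)).
  apply: ler_sum => h _; apply: rmax_sqr_le => m mL.
  exact: (rademacher_menshov (fun a => e (h.+1%:R * sqrtn a)) s hr mL).
rewrite -mulr_sumr halvings_sum.
have := halvings_le (s0 := s) (L0 := L) (s := s) (L := L) r hE (leqnn _) (leqnn _).
move=> H; apply: (@le_trans _ _ (r.+1%:R * (c * r.+1%:R * L%:R))).
  by rewrite ler_wpM2l.
by rewrite le_eqVlt; apply/orP; left; apply/eqP; ring.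
Qed.

(** Summation by parts against 1/v, arranged as an induction: the slack
(m F - sum of the a v) / (m + 1) is what the next term is charged to. *)
Lemma sum_div_le (a : nat -> R) (F : R) V :
  (forall m, (m <= V)%N -> \sum_(v < m) a v <= m%:R * F) ->
  \sum_(v < V) a v / v.+1%:R <= F * harm R V.
Proof.
move=> hF.
suff H m : (m <= V)%N -> \sum_(v < m) a v / v.+1%:R <=
    F * harm R m - (m%:R * F - \sum_(v < m) a v) / m.+1%:R.
  apply: (le_trans (H V (leqnn _))); rewrite lerBlDr lerDl divr_ge0//.
  by rewrite subr_ge0 hF.
elim: m => [|m IH] mV.
  by rewrite /harm !big_ord0 mulr0 mul0r subr0 mul0r subr0.
have Cm := hF _ mV; have Im := IH (ltnW mV).
move: Cm Im; rewrite /harm !big_ord_recr/=.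
set T := \sum_(v < m) a v / _; set C := \sum_(v < m) a v; set h := \sum_(v < m) _.
move=> Cm Im.
have x0 : 0 < m.+1%:R :> R by [].
have -> : m.+2%:R = m.+1%:R + 1 :> R by rewrite natr1.
have Em : m%:R = m.+1%:R - 1 :> R by rewrite -natr1 addrK.
move: Cm Im; rewrite Em; move: (m.+1%:R : R) x0 => x x0 Cm Im.
have D : (x * F - (C + a m)) / (x + 1) <= (x * F - (C + a m)) / x.
  rewrite ler_wpM2l ?subr_ge0// lef_pV2 ?posrE//; lra.
apply: (le_trans _ (lerB (lexx _) D)).
have -> : F * (h + x^-1) - (x * F - (C + a m)) / x
  = F * h - ((x - 1) * F - C) / x + a m / x by field; rewrite gt_eqF.
by rewrite lerD2r.
Qed.

Lemma ceil_sqrt N : (0 < N)%N ->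
  exists2 X0, (N <= X0 ^ 2)%N & (X0 ^ 2 <= 4 * N)%N /\
    forall X, (N <= X ^ 2)%N -> (X0 <= X)%N.
Proof.
move=> N0; have ex : exists X, (N <= X ^ 2)%N.
  by exists N; rewrite leq_pmulr.
exists (ex_minn ex); case: ex_minnP => X0 h1 h2 //; split => //.
case: X0 h1 h2 => [//|x] h1 h2.
have : ~~ (N <= x ^ 2)%N by apply/negP => /h2; rewrite ltnn.
by rewrite -ltnNge => h; nia.
Qed.

(** For m <= V the products 2 v k with v <= m, k <= K stay below 2 m K <= H, so the
energy bound at the range max(2 m K, sqrt N), together with Cauchy-Schwarz, bounds
the partial sum over v <= m by m times a constant; K <= L / sqrt N is what makes the
constant proportional to L.  Summation by parts then inserts the factor 1/v. *)
Lemma grid_rmax_bound N (B : R) s L H K V r (ell : R) :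
  0 <= B -> energy_bound N B -> (0 < N)%N -> (N <= s)%N ->
  (s + L <= 4 * N)%N -> (6 * L <= N)%N -> (N <= H ^ 2)%N -> (H <= 4 * N)%N ->
  (K ^ 2 * N <= L ^ 2)%N -> (2 * V * K <= H)%N -> (L <= 2 ^ r)%N ->
  1 <= ell -> r.+1%:R <= ell -> harm R K <= ell -> harm R V <= ell ->
  \sum_(v < V) (\sum_(k < K) rmax s L (2 * (v.+1 * k.+1))%:R) / v.+1%:R
  <= 2 * ell ^+ 4 * L%:R * Num.sqrt B.
Proof.
move=> B0 EB N0 Ns sL LN NH HN KN VK Lr ell1 ellr ellK ellV.
have ell0 : 0 <= ell by rewrite (le_trans ler01).
pose c h := rmax s L (2 * h)%:R.
have c0 h : 0 <= c h by exact: rmax_ge0.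
suff hF m : (m <= V)%N -> \sum_(v < m) \sum_(k < K) c (v.+1 * k.+1)%N
    <= m%:R * (2 * ell ^+ 3 * L%:R * Num.sqrt B).
  apply: (le_trans (sum_div_le (a := fun v => \sum_(k < K) c (v.+1 * k.+1)%N) hF)).
  apply: (@le_trans _ _ (2 * ell ^+ 3 * L%:R * Num.sqrt B * ell)).
    by rewrite ler_wpM2l// !mulr_ge0 ?exprn_ge0 ?sqrtr_ge0.
  by rewrite le_eqVlt; apply/orP; left; apply/eqP; ring.
move=> mV.
have [X0 hX0 [X0N X0min]] := ceil_sqrt N0.
(* The energy bound is only available from sqrt N on. *)
pose X := maxn (2 * (m * K)) X0.
have XH : (X <= H)%N.
  by rewrite geq_max X0min// andbT (leq_trans _ VK)// -mulnA leq_mul2l leq_mul2r mV orbT.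
have NX : (N <= X ^ 2)%N by rewrite (leq_trans hX0)// leq_exp2r// leq_maxr.
have E1 : \sum_(h < X) rmax s L h.+1%:R ^+ 2 <= r.+1%:R ^+ 2 * (B * X%:R) * L%:R.
  apply: energy_rmax => // s' L' h1 h2; apply: EB => //; try lia.
have E2 : \sum_(h < m * K) c h.+1 ^+ 2 <= ell ^+ 2 * (B * X%:R) * L%:R.
  apply: (@le_trans _ _ (r.+1%:R ^+ 2 * (B * X%:R) * L%:R)); last first.
    rewrite ler_wpM2r// ler_wpM2r ?mulr_ge0//.
    by rewrite ler_pXn2r ?nnegrE.
  apply: le_trans E1.
  pose f h := rmax s L h%:R ^+ 2.
  have := sum_multiples f 1 (m * K).
  have -> : \sum_(v < m * K) f (v.+1 * 2)%N = \sum_(h < m * K) c h.+1 ^+ 2.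
    by apply: eq_bigr => v _; rewrite /f /c mulnC.
  move=> <-; apply: (@le_trans _ _ (\sum_(h < m * K * 2) f h.+1)).
    apply: ler_sum => h _; rewrite ler_piMl ?sqr_ge0//.
    by rewrite lern1 leq_b1.
  apply: (sum_nat_mono (c := fun h => f h.+1)); last by move=> i; rewrite sqr_ge0.
  by rewrite mulnC leq_maxl.
rewrite -(ler_pXn2r (n := 2)) ?nnegrE//; last 2 first.
- by apply: sumr_ge0 => v _; apply: sumr_ge0.
- by rewrite !mulr_ge0 ?exprn_ge0 ?sqrtr_ge0.
apply: (le_trans (sum_grid_bound m K c0)).
have key : ((m * K) * X * L <= 4 * m ^ 2 * L ^ 2)%N.
  have kx : (K * X0 <= 2 * L)%N.
    by rewrite -(@leq_exp2r _ _ 2)// !expnMn; nia.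
  have Xle : (X <= 2 * (m * K) + X0)%N by rewrite geq_max leq_addr leq_addl.
  have kl : (6 * K ^ 2 * L <= L ^ 2)%N by nia.
  have : (m * K * X * L <= m * K * (2 * (m * K) + X0) * L)%N.
    by rewrite leq_mul2r leq_mul2l Xle !orbT.
  case: (posnP m) => [->|m0]; first by rewrite !mul0n.
  move=> h; apply: (leq_trans h).
  have -> : (m * K * (2 * (m * K) + X0) * L
     = m ^ 2 * (2 * K ^ 2 * L) + m * (K * X0) * L)%N by ring.
  have h1 : (m * (K * X0) * L <= m ^ 2 * (2 * L * L))%N.
    apply: (@leq_trans (m * (2 * L) * L)); first by rewrite leq_mul2r leq_mul2l kx !orbT.
    have -> : (m * (2 * L) * L = m * (2 * L * L))%N by ring.
    by apply: leq_mul => //; rewrite -mulnn leq_pmulr.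
  have h2 : (m ^ 2 * (2 * K ^ 2 * L) <= m ^ 2 * (L * L))%N.
    by rewrite leq_mul2l; apply/orP; right; nia.
  by apply: (leq_trans (leq_add h2 h1)); nia.
have keyR : (m * K)%:R * X%:R * L%:R <= 4 * m%:R ^+ 2 * L%:R ^+ 2 :> R.
  by rewrite -!natrM -!natrX -!natrM ler_nat.
have h3 : harm R K ^+ 3 <= ell ^+ 3 by rewrite ler_pXn2r ?nnegrE ?harm_ge0.
apply: (@le_trans _ _ ((m * K)%:R * ell ^+ 3 * (ell ^+ 2 * (B * X%:R) * L%:R))).
  apply: ler_pM => //.
  - by rewrite mulr_ge0 ?exprn_ge0 ?harm_ge0.
  - by apply: sumr_ge0 => h _; rewrite sqr_ge0.
  - by rewrite ler_wpM2l.
have -> : (m%:R * (2 * ell ^+ 3 * L%:R * Num.sqrt B)) ^+ 2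
  = 4 * m%:R ^+ 2 * L%:R ^+ 2 * (ell ^+ 6 * B).
  rewrite -{2}[B]sqr_sqrtr//; ring.
have -> : (m * K)%:R * ell ^+ 3 * (ell ^+ 2 * (B * X%:R) * L%:R)
  = ((m * K)%:R * X%:R * L%:R) * (ell ^+ 5 * B) by ring.
apply: ler_pM => //.
- by rewrite mulr_ge0 ?exprn_ge0.
- by rewrite ler_wpM2r// ler_weXn2l.
Qed.

End RootSums.

(** * An exact Poisson formula on a mesh *)

Section DiscretePoisson.
Variable R : realType.
Implicit Types (d v : R).

Lemma nrm_nat (n : nat) : nrm (n%:R : R[i]) = n%:R.
Proof. by rewrite -(rmorph_nat (real_complex R)) nrm_real ger0_norm. Qed.

Lemma expi_neq0 (x : R) : e x != 0.
Proof.
apply/eqP => h; have := nrm_expi x; rewrite h normc0 => /eqP.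
by rewrite eq_sym oner_eq0.
Qed.

Lemma expi_neq1 (x : R) : 0 < x < 1 -> e x != 1.
Proof.
move=> /andP[x0 x1]; apply/eqP => ex1.
have [x34|x34] := leP x (3 / 4).
  have : x <= nrm (e x - 1) by apply: expi_lower; rewrite ltW.
  by rewrite ex1 subrr normc0 leNgt x0.
have : 1 - x <= nrm (e (1 - x) - 1).
  by apply: expi_lower; apply/andP; split; lra.
by rewrite expiB ex1 expi1 conjc1 mulr1 subrr normc0 leNgt subr_gt0 x1.
Qed.

Lemma dirichlet_sum (w : R[i]) r : w != 0 ->
  1 + \sum_(m < r) (w ^+ m.+1 + w^-1 ^+ m.+1)
  = w^-1 ^+ r * \sum_(j < r.*2.+1) w ^+ j.
Proof.
move=> w0; elim: r => [|r IH]; first by rewrite big_ord0 big_ord1 addr0 mulr1.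
rewrite [in LHS]big_ord_recr/= addrA IH doubleS.
set D := \sum_(j < _) _.
have -> : \sum_(j < r.*2.+3) w ^+ j = 1 + w * D + w ^+ (r.+1 + r.+1).
  rewrite big_ord_recr big_ord_recl/= expr0 mulr_sumr addnS addSn addnn.
  by congr (_ + _ + _); apply: eq_bigr => j _; rewrite /bump leq0n add1n exprS.
have wV : w^-1 ^+ r * w ^+ r = 1 by rewrite -exprMn mulVf// expr1n.
rewrite exprD !exprS.
move: (w^-1 ^+ r) (w ^+ r) wV => x y xy.
have ww : w^-1 * w = 1 by rewrite mulVf.
move: (w^-1) ww => z zw.
transitivity (x * D * (z * w) + (w * y) * (z * w) * (x * y) + z * x).
  by rewrite zw xy; ring.
ring.
Qed.

Lemma sum_blocks (V : nmodType) (F : nat -> V) L q :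
  \sum_(t < L * q) F t = \sum_(i < L) \sum_(j < q) F (i * q + j)%N.
Proof.
elim: L => [|L IH]; first by rewrite mul0n !big_ord0.
by rewrite [RHS]big_ord_recr/= -IH mulSn addnC big_split_ord.
Qed.

Lemma geometric_period q j : (j < q)%N ->
  \sum_(m < q) (e (- (j%:R / q%:R)) : R[i]) ^+ m = (if j == 0%N then q else 0%N)%:R.
Proof.
move=> jq; have q0 : (0 < q)%N by apply: leq_ltn_trans jq.
have [->|j0] := eqVneq j 0%N.
  rewrite mul0r oppr0 expi0 (eq_bigr (fun=> 1)) ?sumr_const ?card_ord// => m _.
  by rewrite expr1n.
have qR : 0 < q%:R :> R by rewrite ltr0n.
have w1 : e (- (j%:R / q%:R)) - 1 != 0 :> R[i].
  rewrite subr_eq0 expiN; apply/eqP => h.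
  have : e (j%:R / q%:R) != 1 :> R[i].
    apply: expi_neq1; rewrite divr_gt0 ?qR ?ltr0n ?lt0n//=.
    by rewrite ltr_pdivrMr// mul1r ltr_nat.
  move=> /eqP; apply; apply: (can_inj (@conjcK R)).
  by rewrite h conjc1.
apply: (mulfI w1); rewrite -subrX1 -expi_mulrn mulr0.
by rewrite mulrN mulrC divfK ?gt_eqF// expiN expi_nat conjc1 subrr.
Qed.

(** The Riemann sum of mesh 1/q for the integral of e(d sqrt x - v x) over
[s, s + L], with x = s + t/q; the phase v s is dropped since v is an integer in the
applications. *)
Definition grid_sum s L q d v : R[i] := q%:R^-1 *
  \sum_(t < L * q) e (d * Num.sqrt (s%:R + t%:R / q%:R) - v * (t%:R / q%:R)).

(** On the mesh (1/q) Z, the average of e(- nu x) over the residues nu modulo q is the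
indicator of the integers.  Taking q odd makes the set of residues symmetric about
0. *)
Lemma discrete_poisson s L r d : rsum s L d = grid_sum s L r.*2.+1 d 0
  + \sum_(m < r) (grid_sum s L r.*2.+1 d m.+1%:R + grid_sum s L r.*2.+1 d (- m.+1%:R)).
Proof.
set q := r.*2.+1.
have qC : (q%:R : R[i]) != 0 by rewrite pnatr_eq0.
have qR : (q%:R : R) != 0 by rewrite pnatr_eq0.
rewrite /grid_sum.
pose T v t : R[i] := e (d * Num.sqrt (s%:R + t%:R / q%:R) - v * (t%:R / q%:R)).
rewrite (eq_bigr (fun m : 'I_r => q%:R^-1 *
    \sum_(t < L * q) (T m.+1%:R t + T (- m.+1%:R) t))) => [|m _]; last first.
  by rewrite big_split/= mulrDr.
rewrite -mulr_sumr -mulrDr exchange_big/= -big_split/=.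
apply: (mulfI qC); rewrite mulVKf//.
pose g t : R := d * Num.sqrt (s%:R + t%:R / q%:R).
pose w t : R[i] := e (- (t%:R / q%:R)).
have E t : e (g t - 0 * (t%:R / q%:R)) +
    \sum_(m < r) (e (g t - m.+1%:R * (t%:R / q%:R)) + e (g t - - m.+1%:R * (t%:R / q%:R)))
    = e (g t) * (w t ^+ 0 + \sum_(m < r) (w t ^+ m.+1 + (w t)^-1 ^+ m.+1)).
  rewrite mul0r subr0 expr0 mulrDr mulr1; congr (_ + _).
  rewrite mulr_sumr; apply: eq_bigr => m _.
  have wV : (w t)^-1 = e (t%:R / q%:R).
    apply: (mulfI (expi_neq0 (- (t%:R / q%:R)))).
    by rewrite -expiD addNr expi0 mulfV// expi_neq0.
  by rewrite mulrDr wV -!expi_mulrn -!expiD mulrN mulNr opprK.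
rewrite [RHS](eq_bigr (fun t : 'I__ => e (g t) * (w t ^+ 0 +
   \sum_(m < r) (w t ^+ m.+1 + (w t)^-1 ^+ m.+1)))) => [|t _]; last exact: E.
rewrite (sum_blocks (fun t => e (g t) * (w t ^+ 0 +
   \sum_(m < r) (w t ^+ m.+1 + (w t)^-1 ^+ m.+1)))).
rewrite /rsum mulr_sumr; apply: eq_bigr => i _.
have wE (j : nat) : w (i * q + j)%N = e (- (j%:R / q%:R)).
  rewrite /w natrD natrM mulrDl mulfK// opprD expiD expiN expi_nat conjc1 mul1r.
  by [].
rewrite (bigD1 ord0)//= [X in _ = _ + X]big1 ?addr0 => [|j j0].
  rewrite wE mul0r oppr0 expi0 expr0 dirichlet_sum ?oner_eq0//.
  rewrite invr1 expr1n mul1r (eq_bigr (fun=> 1)) => [|j _]; last by rewrite expr1n.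
  rewrite sumr_const card_ord mulrC /g natrD addr0 natrM mulfK//.
  by rewrite /sqrtn natrD.
rewrite wE expr0 dirichlet_sum; last first.
  exact: expi_neq0.
rewrite (geometric_period (ltn_ord j)) ifF ?mulr0//.
by apply/eqP => h; move/eqP: j0; apply; apply/val_inj.
Qed.

Lemma grid_sum_conj s L q d v : grid_sum s L q (- d) (- v) = conj (grid_sum s L q d v).
Proof.
rewrite /grid_sum rmorphM/= fmorphV/= rmorph_nat; congr (_ * _).
rewrite conj_sum; apply: eq_bigr => t _; rewrite -expiN; congr (e _); ring.
Qed.

Lemma rsum_conj s L d : rsum s L (- d) = conj (rsum s L d).
Proof.
by rewrite /rsum conj_sum; apply: eq_bigr => t _; rewrite mulNr expiN.
Qed.

Lemma nrm_grid_sum_le s L q d v (c : R) : (0 < q)%N ->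
  nrm (\sum_(t < L * q)
     e (d * Num.sqrt (s%:R + t%:R / q%:R) - v * (t%:R / q%:R))) <= c * q%:R ->
  nrm (grid_sum s L q d v) <= c.
Proof.
move=> q0 h; rewrite /grid_sum normcM normcV nrm_nat mulrC ler_pdivrMr//.
by rewrite ltr0n.
Qed.

Lemma grid_sum_trivial s L q d v : (0 < q)%N -> nrm (grid_sum s L q d v) <= L%:R.
Proof.
move=> q0; apply: nrm_grid_sum_le => //; apply: (le_trans (nrm_sum _ _ _)).
rewrite (eq_bigr (fun=> 1)) => [|t _]; last by rewrite nrm_expi.
by rewrite sumr_const card_ord natrM.
Qed.

Lemma grid_sum00 s L r m : (m < r)%N ->
  grid_sum s L r.*2.+1 0 m.+1%:R = 0.
Proof.
move=> mr; rewrite /grid_sum; set q := r.*2.+1.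
have qR : (q%:R : R) != 0 by rewrite pnatr_eq0.
rewrite (sum_blocks (fun t => e (0 * Num.sqrt (s%:R + t%:R / q%:R)
   - m.+1%:R * (t%:R / q%:R)))) big1 ?mulr0// => i _.
rewrite (eq_bigr (fun j : 'I_q => e (- (m.+1%:R / q%:R)) ^+ j)) => [|j _].
  by rewrite geometric_period//= /q ltnS; lia.
rewrite mul0r add0r natrD natrM mulrDl mulfK// -expi_mulrn mulrDr opprD expiD.
rewrite -natrM expiN expi_nat conjc1 mul1r; congr (e _); ring.
Qed.

End DiscretePoisson.

(** * Non-stationary frequencies *)

Section NonStationary.
Variable R : realType.
Implicit Types (d v : R).

Lemma sqrt_diff (a b : R) : 0 < a -> 0 < b ->
  Num.sqrt b - Num.sqrt a = (b - a) / (Num.sqrt a + Num.sqrt b).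
Proof.
move=> a0 b0.
have := sqr_sqrtr (ltW a0); have := sqr_sqrtr (ltW b0).
have : 0 < Num.sqrt a by rewrite sqrtr_gt0.
have : 0 < Num.sqrt b by rewrite sqrtr_gt0.
move: (Num.sqrt a) (Num.sqrt b) => x y y0 x0 yE xE.
apply: (mulIf (x := x + y)); first by rewrite gt_eqF// addr_gt0.
by rewrite divfK ?gt_eqF ?addr_gt0// -xE -yE; ring.
Qed.

Section Mesh.
Variables (N s L q : nat).
Hypotheses (N0 : (0 < N)%N) (q0 : (0 < q)%N).
Hypotheses (Ns : (N <= s)%N) (sL : (s + L <= 4 * N)%N).

Let g t : R := Num.sqrt (s%:R + t%:R / q%:R).
Let rN : R := Num.sqrt N%:R.

Let qR : 0 < q%:R :> R. Proof. by rewrite ltr0n. Qed.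
Let rN0 : 0 < rN. Proof. by rewrite sqrtr_gt0 ltr0n. Qed.

Lemma mesh_ge t : rN <= g t.
Proof.
apply: ler_wsqrtr; by rewrite ler_wpDr ?divr_ge0// ler_nat.
Qed.

(** The range of t exceeds the L q terms of the sum because the differences in the
Kusmin-Landau inequality reach beyond the last term. *)
Lemma mesh_le t : (t <= L * q + 2)%N -> g t <= 3 * rN.
Proof.
move=> tL; have -> : 3 * rN = Num.sqrt ((3 ^ 2 * N)%:R).
  by rewrite natrM natrX sqrtrM ?exprn_ge0// sqrtr_sqr ger0_norm.
apply: ler_wsqrtr.
have : t%:R / q%:R <= L%:R + 2 :> R.
  rewrite ler_pdivrMr// -natrD -natrM ler_nat.
  by apply: (leq_trans tL); nia.
move=> h; apply: (@le_trans _ _ ((s + L)%:R + 2)); first by rewrite natrD -addrA lerD2l.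
by rewrite -natrD ler_nat; lia.
Qed.

Lemma mesh_stepE t : g t.+1 - g t = q%:R^-1 / (g t + g t.+1).
Proof.
rewrite sqrt_diff ?ltr_wpDr ?divr_ge0 ?ltr0n ?(leq_trans N0)//.
by congr (_ / _); rewrite -natr1 mulrDl mul1r; ring.
Qed.

Let g0 t : 0 < g t. Proof. exact: lt_le_trans rN0 (mesh_ge t). Qed.

Lemma mesh_step_bounds t : (t <= L * q)%N ->
  (6 * q%:R * rN)^-1 <= g t.+1 - g t <= (2 * q%:R * rN)^-1.
Proof.
move=> tL; rewrite mesh_stepE -invfM.
have a1 := mesh_ge t; have a2 := mesh_ge t.+1.
have b1 : g t <= 3 * rN by apply: mesh_le; lia.
have b2 : g t.+1 <= 3 * rN by apply: mesh_le; lia.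
have c1 := g0 t; have c2 := g0 t.+1.
apply/andP; split; rewrite lef_pV2 ?posrE ?mulr_gt0 ?addr_gt0//.
  by move: (q%:R : R) qR => x x0; rewrite mulrAC [6 * _ * _]mulrC ler_wpM2l ?(ltW x0)//; lra.
by move: (q%:R : R) qR => x x0; rewrite mulrAC [2 * _ * _]mulrC ler_wpM2l ?(ltW x0)//; lra.
Qed.

Lemma mesh_step_decr t : g t.+2 - g t.+1 <= g t.+1 - g t.
Proof.
rewrite !mesh_stepE ler_wpM2l ?invr_ge0 ?(ltW qR)//.
rewrite lef_pV2 ?posrE ?addr_gt0// [leLHS]addrC lerD2l.
apply: ler_wsqrtr.
by rewrite lerD2l ler_wpM2r ?invr_ge0 ?(ltW qR)// ler_nat; lia.
Qed.

(** The frequency nu = 0: the derivative d / (2 sqrt x) is of order d / sqrt N and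
never vanishes. *)
Lemma grid_sum0_bound d : 0 < d -> d <= q%:R ->
  nrm (grid_sum s L q d 0) <= 108 * rN / d.
Proof.
move=> d0 dq; apply: nrm_grid_sum_le => //.
rewrite (eq_bigr (fun t : 'I__ => e (d * g t))) => [|t _]; last by rewrite mul0r subr0.
have rN1 : 1 <= rN by rewrite -[1]sqrtr1; apply: ler_wsqrtr; rewrite ler1n.
pose theta := d * (6 * q%:R * rN)^-1.
have th0 : 0 < theta by rewrite mulr_gt0// invr_gt0 !mulr_gt0.
have -> : 108 * rN / d * q%:R = 18 / theta.
  by rewrite /theta invfM invrK; field; rewrite gt_eqF.
apply: (@kusmin_landau R (fun t => d * g t)) => // [t tL|].
- rewrite -mulrBr /theta; have /andP[h1 h2] := mesh_step_bounds tL.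
  rewrite ler_wpM2l ?(ltW d0)//=.
  apply: (@le_trans _ _ (d * (2 * q%:R * rN)^-1)); first by rewrite ler_wpM2l// ltW.
  rewrite ler_pdivrMr ?mulr_gt0//.
  have : 0 < q%:R :> R by [].
  by move: (q%:R : R) dq => x dx x0; nra.
- by right => t _; rewrite -!mulrBr ler_wpM2l ?mesh_step_decr// ltW.
Qed.

(** Once m >= d / sqrt N the derivative d / (2 sqrt x) is at most m / 2, so the phases
d sqrt x - m x and d sqrt x + m x both have derivative of order m. *)
Lemma grid_sum_far d m : 0 < d -> (0 < m)%N -> (2 * m <= q)%N ->
  d <= m%:R * rN ->
  nrm (grid_sum s L q d m%:R) + nrm (grid_sum s L q d (- m%:R)) <= 54 / m%:R.
Proof.
move=> d0 m0 mq dm.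
have mR : 0 < m%:R :> R by rewrite ltr0n.
have mqR : 2 * m%:R <= q%:R :> R by rewrite -natrM ler_nat.
have st t : (t <= L * q)%N -> 0 <= d * (g t.+1 - g t) <= m%:R / q%:R / 2.
  move=> tL; have /andP[h1 h2] := mesh_step_bounds tL.
  rewrite mulr_ge0 ?(ltW d0)//=; last first.
    by apply: le_trans h1; rewrite invr_ge0 !mulr_ge0// ltW.
  apply: (@le_trans _ _ (m%:R * rN * (2 * q%:R * rN)^-1)).
    rewrite ler_pM ?(ltW d0)//.
    by apply: le_trans h1; rewrite invr_ge0 !mulr_ge0// ltW.
  rewrite le_eqVlt; apply/orP; left; apply/eqP; field.
  by rewrite !gt_eqF.
have mq1 : m%:R / q%:R <= 2^-1 :> R by rewrite ler_pdivrMr//; lra.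
have mq0 : 0 < m%:R / q%:R :> R by rewrite divr_gt0.
have qS (t : nat) : t.+1%:R / q%:R = t%:R / q%:R + q%:R^-1 :> R.
  by rewrite -natr1 mulrDl mul1r.
have dd t : d * (g t.+2 - g t.+1) <= d * (g t.+1 - g t).
  by rewrite ler_wpM2l ?mesh_step_decr// ltW.
have -> : 54 / m%:R = 36 / m%:R + 18 / m%:R :> R by field; rewrite gt_eqF.
apply: lerD; apply: nrm_grid_sum_le => //.
- rewrite -nrm_conj conj_sum.
  pose f t : R := m%:R * (t%:R / q%:R) - d * g t.
  have fE t : f t.+1 - f t = m%:R / q%:R - d * (g t.+1 - g t).
    by rewrite /f qS; ring.
  rewrite (eq_bigr (fun t : 'I__ => e (f t))) => [|t _]; last first.
    by rewrite -expiN opprB.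
  have -> : 36 / m%:R * q%:R = 18 / (m%:R / q%:R / 2) :> R.
    by field; rewrite !gt_eqF.
  apply: kusmin_landau => [|t tL|]; first by rewrite divr_gt0.
    by rewrite fE; have /andP[] := st t tL; lra.
  by left => t _; rewrite !fE; have := dd t; lra.
- pose f t : R := d * g t + m%:R * (t%:R / q%:R).
  have fE t : f t.+1 - f t = m%:R / q%:R + d * (g t.+1 - g t).
    by rewrite /f qS; ring.
  rewrite (eq_bigr (fun t : 'I__ => e (f t))) => [|t _]; last first.
    by rewrite mulNr opprK.
  have -> : 18 / m%:R * q%:R = 18 / (m%:R / q%:R) :> R.
    by field; rewrite !gt_eqF.
  apply: kusmin_landau => [//|t tL|].
    by rewrite fE; have /andP[] := st t tL; lra.
  by right => t _; rewrite !fE; have := dd t; lra.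
Qed.

End Mesh.

(** What remains of the exponential sum after removing the frequencies
1 <= |nu| <= V. *)
Definition main_error s L r V d : R[i] := rsum s L d -
  \sum_(m < V) (grid_sum s L r.*2.+1 d m.+1%:R + grid_sum s L r.*2.+1 d (- m.+1%:R)).

Lemma main_error_conj s L r V d : main_error s L r V (- d) = conj (main_error s L r V d).
Proof.
rewrite /main_error rmorphB/= rsum_conj; congr (_ - _).
rewrite conj_sum; apply: eq_bigr => m _; rewrite rmorphD/= -!grid_sum_conj opprK addrC.
by [].
Qed.

(** The frequency 0 is estimated by the geometric mean of the trivial bound L and of
the Kusmin-Landau bound sqrt N / |d|; the trivial bound is needed when L is shorter
than sqrt N, so that the sum over d remains proportional to L. *)
Lemma main_error_bound N s L r V d : (0 < N)%N -> (N <= s)%N -> (s + L <= 4 * N)%N ->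
  (V <= r)%N -> 0 < `|d| -> `|d| <= V%:R * Num.sqrt N%:R -> `|d| <= r%:R ->
  nrm (main_error s L r V d) ^+ 2 <=
    216 * L%:R * Num.sqrt N%:R / `|d| + 5832 * harm R r ^+ 2.
Proof.
move=> N0 Ns sL Vr.
wlog d0 : d / 0 <= d.
  move=> H d0 dV dr; have [dp|dn] := leP 0 d; first exact: H.
  by have := H (- d); rewrite main_error_conj nrm_conj normrN; apply; rewrite // oppr_ge0 ltW.
rewrite (ger0_norm d0) => dp dV dr.
set q := r.*2.+1; set rN := Num.sqrt N%:R.
have q0 : (0 < q)%N by [].
have rN0 : 0 < rN by rewrite sqrtr_gt0 ltr0n.
have E : main_error s L r V d = grid_sum s L q d 0 + \sum_(V <= m < r)
     (grid_sum s L q d m.+1%:R + grid_sum s L q d (- m.+1%:R)).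
  rewrite /main_error (discrete_poisson s L r) -/q.
  rewrite -!(big_mkord xpredT (fun m => grid_sum s L q d m.+1%:R + grid_sum s L q d (- m.+1%:R))).
  by rewrite (big_cat_nat (n := V))//=; ring.
have B2 : nrm (\sum_(V <= m < r)
     (grid_sum s L q d m.+1%:R + grid_sum s L q d (- m.+1%:R))) <= 54 * harm R r.
  apply: (le_trans (nrm_sum _ _ _)).
  apply: (@le_trans _ _ (\sum_(V <= m < r) 54 / m.+1%:R)).
    rewrite big_nat_cond [leRHS]big_nat_cond; apply: ler_sum => m /andP[/andP[Vm mr] _].
    apply: (le_trans (nrmD _ _)); apply: (grid_sum_far (N := N)) => //.
      by rewrite /q -mul2n; lia.
    apply: (le_trans dV); rewrite ler_wpM2r ?(ltW rN0)// ler_nat; lia.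
  rewrite -mulr_sumr ler_wpM2l// /harm -(big_mkord xpredT (fun m => (m.+1%:R)^-1)).
  by rewrite [leRHS](big_cat_nat (n := V))//= lerDr sumr_ge0.
have B1 : nrm (grid_sum s L q d 0) <= L%:R by exact: grid_sum_trivial.
have B1' : nrm (grid_sum s L q d 0) <= 108 * rN / d.
  apply: (grid_sum0_bound (N := N)) => //; apply: (le_trans dr).
  by rewrite ler_nat /q; lia.
have T := nrmD (grid_sum s L q d 0) (\sum_(V <= m < r)
     (grid_sum s L q d m.+1%:R + grid_sum s L q d (- m.+1%:R))).
rewrite -E in T.
have n0 := nrm_ge0 (grid_sum s L q d 0).
have n1 := nrm_ge0 (main_error s L r V d).
have h0 := harm_ge0 R r.
have -> : 216 * L%:R * rN / d = 2 * (L%:R * (108 * rN / d)) by ring.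
have S : nrm (grid_sum s L q d 0) ^+ 2 <= L%:R * (108 * rN / d).
  by rewrite expr2 ler_pM.
move: S T B2 n0 n1 h0.
set x := nrm (grid_sum _ _ _ _ _); set y := nrm (\sum_(V <= m < r) _).
set z := nrm (main_error _ _ _ _ _); set h := harm R r.
move=> S T B2 x0 z0 h0.
have : z <= x + 54 * h by lra.
by have := sqr_ge0 (x - 54 * h); nra.
Qed.

End NonStationary.

(** * The Fejer kernel *)

Section Fejer.
Variables (R : realType) (Lam : nat).
Implicit Types (u y : R).

Definition dirichlet y : R[i] := \sum_(i < Lam) e (i%:R * y).

Definition fejer y : R := nrm (dirichlet y) ^+ 2.

Lemma fejerE y : ((fejer y)%:C)%C = \sum_(i < Lam) \sum_(j < Lam) e ((i%:R - j%:R) * y).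
Proof.
rewrite /fejer -mul_conj conj_sum big_distrlr/=.
by apply: eq_bigr => i _; apply: eq_bigr => j _; rewrite mulrBl expiB.
Qed.

Lemma dirichlet_periodic y (k : nat) : dirichlet (y + k%:R) = dirichlet y.
Proof.
by apply: eq_bigr => i _; rewrite mulrDr expiD -natrM expi_nat mulr1.
Qed.

Lemma fejer_periodic y (k : nat) : fejer (y + k%:R) = fejer y.
Proof. by rewrite /fejer dirichlet_periodic. Qed.

Lemma dirichlet_le y : nrm (dirichlet y) <= Lam%:R.
Proof.
apply: (le_trans (nrm_sum _ _ _)); rewrite (eq_bigr (fun=> 1)) => [|i _].
  by rewrite sumr_const card_ord.
exact: nrm_expi.
Qed.

Lemma dirichlet_lip y y' :
  nrm (dirichlet y - dirichlet y') <= 8 * Lam%:R ^+ 2 * `|y - y'|.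
Proof.
rewrite /dirichlet -sumrB; apply: (le_trans (nrm_sum _ _ _)).
apply: (@le_trans _ _ (\sum_(i < Lam) 8 * Lam%:R * `|y - y'|)).
  apply: ler_sum => i _; apply: (le_trans (expi_lip _ _)).
  rewrite -mulrBr normrM ger0_norm// -mulrA ler_wpM2l// ler_wpM2r//.
  by rewrite ler_nat ltnW.
by rewrite sumr_const card_ord -[_ *+ _]mulr_natr le_eqVlt; apply/orP; left; apply/eqP; ring.
Qed.

Lemma fejer_diff y y' : `|fejer y - fejer y'| <=
  nrm (dirichlet y - dirichlet y') * (nrm (dirichlet y) + nrm (dirichlet y')).
Proof.
rewrite /fejer subr_sqr normrM ler_pM ?nrm_dist//.
by rewrite ger0_norm// addr_ge0 ?nrm_ge0.
Qed.

Lemma fejer_lip y y' : `|fejer y - fejer y'| <= 16 * Lam%:R ^+ 3 * `|y - y'|.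
Proof.
apply: (le_trans (fejer_diff y y')).
apply: (@le_trans _ _ ((8 * Lam%:R ^+ 2 * `|y - y'|) * (Lam%:R + Lam%:R))).
  rewrite ler_pM ?nrm_ge0 ?addr_ge0 ?nrm_ge0 ?dirichlet_lip//.
  by rewrite lerD ?dirichlet_le.
by rewrite le_eqVlt; apply/orP; left; apply/eqP; ring.
Qed.

Lemma dirichlet_geometric y : (e y - 1) * dirichlet y = e (Lam%:R * y) - 1.
Proof.
rewrite expi_mulrn subrX1; congr (_ * _).
by apply: eq_bigr => i _; rewrite expi_mulrn.
Qed.

Lemma dirichlet_decay u : 0 < `|u| <= 2^-1 -> nrm (dirichlet u) * `|u| <= 2.
Proof.
move=> /andP[u0 u12].
have := congr1 (@Normc.normc R) (dirichlet_geometric u); rewrite normcM => E.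
have l : `|u| <= nrm (e u - 1) by apply: expi_lower_abs; lra.
have : nrm (e (Lam%:R * u) - 1) <= 2.
  by rewrite (le_trans (nrmB _ _))// nrm_expi normc1.
rewrite -E; apply: le_trans; rewrite mulrC ler_wpM2r ?nrm_ge0//.
Qed.

(** Multiplying by e(u) - 1 turns the Dirichlet kernel into e(Lam u) - 1, which is
Lipschitz with constant of order Lam instead of Lam^2. *)
Lemma dirichlet_diff_decay u u' : 0 < `|u| <= 2^-1 ->
  nrm (dirichlet u - dirichlet u') * `|u| <= 16 * Lam%:R * `|u - u'|.
Proof.
move=> /andP[u0 u12].
have l : `|u| <= nrm (e u - 1) by apply: expi_lower_abs; lra.
have E : (e u - 1) * (dirichlet u - dirichlet u') =
   (e (Lam%:R * u) - e (Lam%:R * u')) - (e u - e u') * dirichlet u'.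
  have := dirichlet_geometric u; have := dirichlet_geometric u' => E' E1.
  have -> : e (Lam%:R * u) - e (Lam%:R * u') = (e u - 1) * dirichlet u - (e u' - 1) * dirichlet u'.
    by rewrite E' E1; ring.
  ring.
have := congr1 (@Normc.normc R) E; rewrite normcM => E2.
apply: (@le_trans _ _ (nrm (e u - 1) * nrm (dirichlet u - dirichlet u'))).
  by rewrite mulrC ler_wpM2r ?nrm_ge0.
rewrite E2; apply: (le_trans (nrmB _ _)); rewrite normcM.
have -> : 16 * Lam%:R * `|u - u'| = 8 * (Lam%:R * `|u - u'|) + (8 * `|u - u'|) * Lam%:R by ring.
apply: lerD.
  by apply: (le_trans (expi_lip _ _)); rewrite -mulrBr normrM ger0_norm.
by rewrite ler_pM ?nrm_ge0 ?expi_lip ?dirichlet_le.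
Qed.

(** The weight 1 + 3 Lam |u| is the loss in the later partial summation over b.  The
increments of the kernel are bounded both by Lam^2 / |u| and by Lam / u^2, and the
second bound absorbs the weight when |u| > 1/Lam. *)
Lemma fejer_diff_decay u u' : 0 < `|u| <= 2^-1 -> Lam%:R * `|u - u'| <= 1 ->
  `|fejer u - fejer u'| * (1 + 3 * Lam%:R * `|u|) <=
  1120 * Lam%:R ^+ 2 * `|u - u'| / `|u|.
Proof.
move=> hu hL; have /andP[u0 _] := hu.
have a1 := dirichlet_decay hu; have a2 := dirichlet_diff_decay u' hu.
have a3 := dirichlet_lip u u'.
have a4 : nrm (dirichlet u') * `|u| <= 18.
  have : nrm (dirichlet u') <= nrm (dirichlet u) + nrm (dirichlet u - dirichlet u').
    rewrite -{1}[dirichlet u'](subKr (dirichlet u)) opprB addrC.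
    by rewrite (le_trans (nrmD _ _))// addrC nrm_subC.
  have := ler_wpM2r (ltW u0); move=> h /h; rewrite mulrDl => h2.
  have : 16 * Lam%:R * `|u - u'| <= 16 by rewrite -mulrA; lra.
  move: (nrm _ * _) (nrm _ * _) a1 a2 h2 => x y; lra.
have F := fejer_diff u u'.
rewrite ler_pdivlMr//.
have n1 := nrm_ge0 (dirichlet u - dirichlet u').
have n2 := nrm_ge0 (dirichlet u); have n3 := nrm_ge0 (dirichlet u').
set x := nrm (dirichlet u - dirichlet u') in a2 a3 F n1 *.
have b : (nrm (dirichlet u) + nrm (dirichlet u')) * `|u| <= 20 by rewrite mulrDl; lra.
set z := _ + _ in b F.
have z0 : 0 <= z by rewrite addr_ge0.
have b0 : 0 <= z * `|u| by rewrite mulr_ge0// ltW.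
apply: (@le_trans _ _ (x * z * (1 + 3 * Lam%:R * `|u|) * `|u|)).
  rewrite ler_wpM2r ?(ltW u0)// ler_wpM2r// addr_ge0// !mulr_ge0// ltW.
have -> : x * z * (1 + 3 * Lam%:R * `|u|) * `|u| =
   x * (z * `|u|) + 3 * Lam%:R * (x * `|u|) * (z * `|u|) by ring.
have -> : 1120 * Lam%:R ^+ 2 * `|u - u'| = 8 * Lam%:R ^+ 2 * `|u - u'| * 20
   + 3 * Lam%:R * (16 * Lam%:R * `|u - u'|) * 20 by ring.
apply: lerD; first by rewrite ler_pM.
rewrite ler_pM ?mulr_ge0 ?(ltW u0)//.
by rewrite ler_wpM2l// mulr_ge0.
Qed.

(** The points of (1/(2Q)) Z in the period (-1/2, 1/2]. *)
Definition node Q l : R := (l.+1%:R - Q%:R) / (Q.*2)%:R.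

Lemma node_abs Q l : (0 < Q)%N -> (l < Q.*2)%N -> `|node Q l| <= 2^-1.
Proof.
move=> Q0 lQ; have Q2 : 0 < (Q.*2)%:R :> R by rewrite ltr0n double_gt0.
rewrite /node normrM normfV [`|(Q.*2)%:R|]gtr0_norm// ler_pdivrMr//.
rewrite -mul2n natrM mulrA mulVf// mul1r ler_norml; apply/andP; split.
  by rewrite lerBrDl subrr.
by rewrite lerBlDr -natrD ler_nat addnn.
Qed.

(** The weighted total variation of the kernel over one period is of the same order
Lam^2 as the unweighted one, up to a logarithm: at distance i/(2Q) from 0 the
increment contributes Lam^2 / i.  The increment at 0 itself is bounded by the
Lipschitz constant, and this uses Q >= Lam. *)
Lemma fejer_variation Q (ell : R) : (Lam <= Q)%N -> (0 < Q)%N -> 1 <= ell ->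
  harm R Q <= ell ->
  \sum_(l < Q.*2) `|fejer (node Q l) - fejer (node Q l - ((Q.*2)%:R)^-1)|
     * (1 + 3 * Lam%:R * `|node Q l|) <= 2256 * Lam%:R ^+ 2 * ell.
Proof.
move=> LQ Q0 ell1 ellQ.
have Q2 : 0 < (Q.*2)%:R :> R by rewrite ltr0n double_gt0.
have QR : 0 < Q%:R :> R by rewrite ltr0n.
have LQR : Lam%:R <= (Q.*2)%:R :> R by rewrite ler_nat -addnn (leq_trans LQ)// leq_addr.
pose a l := `|fejer (node Q l) - fejer (node Q l - ((Q.*2)%:R)^-1)|
     * (1 + 3 * Lam%:R * `|node Q l|).
have step l : node Q l - (node Q l - ((Q.*2)%:R)^-1) = ((Q.*2)%:R)^-1 by ring.
have iQ : `|((Q.*2)%:R)^-1| = ((Q.*2)%:R)^-1 :> R by rewrite gtr0_norm ?invr_gt0.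
have off l i : (l < Q.*2)%N -> `|node Q l| = i.+1%:R / (Q.*2)%:R ->
    a l <= 1120 * Lam%:R ^+ 2 / i.+1%:R.
  move=> lQ E; have n0 : 0 < `|node Q l| by rewrite E divr_gt0.
  have := @fejer_diff_decay (node Q l) (node Q l - ((Q.*2)%:R)^-1).
  rewrite step iQ n0 node_abs// ler_pdivrMr// mul1r => /(_ isT LQR) H.
  apply: (le_trans H); rewrite E le_eqVlt; apply/orP; left; apply/eqP.
  by have : i.+1%:R != 0 :> R by []; move: (i.+1%:R : R) => x x0; field; rewrite x0 gt_eqF.
have zero l : l.+1 = Q -> a l <= 16 * Lam%:R ^+ 2.
  move=> E; rewrite /a; have -> : node Q l = 0 by rewrite /node E subrr mul0r.
  rewrite normr0 mulr0 addr0 mulr1; apply: (le_trans (fejer_lip _ _)).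
  rewrite !sub0r opprK iQ exprSr mulrA -[leRHS]mulr1 -mulrA ler_wpM2l//.
  by rewrite ler_pdivrMr// mul1r.
have split : \sum_(l < Q.*2) a l =
    \sum_(i < Q.-1) a (Q.-1 - i.+1)%N + a Q.-1 + \sum_(i < Q) a (Q + i)%N.
  rewrite -addnn big_split_ord/=; congr (_ + _).
  have -> : \sum_(i < Q) a i = \sum_(i < Q.-1) a i + a Q.-1.
    by case: (Q) Q0 => // n _; rewrite big_ord_recr.
  congr (_ + _); rewrite (reindex_inj rev_ord_inj)/=.
  by apply: eq_bigr.
change (\sum_(l < Q.*2) a l <= 2256 * Lam%:R ^+ 2 * ell); rewrite split.
have [C CE] : exists C : R, C = 1120 * Lam%:R ^+ 2 by eexists.
have C0 : 0 <= C by rewrite CE; apply: mulr_ge0; [exact: ler0n | exact: exprn_ge0].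
rewrite -CE in off.
have s1 : \sum_(i < Q) a (Q + i)%N <= C * ell.
  apply: (@le_trans _ _ (C * harm R Q)); last by rewrite ler_wpM2l.
  rewrite /harm mulr_sumr; apply: ler_sum => i _; apply: off.
    by rewrite -addnn ltn_add2l.
  rewrite /node -addnS natrD addrC addKr ger0_norm// divr_ge0//.
have s2 : \sum_(i < Q.-1) a (Q.-1 - i.+1)%N <= C * ell.
  apply: (@le_trans _ _ (C * harm R Q.-1)).
    rewrite /harm mulr_sumr; apply: ler_sum => i _; apply: off; first lia.
    have iQ' := ltn_ord i.
    rewrite /node; have -> : (Q.-1 - i.+1).+1 = (Q - i.+1)%N by lia.
    rewrite natrB; last by lia.
    rewrite -normrN -mulNr opprB opprB addrC subrK ger0_norm ?divr_ge0//.
  rewrite ler_wpM2l //; apply: le_trans ellQ; apply: harm_mono; exact: leq_pred.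
have s3 := zero Q.-1 (prednK Q0).
have : 16 * Lam%:R ^+ 2 <= 16 * Lam%:R ^+ 2 * ell by rewrite ler_peMr// mulr_ge0.
rewrite CE in s1 s2; lra.
Qed.

End Fejer.

(** * Step functions and thresholds *)

Section StepFunction.
Variable R : realType.
Variables (F : R -> R) (A y0 dlt : R) (J : nat).
Hypotheses (FA : forall x y, `|F x - F y| <= A * `|x - y|) (dlt0 : 0 < dlt) (A0 : 0 <= A).

Definition knot j : R := y0 + j%:R * dlt.

Definition jump j : R := F (knot j.+1) - F (knot j).

(** F sampled at the left end of each cell, written as a sum of jumps so that the order
of summation can be exchanged with a sum over points z. *)
Definition stepf (z : R) : R := F y0 + \sum_(j < J) (knot j.+1 <= z)%R%:R * jump j.

Lemma sum_ord_lt (V : zmodType) (f : nat -> V) n p : (p <= n)%N ->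
  \sum_(j < n) f j *+ (j < p)%N = \sum_(j < p) f j.
Proof.
move=> pn; rewrite -(subnKC pn) big_split_ord/= [X in _ + X]big1 => [|j _].
  by rewrite addr0; apply: eq_bigr => j _; rewrite ltn_ord.
by rewrite ltnNge leq_addr.
Qed.

Lemma stepf_approx z : y0 <= z <= knot J -> `|F z - stepf z| <= A * dlt.
Proof.
move=> /andP[h0 hJ].
pose p := Num.truncn ((z - y0) / dlt).
have x0 : 0 <= (z - y0) / dlt by rewrite divr_ge0 ?subr_ge0// ltW.
have /andP[p1 p2] := truncn_itv x0.
rewrite -/p in p1 p2.
have p1' : p%:R * dlt <= z - y0 by rewrite -ler_pdivlMr.
have p2' : z - y0 < p.+1%:R * dlt by rewrite -ltr_pdivrMr.
have pJ : (p <= J)%N.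
  rewrite -(ler_nat R) -(ler_pM2r dlt0); apply: (le_trans p1').
  by rewrite lerBlDl.
have iff j : (knot j.+1 <= z) = (j < p)%N.
  rewrite /knot -lerBrDl; apply/idP/idP => h.
    rewrite ltnNge; apply/negP => pj.
    have : j.+1%:R * dlt < p.+1%:R * dlt by apply: le_lt_trans p2'.
    by rewrite ltr_pM2r// ltr_nat ltnS ltnNge pj.
  by apply: le_trans p1'; rewrite ler_pM2r// ler_nat.
have -> : stepf z = F (knot p).
  rewrite /stepf (eq_bigr (fun j : 'I_J => jump j *+ (j < p)%N)) => [|j _]; last first.
    by rewrite iff mulr_natl.
  rewrite sum_ord_lt// -(big_mkord xpredT jump) telescope_sumr//.
  by rewrite /knot mul0r addr0 addrC subrK.
apply: (le_trans (FA _ _)); rewrite ler_wpM2l// /knot ger0_norm.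
  by move: p2'; rewrite -natr1 mulrDl mul1r; lra.
by rewrite subr_ge0 -lerBrDl.
Qed.

End StepFunction.

Section Thresholds.

Definition threshold M (p : pred nat) := find p (iota 0 M).

Lemma threshold_le M p : (threshold M p <= M)%N.
Proof. by rewrite /threshold -[leqRHS](size_iota 0) find_size. Qed.

Lemma thresholdP M (p : pred nat) :
  (forall t, (t.+1 < M)%N -> p t -> p t.+1) ->
  forall t, (t < M)%N -> p t = (threshold M p <= t)%N.
Proof.
move=> pS t tM; have [h|h] := leqP (threshold M p) t; last first.
  have := before_find 0%N h; rewrite nth_iota// ?add0n// .
have fM : (threshold M p < M)%N by apply: leq_ltn_trans tM.
have pf : p (threshold M p).
  have hp : has p (iota 0 M) by rewrite has_find size_iota.
  by have := nth_find 0%N hp; rewrite nth_iota.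
have up n : (threshold M p + n < M)%N -> p (threshold M p + n)%N.
  elim: n => [|n IH]; first by rewrite addn0.
  by rewrite addnS => nM; apply: pS => //; apply: IH; exact: ltnW.
by have := up (t - threshold M p)%N; rewrite subnKC// => ->.
Qed.

End Thresholds.

(** * One dual frequency *)

Section DualTerm.
Variable R : realType.

(** Summing the twist over the mesh points beyond a jump: since the sum over a whole
number of periods vanishes, only the position t0 of the jump survives. *)
Lemma geometric_tail (w : R[i]) M t0 : w != 1 -> w ^+ M = 1 -> (t0 <= M)%N ->
  \sum_(t < M) (t0 <= t)%N%:R * w ^+ t = (w ^+ t0 - 1) / (1 - w).
Proof.
move=> w1 twist_period tM; have w1' : 1 - w != 0 by rewrite subr_eq0 eq_sym.
have S n : \sum_(t < n) w ^+ t = (1 - w ^+ n) / (1 - w).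
  apply: (mulIf w1'); rewrite divfK// -[1 - w ^+ n]opprB subrX1.
  by move: (\sum_(i < n) _) => x; ring.
have : \sum_(t < M) w ^+ t = 0 by rewrite S twist_period subrr mul0r.
rewrite (eq_bigr (fun t : 'I_M => (t0 <= t)%N%:R * w ^+ t + w ^+ t *+ (t < t0)%N)).
  rewrite big_split/= (sum_ord_lt (fun t => w ^+ t))// S => /eqP.
  by rewrite addr_eq0 => /eqP ->; rewrite -mulNr opprB.
by move=> t _; rewrite ltnNge; case: (t0 <= t)%N; rewrite /= ?mul1r ?mul0r ?mulr0n ?addr0 ?add0r.
Qed.

Lemma sum_window (f : nat -> R[i]) L lo hi : (hi <= L)%N ->
  \sum_(b < L) ((lo <= b) && (b < hi))%N%:R * f b =
  \sum_(b < hi) f b - \sum_(b < minn lo hi) f b.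
Proof.
move=> hiL; have mL : (minn lo hi <= L)%N by rewrite geq_min hiL orbT.
rewrite -(sum_ord_lt f hiL) -(sum_ord_lt f mL) -sumrB; apply: eq_bigr => b _.
rewrite leq_min (leqNgt lo); case: (b < lo)%N; case: (b < hi)%N => /=;
  by rewrite ?mul1r ?mul0r ?mulr1n ?mulr0n ?subrr ?subr0.
Qed.

(** Multiplication by the slowly varying factor e(z sqrt b) costs the total variation
of its phase. *)
Lemma prefix_twist s L n (x z : R) : (n <= L)%N ->
  nrm (\sum_(b < n) e (x * sqrtn R (s + b)) * e (z * sqrtn R (s + b)))
  <= rmax s L x * (1 + 8 * `|z| * (sqrtn R (s + n) - sqrtn R s)).
Proof.
move=> nL.
have sqm a b : (a <= b)%N -> sqrtn R a <= sqrtn R b.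
  by move=> ab; apply: ler_wsqrtr; rewrite ler_nat.
have H := @abel_bound R (fun b => e (x * sqrtn R (s + b))) (fun b => e (z * sqrtn R (s + b)))
   n (rmax s L x) 1.
apply: (le_trans (H _ _)).
- by move=> m mn; apply: rmax_ge; exact: leq_trans nL.
- by rewrite nrm_expi.
rewrite ler_wpM2l ?rmax_ge0// lerD2l.
apply: (@le_trans _ _ (\sum_(i < n) 8 * `|z| * (sqrtn R (s + i.+1) - sqrtn R (s + i)))).
  apply: ler_sum => i _; apply: (le_trans (expi_lip _ _)).
  have p : 0 <= sqrtn R (s + i.+1) - sqrtn R (s + i) by rewrite subr_ge0 sqm// leq_add2l.
  by rewrite -mulrBr normrM (ger0_norm p) mulrA.
rewrite -mulr_sumr -(big_mkord xpredT (fun i => sqrtn R (s + i.+1) - sqrtn R (s + i))).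
by rewrite (telescope_sumr (fun i => sqrtn R (s + i)))// addn0.
Qed.

Lemma rmaxN s L (x : R) : rmax s L (- x) = rmax s L x.
Proof.
by rewrite /rmax; apply: eq_bigr => m _; rewrite rsum_conj nrm_conj.
Qed.

Lemma rmax0_le s L : rmax s L 0 <= L%:R :> R.
Proof.
apply: rmax_le => // m mL; apply: (le_trans (nrm_sum _ _ _)).
rewrite (eq_bigr (fun=> 1)) => [|i _]; last by rewrite nrm_expi.
by rewrite sumr_const card_ord ler_nat.
Qed.

Lemma sum_symmetric (f : R -> R) K : (forall x, f (- x) = f x) ->
  \sum_(k < K.*2.+1) f (k%:R - K%:R) = f 0 + 2 * \sum_(k < K) f k.+1%:R.
Proof.
move=> fN.
have -> : (K.*2.+1 = K + K.+1)%N by lia.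
rewrite big_split_ord/= big_ord_recl/= addn0 subrr addrCA; congr (_ + _).
rewrite mulr2n mulrDl mul1r; congr (_ + _).
  rewrite (reindex_inj rev_ord_inj)/=; apply: eq_bigr => k _.
  by rewrite -fN opprB natrB ?ltn_ord// subKr.
by apply: eq_bigr => k _; rewrite /bump/= add1n natrD addrAC subrr add0r.
Qed.

Lemma sqrtn_spread N s L : (0 < N)%N -> (N <= s)%N ->
  (sqrtn R (s + L) - sqrtn R s) * (2 * Num.sqrt N%:R) <= L%:R.
Proof.
move=> N0 Ns.
have rN0 : 0 < Num.sqrt N%:R :> R by rewrite sqrtr_gt0 ltr0n.
have a1 : Num.sqrt N%:R <= Num.sqrt s%:R :> R by apply: ler_wsqrtr; rewrite ler_nat.
have a2 : Num.sqrt N%:R <= Num.sqrt (s + L)%:R :> R.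
  by apply: ler_wsqrtr; rewrite ler_nat (leq_trans Ns)// leq_addr.
have s0 : (0 < s)%N by exact: leq_trans Ns.
rewrite /sqrtn sqrt_diff ?ltr0n ?addn_gt0 ?s0// -natrB ?leq_addr// addKn.
rewrite mulrAC ler_pdivrMr ?addr_gt0 ?(lt_le_trans rN0)//.
by rewrite ler_wpM2l//; lra.
Qed.

Lemma sqrtn_spread_le N s L K : (0 < N)%N -> (N <= s)%N -> (L ^ 2 < K.+1 ^ 2 * N)%N ->
  sqrtn R (s + L) - sqrtn R s <= (K%:R + 1) / 2.
Proof.
move=> N0 Ns KL; have rN0 : 0 < Num.sqrt N%:R :> R by rewrite sqrtr_gt0 ltr0n.
have h := sqrtn_spread L N0 Ns.
have a5 : L%:R <= (K%:R + 1) * Num.sqrt N%:R :> R.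
  rewrite -(ler_pXn2r (n := 2)) ?nnegrE ?mulr_ge0 ?addr_ge0 ?(ltW rN0)//.
  by rewrite exprMn sqr_sqrtr// natr1 -!natrX -natrM ler_nat ltnW.
rewrite -(ler_pM2r rN0); lra.
Qed.

Lemma sqrtn_spread_N N s L : (0 < N)%N -> (N <= s)%N -> (6 * L <= N)%N ->
  sqrtn R (s + L) - sqrtn R s <= Num.sqrt N%:R / 12.
Proof.
move=> N0 Ns LN; have rN0 : 0 < Num.sqrt N%:R :> R by rewrite sqrtr_gt0 ltr0n.
have h := sqrtn_spread L N0 Ns.
have a4 : 6 * L%:R <= Num.sqrt N%:R * Num.sqrt N%:R :> R.
  by rewrite -expr2 sqr_sqrtr// -natrM ler_nat.
rewrite -(ler_pM2r rN0); lra.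
Qed.

Section Fixed.
Variables (N s L K Lam Q r m : nat) (Omega : R).
Hypotheses (N0 : (0 < N)%N) (Ns : (N <= s)%N).
Hypotheses (L0 : (0 < L)%N) (LN : (6 * L <= N)%N).
Hypotheses (KL : (L ^ 2 < K.+1 ^ 2 * N)%N).
Hypotheses (Q0 : (0 < Q)%N) (m0 : (0 < m)%N) (mr : (m <= r)%N).
Hypotheses (mLam : m%:R * Num.sqrt N%:R <= 2 * Lam%:R :> R).
Hypotheses (OmegaP : \sum_(l < Q.*2)
  `|fejer Lam (node R Q l) - fejer Lam (node R Q l - ((Q.*2)%:R)^-1)|
     * (1 + 3 * Lam%:R * `|node R Q l|) <= Omega).

Let q := r.*2.+1.
Let M := (L * q)%N.
Let F := @fejer R Lam.
Let A : R := 16 * Lam%:R ^+ 3.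
Let dlt : R := ((Q.*2)%:R)^-1.
Let y0 : R := - K%:R - 2^-1.
Let J := (K.*2.+1 * Q.*2)%N.
Let g t : R := Num.sqrt (s%:R + t%:R / q%:R).
Let beta b : R := sqrtn R (s + b).
Let w : R[i] := e (- (m%:R / q%:R)).
Let y j := knot y0 dlt j.+1.
Let jmp := jump F y0 dlt.
Let stp := stepf F y0 dlt J.

(** The contribution of the dual frequency nu = m to the sum of |S(i - j)|^2 over all
i, j < Lam.  The pair (i, j) runs over the frequency h = i - j with the Fejer weight
Lam - |h|. *)
Definition dual_term : R[i] := \sum_(i < Lam) \sum_(j < Lam)
  conj (rsum s L (i%:R - j%:R : R)) * grid_sum s L q (i%:R - j%:R : R) m%:R.

(** The trivial bound for the sum over b of the Fejer kernel at x - sqrt b, for every x. *)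
Definition total_mass : R := \sum_(i < Lam) \sum_(j < Lam) nrm (rsum s L (i%:R - j%:R : R)).

Let q0 : (0 < q)%N. Proof. by []. Qed.
Let qR : 0 < q%:R :> R. Proof. by rewrite ltr0n. Qed.
Let M0 : (0 < M)%N. Proof. by rewrite muln_gt0 L0. Qed.
Let Q2R : 0 < (Q.*2)%:R :> R. Proof. by rewrite ltr0n double_gt0. Qed.
Let dlt0 : 0 < dlt. Proof. by rewrite invr_gt0. Qed.
Let A0 : 0 <= A. Proof. by apply: mulr_ge0; [exact: ler0n | exact: exprn_ge0]. Qed.
Let mR : 0 < m%:R :> R. Proof. by rewrite ltr0n. Qed.

Let mq : (2 * m < q)%N. Proof. by rewrite /q ltnS -mul2n leq_mul2l. Qed.

Let mq34 : 0 < (m%:R / q%:R : R) <= 3 / 4.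
Proof.
rewrite divr_gt0//= ler_pdivrMr//.
have : (2 * m)%:R <= q%:R :> R by rewrite ler_nat ltnW.
rewrite natrM; move: (q%:R : R) qR (m%:R : R) => x x0 z; lra.
Qed.

Lemma twist_period : w ^+ M = 1.
Proof.
rewrite /w -expi_mulrn /M natrM.
have -> : L%:R * q%:R * - (m%:R / q%:R) = - (L * m)%:R :> R.
  by rewrite natrM; field; rewrite gt_eqF.
by rewrite expiN expi_nat conjc1.
Qed.

Lemma twist_gap : m%:R / q%:R <= nrm (1 - w).
Proof.
rewrite nrm_subC /w nrm_expiN1; apply: expi_lower.
by have /andP[a b] := mq34; rewrite ltW.
Qed.

Lemma twist_neq1 : w != 1.
Proof.
apply/eqP => h; have := twist_gap; rewrite h subrr normc0 leNgt.
by have /andP[-> _] := mq34.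
Qed.

(** Opening the kernel as a trigonometric polynomial turns the sum over b back into
exponential sums. *)
Lemma fejer_expand x :
  ((\sum_(b < L) F (x - beta b))%:C)%C = \sum_(i < Lam) \sum_(j < Lam)
    e ((i%:R - j%:R) * x) * conj (rsum s L (i%:R - j%:R : R)).
Proof.
rewrite rmorph_sum/=.
under eq_bigr => b _ do rewrite fejerE.
rewrite exchange_big/=; apply: eq_bigr => i _.
rewrite exchange_big/=; apply: eq_bigr => j _.
rewrite /rsum conj_sum mulr_sumr; apply: eq_bigr => b _.
by rewrite mulrBr expiB.
Qed.

Lemma fejer_sum_le x : `|\sum_(b < L) F (x - beta b)| <= total_mass.
Proof.
rewrite -nrm_real fejer_expand; apply: (le_trans (nrm_sum _ _ _)).
apply: ler_sum => i _; apply: (le_trans (nrm_sum _ _ _)).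
by apply: ler_sum => j _; rewrite normcM nrm_expi mul1r nrm_conj.
Qed.

Lemma dual_termE : dual_term =
  q%:R^-1 * \sum_(b < L) \sum_(t < M) w ^+ t * ((F (g t - beta b))%:C)%C.
Proof.
rewrite exchange_big/=.
under [in RHS]eq_bigr => t _ do rewrite -mulr_sumr -rmorph_sum/= fejer_expand mulr_sumr.
rewrite exchange_big/= mulr_sumr; apply: eq_bigr => i _.
under [in RHS]eq_bigr => t _ do rewrite mulr_sumr.
rewrite exchange_big/= mulr_sumr; apply: eq_bigr => j _.
rewrite /grid_sum mulrCA; congr (_ * _); rewrite mulr_sumr; apply: eq_bigr => t _.
rewrite /w -expi_mulrn mulrA mulrC; congr (_ * _); rewrite -expiD; congr (e _).
by rewrite -/(g t); ring.
Qed.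

Lemma root_mono a b : (a <= b)%N -> beta a <= beta b.
Proof. by move=> ab; apply: ler_wsqrtr; rewrite ler_nat leq_add2l. Qed.

Lemma mesh_mono a b : (a <= b)%N -> g a <= g b.
Proof.
move=> ab; apply: ler_wsqrtr; rewrite lerD2l ler_wpM2r ?invr_ge0 ?(ltW qR)//.
by rewrite ler_nat.
Qed.

(** The difference of two square roots from the interval is at most
L / (2 sqrt N) < (K + 1)/2, so the nodes from - K - 1/2 to K + 1/2 suffice. *)
Lemma gap_range t b : (t < M)%N -> (b < L)%N -> y0 <= g t - beta b <= knot y0 dlt J.
Proof.
move=> tM bL.
have -> : knot y0 dlt J = K%:R + 2^-1.
  have KE : (K.*2.+1)%:R = 2 * K%:R + 1 :> R by rewrite -natr1 -mul2n natrM.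
  by rewrite /knot /dlt /J natrM mulfK ?gt_eqF// KE /y0; lra.
have rN0 : 0 < Num.sqrt N%:R :> R by rewrite sqrtr_gt0 ltr0n.
have gL : g t <= beta L.
  rewrite /g /beta /sqrtn; apply: ler_wsqrtr.
  by rewrite natrD lerD2l ler_pdivrMr// -natrM ler_nat ltnW.
have g0 : beta 0 <= g t.
  by apply: ler_wsqrtr; rewrite addn0 lerDl divr_ge0.
have b0 : beta 0 <= beta b by exact: root_mono.
have bL' : beta b <= beta L by apply: root_mono; exact: ltnW.
have sp : beta L - beta 0 <= (K%:R + 1) / 2.
  by rewrite /beta addn0; exact: (sqrtn_spread_le N0).
have K1 : 0 <= K%:R :> R by [].
by apply/andP; split; rewrite /y0; lra.
Qed.

(** The first mesh index t at which sqrt x_t - sqrt b reaches the node y j. *)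
Definition crossing b j := threshold M (fun t => y j <= g t - beta b).

Lemma crossingP b j t : (t < M)%N -> (y j <= g t - beta b) = (crossing b j <= t)%N.
Proof.
move=> tM; apply: thresholdP => // u _ h; apply: (le_trans h).
by rewrite lerD2r mesh_mono.
Qed.

(** The node is crossed strictly inside the interval; for the other nodes the geometric
sum vanishes. *)
Definition inside b j := (0 < crossing b j)%N && (crossing b j < M)%N.

Lemma insideE b j :
  inside b j = (g 0%N - beta b < y j) && (y j <= g M.-1 - beta b).
Proof.
have M1 : (M.-1 < M)%N by rewrite prednK.
rewrite /inside (crossingP b j M1) ltNge (crossingP b j M0) leqn0 -lt0n; congr (_ && _).
by rewrite -[in LHS](prednK M0) ltnS.
Qed.

Lemma step_sum b : \sum_(t < M) w ^+ t * ((stp (g t - beta b))%:C)%C =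
  \sum_(j < J) ((jmp j)%:C)%C * ((w ^+ crossing b j - 1) / (1 - w)).
Proof.
under eq_bigr => t _ do rewrite rmorphD rmorph_sum/= mulrDr mulr_sumr.
rewrite big_split/= -mulr_suml.
have Sw : \sum_(t < M) w ^+ t = 0.
  transitivity (\sum_(t < M) (0 <= t)%N%:R * w ^+ t).
    by apply: eq_bigr => t _; rewrite mul1r.
  by rewrite (geometric_tail twist_neq1 twist_period (leq0n M)) expr0 subrr mul0r.
rewrite Sw mul0r add0r exchange_big/=; apply: eq_bigr => j _.
rewrite -(geometric_tail twist_neq1 twist_period (threshold_le _ _)) mulr_sumr.
apply: eq_bigr => t _; rewrite rmorphM/= rmorph_nat.
rewrite -/(y j) (crossingP b j (ltn_ord t)) /jmp; ring.
Qed.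

(** The crossing point of the node y is x = (sqrt b + y)^2, up to one mesh step. *)
Lemma crossing_close b j : inside b j ->
  `|(crossing b j)%:R / q%:R - ((beta b + y j) ^+ 2 - s%:R)| <= q%:R^-1.
Proof.
move=> /andP[h0 hM].
have M1 : ((crossing b j).-1 < M)%N by rewrite (leq_ltn_trans (leq_pred _)).
have a1 : beta b + y j <= g (crossing b j).
  by rewrite -lerBrDl (crossingP b j hM).
have a2 : g (crossing b j).-1 < beta b + y j.
  by rewrite -ltrBlDl ltNge (crossingP b j M1) -ltnNge prednK.
have sg t : g t ^+ 2 = s%:R + t%:R / q%:R.
  by rewrite sqr_sqrtr// addr_ge0// divr_ge0.
have g0 t : 0 <= g t by rewrite sqrtr_ge0.
have b1 : (beta b + y j) ^+ 2 <= s%:R + (crossing b j)%:R / q%:R.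
  rewrite -sg ler_pXn2r ?nnegrE//; apply: le_trans (ltW a2); exact: g0.
have b2 : s%:R + (crossing b j).-1%:R / q%:R <= (beta b + y j) ^+ 2.
  by rewrite -sg ler_pXn2r ?nnegrE ?(ltW a2)//; apply: le_trans (ltW a2); exact: g0.
have hE : (crossing b j)%:R = (crossing b j).-1%:R + 1 :> R by rewrite natr1 prednK.
have := invr_gt0 (q%:R : R); rewrite qR => qV.
rewrite ler_norml; apply/andP; split; first by lra.
by move: b2; rewrite hE mulrDl mul1r; lra.
Qed.

(** The heart of the matter: m (sqrt b + y)^2 = m b + 2 m y sqrt b + m y^2 modulo the
shift by s, and the first term is an integer.  With y = k + u, the frequency of
sqrt b is 2 m k up to a small perturbation. *)
Lemma phase_split b j (k u : R) : y j = k + u ->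
  e (- (m%:R * ((beta b + y j) ^+ 2 - s%:R))) =
  e (- (m%:R * y j ^+ 2)) *
    (e (- (2 * m%:R * k) * beta b) * e (- (2 * m%:R * u) * beta b)).
Proof.
move=> yE; rewrite -!expiD.
have -> : - (m%:R * ((beta b + y j) ^+ 2 - s%:R)) =
  - (m * b)%:R + (- (m%:R * y j ^+ 2) + (- (2 * m%:R * k) * beta b + - (2 * m%:R * u) * beta b)).
  have bE : beta b ^+ 2 = s%:R + b%:R by rewrite sqr_sqrtr// natrD.
  have -> : (beta b + y j) ^+ 2 = beta b ^+ 2 + 2 * y j * beta b + y j ^+ 2 by ring.
  by rewrite bE natrM {1}yE; ring.
by rewrite [LHS]expiD expiN expi_nat conjc1 mul1r.
Qed.

(** The b for which the node is crossed inside the interval form an interval, so the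
sum is a difference of two initial segments.  The perturbation 2 m u of the frequency
is removed by partial summation: sqrt b varies by at most sqrt N / 12 over J and
m sqrt N <= 2 Lam. *)
Lemma window_bound j (k u : R) : y j = k + u ->
  nrm (\sum_(b < L) (inside b j)%:R * w ^+ crossing b j) <=
  L%:R * (8 * m%:R / q%:R) + 2 * rmax s L (2 * m%:R * k) * (1 + 3 * Lam%:R * `|u|).
Proof.
move=> yE.
pose f b := e (- (2 * m%:R * k) * beta b) * e (- (2 * m%:R * u) * beta b).
pose c := e (- (m%:R * y j ^+ 2)).
have -> : \sum_(b < L) (inside b j)%:R * w ^+ crossing b j =
   \sum_(b < L) (inside b j)%:R * (w ^+ crossing b j - c * f b)
   + c * \sum_(b < L) (inside b j)%:R * f b.
  by rewrite mulr_sumr -big_split/=; apply: eq_bigr => b _; ring.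
apply: (le_trans (nrmD _ _)); apply: lerD.
  apply: (le_trans (nrm_sum _ _ _)).
  rewrite -[L in L%:R * _]card_ord mulr_natl -sumr_const.
  apply: ler_sum => b _; case hin : (inside b j); last first.
    by rewrite mul0r normc0 divr_ge0 ?mulr_ge0.
  rewrite mul1r -phase_split// /w -expi_mulrn; apply: (le_trans (expi_lip _ _)).
  have -> : (crossing b j)%:R * - (m%:R / q%:R) - - (m%:R * ((beta b + y j) ^+ 2 - s%:R))
    = - (m%:R * ((crossing b j)%:R / q%:R - ((beta b + y j) ^+ 2 - s%:R))) by ring.
  rewrite normrN normrM [`|m%:R|]ger0_norm// -!mulrA ler_wpM2l// ler_wpM2l//.
  exact: crossing_close.
rewrite normcM nrm_expi mul1r.
(* Both end conditions are monotone in b. *)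
pose lo := threshold L (fun b => g 0%N - y j < beta b).
pose hi := threshold L (fun b => g M.-1 - y j < beta b).
have bm t : (t.+1 < L)%N -> beta t <= beta t.+1 by move=> _; exact: root_mono.
have loP b : (b < L)%N -> (g 0%N - y j < beta b) = (lo <= b)%N.
  by move=> bL; apply: thresholdP => // t tL h; apply: lt_le_trans h (bm _ tL).
have hiP b : (b < L)%N -> (g M.-1 - y j < beta b) = (hi <= b)%N.
  by move=> bL; apply: thresholdP => // t tL h; apply: lt_le_trans h (bm _ tL).
have hiL : (hi <= L)%N by exact: threshold_le.
have -> : \sum_(b < L) (inside b j)%:R * f b =
    \sum_(b < L) ((lo <= b) && (b < hi))%N%:R * f b.
  apply: eq_bigr => b _; rewrite insideE; congr (_%:R * _); congr (nat_of_bool (_ && _)).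
    by rewrite -loP// ltrBlDl ltrBlDr.
  by rewrite [RHS]ltnNge -hiP// -leNgt lerBrDl lerBrDr.
rewrite (sum_window f lo hiL); apply: (le_trans (nrmB _ _)).
have mL : (minn lo hi <= L)%N by rewrite geq_min hiL orbT.
have P n : (n <= L)%N -> nrm (\sum_(b < n) f b) <=
    rmax s L (2 * m%:R * k) * (1 + 3 * Lam%:R * `|u|).
  move=> nL; apply: (le_trans (prefix_twist s (- (2 * m%:R * k)) (- (2 * m%:R * u)) nL)).
  rewrite rmaxN ler_wpM2l ?rmax_ge0// lerD2l normrN normrM ger0_norm ?mulr_ge0//.
  have d : sqrtn R (s + n) - sqrtn R s <= Num.sqrt N%:R / 12.
    by apply: sqrtn_spread_N => //; apply: leq_trans LN; rewrite leq_mul2l nL orbT.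
  have u0 : 0 <= `|u| by [].
  apply: (@le_trans _ _ (8 * (2 * m%:R * `|u|) * (Num.sqrt N%:R / 12))).
    by rewrite ler_wpM2l// !mulr_ge0.
  have -> : 8 * (2 * m%:R * `|u|) * (Num.sqrt N%:R / 12) =
    (4 / 3 * (m%:R * Num.sqrt N%:R)) * `|u| by field.
  rewrite ler_wpM2r//; have := mLam; have : 0 <= Lam%:R :> R by [].
  move: (m%:R * _) => x; lra.
by have := P _ hiL; have := P _ mL; rewrite -mulrA; lra.
Qed.

Lemma step_mass t : (t < M)%N ->
  `|\sum_(b < L) stp (g t - beta b)| <= total_mass + L%:R * (A * dlt).
Proof.
move=> tM.
have -> : \sum_(b < L) stp (g t - beta b) = \sum_(b < L) F (g t - beta b)
    - \sum_(b < L) (F (g t - beta b) - stp (g t - beta b)).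
  by rewrite -sumrB; apply: eq_bigr => b _; ring.
apply: (le_trans (ler_normB _ _)); apply: lerD; first exact: fejer_sum_le.
apply: (le_trans (ler_norm_sum _ _ _)).
rewrite -[L in L%:R * _]card_ord mulr_natl -sumr_const.
apply: ler_sum => b _; apply: stepf_approx => //; first exact: fejer_lip.
exact: gap_range.
Qed.

(** The constant terms of the geometric sums add up to the step function at the two
ends of the interval. *)
Lemma inside_jumps b : \sum_(j < J) jmp j * (inside b j)%:R =
  stp (g M.-1 - beta b) - stp (g 0%N - beta b).
Proof.
rewrite /stp /stepf opprD addrACA subrr add0r -sumrB; apply: eq_bigr => j _.
rewrite -/(y j) -/(jmp j) insideE ltNge.
have : y j <= g 0%N - beta b -> y j <= g M.-1 - beta b.
  by move=> h; apply: (le_trans h); rewrite lerD2r mesh_mono.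
case: (y j <= g 0%N - beta b)%R; case: (y j <= g M.-1 - beta b)%R => /=.
- by rewrite mulr0 subrr.
- by move=> /(_ isT).
- by rewrite mul1r mul0r subr0 mulr1.
- by rewrite mulr0 mul0r subrr.
Qed.

(** The nodes fall into 2 K + 1 periods; by periodicity of the kernel its jumps depend
only on the position inside the period. *)
Lemma jump_node (x l : nat) : (l < Q.*2)%N -> 
  y (x * Q.*2 + l)%N = (x%:R - K%:R) + node R Q l /\
  jmp (x * Q.*2 + l)%N = F (node R Q l) - F (node R Q l - dlt).
Proof.
move=> lQ.
have Q2n : (Q.*2)%:R != 0 :> R by rewrite gt_eqF.
have yE : y (x * Q.*2 + l)%N = (x%:R - K%:R) + node R Q l.
  rewrite /y /knot /node -addnS natrD natrM mulrDl /dlt mulfK// /y0 mulrBl.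
  have -> : Q%:R / (Q.*2)%:R = 2^-1 :> R.
    have Qn : Q%:R != 0 :> R by rewrite pnatr_eq0 -lt0n.
    by rewrite -mul2n natrM; field.
  by ring.
have per z : F (x%:R - K%:R + z) = F z.
  rewrite /F -(fejer_periodic Lam _ K); have -> : x%:R - K%:R + z + K%:R = z + x%:R by ring.
  by rewrite fejer_periodic.
split=> //; rewrite /jmp /jump -/(y _) yE per; congr (_ - _).
have -> : knot y0 dlt (x * Q.*2 + l) = x%:R - K%:R + (node R Q l - dlt).
  rewrite addrA -yE /y /knot -natr1; ring.
by rewrite per.
Qed.

(** The four contributions are: the replacement of the kernel by a step function, the
constant terms of the geometric sums, the rounding of the crossing points to the
mesh, and the main term, where the node in the k-th period sees the frequency 2 m k.
The term k = 0 is bounded trivially by L. *)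
Lemma dual_term_bound : nrm dual_term <= L%:R ^+ 2 * (A * dlt) + m%:R^-1 *
  (2 * (total_mass + L%:R * (A * dlt)) + Omega * ((2 * K%:R + 1) * (L%:R * (8 * m%:R / q%:R))
     + 2 * (L%:R + 2 * \sum_(k < K) rmax s L (2 * m%:R * k.+1%:R)))).
Proof.
rewrite dual_termE.
have qC : (q%:R : R[i]) != 0 by rewrite pnatr_eq0.
have -> : q%:R^-1 * \sum_(b < L) \sum_(t < M) w ^+ t * ((F (g t - beta b))%:C)%C =
   q%:R^-1 * (\sum_(b < L) \sum_(t < M) w ^+ t * ((F (g t - beta b) - stp (g t - beta b))%:C)%C)
   + q%:R^-1 / (1 - w) * \sum_(b < L) \sum_(j < J) ((jmp j)%:C)%C * (w ^+ crossing b j - 1).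
  rewrite -mulrA -mulrDr; congr (_ * _).
  rewrite mulr_sumr -big_split/=; apply: eq_bigr => b _.
  have -> : (1 - w)^-1 * \sum_(j < J) ((jmp j)%:C)%C * (w ^+ crossing b j - 1)
     = \sum_(t < M) w ^+ t * ((stp (g t - beta b))%:C)%C.
    by rewrite step_sum mulr_sumr; apply: eq_bigr => j _; rewrite mulrCA; congr (_ * _); exact: mulrC.
  by rewrite -big_split/=; apply: eq_bigr => t _; rewrite -mulrDr -rmorphD/= subrK.
apply: (le_trans (nrmD _ _)); apply: lerD.
  rewrite normcM normcV nrm_nat mulrC ler_pdivrMr//.
  apply: (le_trans (nrm_sum _ _ _)).
  have -> : L%:R ^+ 2 * (A * dlt) * q%:R = \sum_(b < L) \sum_(t < M) A * dlt.
    rewrite (eq_bigr (fun=> M%:R * (A * dlt))) => [|b _]; last first.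
      by rewrite sumr_const card_ord mulr_natl.
    by rewrite sumr_const card_ord -[RHS]mulr_natl /M natrM; ring.
  apply: ler_sum => b _; apply: (le_trans (nrm_sum _ _ _)); apply: ler_sum => t _.
  rewrite normcM /w -expi_mulrn nrm_expi mul1r nrm_real.
  by apply: stepf_approx => //; [exact: fejer_lip|exact: gap_range].
rewrite normcM; apply: ler_pM; rewrite ?nrm_ge0//.
  rewrite normcM !normcV nrm_nat -invfM lef_pV2 ?posrE//.
    by rewrite -ler_pdivrMl// mulrC twist_gap.
  rewrite mulr_gt0//; apply: lt_le_trans twist_gap; by have /andP[] := mq34.
have zero b j : w ^+ crossing b j - 1 = (inside b j)%:R * w ^+ crossing b j - (inside b j)%:R.
  rewrite /inside; have := threshold_le M (fun t => y j <= g t - beta b).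
  rewrite -/(crossing b j) leq_eqVlt => /orP[/eqP ->|->].
    by rewrite ltnn andbF twist_period mul0r !subrr.
  rewrite andbT; case: (posnP (crossing b j)) => [->|h] /=; first by rewrite expr0 mul0r !subrr.
  by rewrite mul1r.
have -> : \sum_(b < L) \sum_(j < J) ((jmp j)%:C)%C * (w ^+ crossing b j - 1) =
   \sum_(j < J) ((jmp j)%:C)%C * (\sum_(b < L) (inside b j)%:R * w ^+ crossing b j)
   - ((\sum_(b < L) (stp (g M.-1 - beta b) - stp (g 0%N - beta b)))%:C)%C.
  rewrite rmorph_sum/=.
  under [X in _ - X]eq_bigr => b _ do rewrite -inside_jumps rmorph_sum/=.
  under [X in X - _]eq_bigr => j _ do rewrite mulr_sumr.
  rewrite [X in X - _]exchange_big/= -sumrB; apply: eq_bigr => b _.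
  rewrite -sumrB; apply: eq_bigr => j _.
  by rewrite rmorphM/= rmorph_nat -mulrBr zero.
rewrite addrC; apply: (le_trans (nrmD _ _)); apply: lerD.
  rewrite nrmN nrm_real sumrB; apply: (le_trans (ler_normB _ _)).
  have M1 : (M.-1 < M)%N by rewrite prednK.
  by have := step_mass M0; have := step_mass M1; lra.
apply: (le_trans (nrm_sum _ _ _)).
under eq_bigr => j _ do rewrite normcM nrm_real.
rewrite (sum_blocks (fun j => `|jmp j| * nrm (\sum_(b < L) (inside b j)%:R * w ^+ crossing b j))).
pose B : R := L%:R * (8 * m%:R / q%:R).
have B0 : 0 <= B by rewrite !mulr_ge0 ?invr_ge0.
pose G (x : R) := B + 2 * rmax s L (2 * m%:R * x).
apply: (@le_trans _ _ (\sum_(x < K.*2.+1) Omega * G (x%:R - K%:R))).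
  apply: ler_sum => x _.
  have G0 : 0 <= G (x%:R - K%:R) by rewrite addr_ge0// mulr_ge0// rmax_ge0.
  apply: le_trans (ler_wpM2r G0 OmegaP); rewrite mulr_suml; apply: ler_sum => l _.
  have [yE jE] := jump_node x (ltn_ord l).
  rewrite jE -[leRHS]mulrA; apply: ler_wpM2l => //; apply: (le_trans (window_bound yE)).
  rewrite -/B /G [leRHS]mulrDr; apply: lerD; last by rewrite [leRHS]mulrC.
  by rewrite ler_peMl// lerDl !mulr_ge0.
rewrite -mulr_sumr ler_wpM2l//.
  apply: le_trans OmegaP; apply: sumr_ge0 => l _; rewrite mulr_ge0// addr_ge0// !mulr_ge0//.
have GN x : G (- x) = G x by rewrite /G mulrN rmaxN.
rewrite (sum_symmetric K GN).
rewrite /G mulr0 big_split/= sumr_const card_ord -mulr_natl -mulr_sumr.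
have := rmax0_le s L; rewrite -/B; move: (\sum_(k < K) _) => S r0; lra.
Qed.

End Fixed.
End DualTerm.

(** * Sums over pairs of frequencies *)

Section PairSums.
Variable R : realType.

Lemma cauchy_schwarz_offdiag n (a b : 'I_n -> 'I_n -> R) :
  (\sum_i \sum_(j | j != i) a i j * b i j) ^+ 2 <=
  (\sum_i \sum_(j | j != i) a i j ^+ 2) * (\sum_i \sum_(j | j != i) b i j ^+ 2).
Proof.
have E (F : 'I_n -> 'I_n -> R) : \sum_i \sum_(j | j != i) F i j =
    \sum_(p <- [seq p <- index_enum ('I_n * 'I_n)%type | p.2 != p.1]) F p.1 p.2.
  by rewrite (pair_big_dep xpredT (fun i j => j != i))/= big_filter.
rewrite (E (fun i j => a i j * b i j)) (E (fun i j => a i j ^+ 2)) (E (fun i j => b i j ^+ 2)).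
exact: (cauchy_schwarz _ (fun p => a p.1 p.2) (fun p => b p.1 p.2)).
Qed.

Lemma sum_inv_dist n i : (i < n)%N ->
  \sum_(j < n) `|i%:R - j%:R|^-1 <= 2 * harm R n.
Proof.
move=> ni.
have -> : \sum_(j < n) `|i%:R - j%:R|^-1 = harm R i + harm R (n - i).-1.
  rewrite -(subnKC (ltnW ni)) big_split_ord/= addKn; congr (_ + _).
    rewrite (reindex_inj rev_ord_inj)/=; apply: eq_bigr => j _.
    by rewrite natrB ?ltn_ord// subKr ger0_norm.
  have : (0 < n - i)%N by rewrite subn_gt0.
  case: (n - i)%N => // k _; rewrite big_ord_recl/= addn0 subrr normr0 invr0 add0r.
  apply: eq_bigr => j _; rewrite /bump/= add1n natrD opprD addrA subrr sub0r normrN.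
  by rewrite ger0_norm.
have h1 : harm R i <= harm R n by apply: harm_mono; exact: ltnW.
have h2 : harm R (n - i).-1 <= harm R n.
  by apply: harm_mono; rewrite (leq_trans (leq_pred _))// leq_subr.
lra.
Qed.

Lemma sum_segment_le (G : nat -> R) n a H (P : pred nat) : (forall j, 0 <= G j) ->
  (a + H <= n)%N -> (forall h, (h < H)%N -> P (a + h)%N) ->
  \sum_(h < H) G (a + h)%N <= \sum_(j < n | P j) G j.
Proof.
move=> G0 aH PP; rewrite -(big_mkord P G) (big_cat_nat (n := a))//=; last first.
  by rewrite (leq_trans _ aH)// leq_addr.
rewrite [X in _ + X](big_cat_nat (n := (a + H)%N)) ?leq_addr//=.
have -> : \sum_(a <= i < a + H | P i) G i = \sum_(h < H) G (a + h)%N.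
  rewrite -{1}[a]add0n big_addn addKn big_mkord.
  rewrite [RHS](eq_bigl (fun h : 'I_H => P (h + a)%N)); last first.
    by move=> h; rewrite addnC PP.
  by apply: eq_bigr => h _; rewrite addnC.
rewrite addrCA lerDl addr_ge0 ?sumr_ge0//.
Qed.

End PairSums.

Section Improvement.
Variable R : realType.

(** The second moment with Fejer weights 2 (Lam - h), without the frequency 0: its
diagonal-free form is essential since |S(0)|^2 = L^2 would dominate. *)
Definition offdiag s L Lam : R :=
  \sum_(i < Lam) \sum_(j < Lam | j != i) nrm (rsum s L (i%:R - j%:R : R)) ^+ 2.

(** Each row i < 2 H contains all the distances 1, ..., H on at least one side of the
diagonal. *)
Lemma energy_offdiag s L H : (2 * H)%:R * energy R s L H <= offdiag s L (2 * H).
Proof.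
rewrite mulr_natl -[X in _ *+ X]card_ord -sumr_const; apply: ler_sum => i _.
pose G (j : nat) : R := nrm (rsum s L (i%:R - j%:R)) ^+ 2.
have G0 j : 0 <= G j by exact: sqr_ge0.
have [iH|iH] := ltnP i H.
  apply: le_trans (sum_segment_le (n := 2 * H) (a := i.+1) (H := H) (P := fun j => j != i) G0 _ _).
  - apply: ler_sum => h _; rewrite /G.
    have -> : i%:R - (i.+1 + h)%:R = - h.+1%:R :> R.
      by rewrite addSnnS natrD opprD addrA subrr sub0r.
    by rewrite rsum_conj nrm_conj.
  - by clear -iH; lia.
  - by move=> h _; rewrite gtn_eqF// addSn ltnS leq_addr.
apply: le_trans (sum_segment_le (n := 2 * H) (a := (i - H)%N) (H := H) (P := fun j => j != i) G0 _ _).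
- rewrite /energy (reindex_inj rev_ord_inj)/=; apply: ler_sum => h _.
  have hH := ltn_ord h.
  rewrite /G; have -> : i%:R - (i - H + h)%:R = (H - h.+1).+1%:R :> R.
    rewrite -natrB; last by lia.
    by congr (_%:R); lia.
  exact: lexx.
- by have := ltn_ord i; lia.
- by move=> h hH; rewrite ltn_eqF//; lia.
Qed.

Lemma total_mass_le s L Lam :
  total_mass R s L Lam <= Lam%:R * L%:R + Lam%:R * Num.sqrt (offdiag s L Lam).
Proof.
have Z0 : 0 <= offdiag s L Lam.
  by apply: sumr_ge0 => i _; apply: sumr_ge0 => j _; exact: sqr_ge0.
have -> : total_mass R s L Lam = \sum_(i < Lam) nrm (rsum s L (0 : R)) +
    \sum_(i < Lam) \sum_(j < Lam | j != i) 1 * nrm (rsum s L (i%:R - j%:R : R)).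
  rewrite /total_mass -big_split/=; apply: eq_bigr => i _.
  by rewrite (bigD1 i)//= subrr; congr (_ + _); apply: eq_bigr => j _; rewrite mul1r.
apply: lerD.
  rewrite sumr_const card_ord -[_ *+ _]mulr_natl ler_wpM2l//.
  by apply: le_trans (rmax_ge s 0 (leqnn L)) (rmax0_le _ _ _).
rewrite -(ler_pXn2r (n := 2)) ?nnegrE ?mulr_ge0 ?sqrtr_ge0//; last first.
  by apply: sumr_ge0 => i _; apply: sumr_ge0 => j _; rewrite mul1r nrm_ge0.
apply: (le_trans (cauchy_schwarz_offdiag _ _)); rewrite exprMn sqr_sqrtr//.
rewrite ler_wpM2r//.
apply: (@le_trans _ _ (\sum_(i < Lam) \sum_(j < Lam) 1)).
  apply: ler_sum => i _; rewrite [leRHS](bigD1 i)//= ler_wpDl//.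
  by rewrite expr1n.
rewrite (eq_bigr (fun=> Lam%:R)) => [|i _]; last by rewrite sumr_const card_ord.
by rewrite sumr_const card_ord -[_ *+ _]mulr_natl expr2.
Qed.

(** Complex conjugation exchanges nu and - nu. *)
Lemma dual_term_neg s L Lam r m :
  nrm (\sum_(i < Lam) \sum_(j < Lam) conj (rsum s L (i%:R - j%:R : R)) *
     grid_sum s L r.*2.+1 (i%:R - j%:R : R) (- m%:R))
  = nrm (dual_term R s L Lam r m).
Proof.
rewrite -[RHS]nrm_conj; congr nrm; rewrite /dual_term conj_sum exchange_big/=.
apply: eq_bigr => i _; rewrite conj_sum; apply: eq_bigr => j _.
by rewrite rmorphM/= -!rsum_conj -!grid_sum_conj !opprB.
Qed.

(** The diagonal can be added to the sums with 1 <= |nu| <= V, because the sum of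
e(- nu x) over a whole number of periods is 0; this completes them to [dual_term]. *)
Lemma offdiag_split s L Lam r V : (V <= r)%N ->
  ((offdiag s L Lam)%:C)%C =
  \sum_(i < Lam) \sum_(j < Lam | j != i)
     conj (rsum s L (i%:R - j%:R : R)) * main_error s L r V (i%:R - j%:R)
  + \sum_(m < V) (dual_term R s L Lam r m.+1 +
      \sum_(i < Lam) \sum_(j < Lam) conj (rsum s L (i%:R - j%:R : R)) *
        grid_sum s L r.*2.+1 (i%:R - j%:R : R) (- m.+1%:R)).
Proof.
move=> Vr.
pose D (i j : nat) m := conj (rsum s L (i%:R - j%:R : R)) *
  (grid_sum s L r.*2.+1 (i%:R - j%:R : R) m.+1%:R +
   grid_sum s L r.*2.+1 (i%:R - j%:R : R) (- m.+1%:R)).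
have -> : \sum_(m < V) (dual_term R s L Lam r m.+1 +
      \sum_(i < Lam) \sum_(j < Lam) conj (rsum s L (i%:R - j%:R : R)) *
        grid_sum s L r.*2.+1 (i%:R - j%:R : R) (- m.+1%:R)) =
   \sum_(i < Lam) \sum_(j < Lam | j != i) \sum_(m < V) D i j m.
  have E (m : 'I_V) : dual_term R s L Lam r m.+1 +
      \sum_(i < Lam) \sum_(j < Lam) conj (rsum s L (i%:R - j%:R : R)) *
        grid_sum s L r.*2.+1 (i%:R - j%:R : R) (- m.+1%:R) =
      \sum_(i < Lam) \sum_(j < Lam | j != i) D i j m.
    rewrite -big_split/=; apply: eq_bigr => i _; rewrite -big_split/= (bigD1 i)//=.
    have mr : (m < r)%N by exact: leq_trans (ltn_ord m) Vr.
    have Z : grid_sum s L r.*2.+1 (0 : R) (- m.+1%:R) = 0.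
      by have := grid_sum_conj s L r.*2.+1 (0 : R) m.+1%:R; rewrite oppr0 grid_sum00// conjc0.
    rewrite subrr grid_sum00// Z !mulr0 !add0r.
    by apply: eq_bigr => j _; rewrite /D mulrDr.
  rewrite (eq_bigr _ (fun m _ => E m)) exchange_big/=; apply: eq_bigr => i _.
  by rewrite exchange_big.
rewrite rmorph_sum/= -big_split/=; apply: eq_bigr => i _.
rewrite rmorph_sum/= -big_split/=; apply: eq_bigr => j _.
by rewrite /D -mulr_sumr -mulrDr subrK mulrC mul_conj.
Qed.

Lemma error_energy N s L r V Lam (ell : R) : (0 < N)%N -> (N <= s)%N ->
  (s + L <= 4 * N)%N -> (V <= r)%N -> (Lam <= r)%N -> (0 < L)%N ->
  (N <= Lam ^ 2)%N -> Lam%:R <= V%:R * Num.sqrt N%:R :> R ->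
  1 <= ell -> harm R r <= ell ->
  \sum_(i < Lam) \sum_(j < Lam | j != i)
     nrm (main_error s L r V (i%:R - j%:R : R)) ^+ 2
  <= 6400 * Lam%:R ^+ 2 * ell ^+ 2 * L%:R.
Proof.
move=> N0 Ns sL Vr Lr L0 NL LV ell1 ellr.
have LL1 : 1 <= L%:R :> R by rewrite ler1n.
have rNL : Num.sqrt N%:R <= Lam%:R :> R.
  rewrite -(ler_pXn2r (n := 2)) ?nnegrE ?sqrtr_ge0// sqr_sqrtr//.
  by rewrite -natrX ler_nat.
have ell0 : 0 <= ell by lra.
pose c1 : R := 216 * L%:R * Num.sqrt N%:R.
have c10 : 0 <= c1 by apply: mulr_ge0; [apply: mulr_ge0; exact: ler0n|exact: sqrtr_ge0].
pose c2 : R := 5832 * ell ^+ 2.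
have c20 : 0 <= c2 by apply: mulr_ge0; [exact: ler0n|exact: exprn_ge0].
apply: (@le_trans _ _ (\sum_(i < Lam) \sum_(j < Lam)
    (c1 * `|i%:R - j%:R|^-1 + c2))).
  apply: ler_sum => i _; rewrite [leRHS](bigD1 i)//=; apply: ler_wpDl.
    by rewrite addr_ge0// mulr_ge0// invr_ge0.
  apply: ler_sum => j ji.
  have dL : `|i%:R - j%:R| <= Lam%:R :> R.
    have iL : i%:R <= Lam%:R :> R by rewrite ler_nat ltnW.
    have jL : j%:R <= Lam%:R :> R by rewrite ler_nat ltnW.
    have i0 : 0 <= i%:R :> R by []. have j0 : 0 <= j%:R :> R by [].
    by clear -iL jL i0 j0; rewrite ler_norml; apply/andP; split; lra.
  have d0 : 0 < `|i%:R - j%:R| :> R.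
    by rewrite normr_gt0 subr_eq0 eqr_nat eq_sym.
  apply: (le_trans (main_error_bound N0 Ns sL Vr d0 _ _)).
  - exact: le_trans LV.
  - by apply: (le_trans dL); rewrite ler_nat.
  - apply: lerD; first exact: lexx.
    apply: ler_wpM2l; first exact: ler0n.
    by rewrite ler_pXn2r ?nnegrE ?harm_ge0.
apply: (@le_trans _ _ (\sum_(i < Lam) (c1 * (2 * ell) + Lam%:R * c2))).
  apply: ler_sum => i _; rewrite big_split/= -mulr_sumr sumr_const card_ord -[c2 *+ _]mulr_natl.
  rewrite lerD2r; apply: ler_wpM2l => //; apply: (le_trans (sum_inv_dist R (ltn_ord i))).
  by rewrite ler_wpM2l// (le_trans _ ellr)// harm_mono.
rewrite sumr_const card_ord -[_ *+ _]mulr_natl /c1 /c2.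
have h1 : L%:R * Num.sqrt N%:R * ell <= L%:R * Lam%:R * ell ^+ 2.
  apply: ler_pM => //; first by rewrite ler_wpM2l.
  by rewrite expr2 ler_peMl.
have h2 : Lam%:R * ell ^+ 2 <= L%:R * Lam%:R * ell ^+ 2.
  by rewrite -mulrA ler_peMl// mulr_ge0// exprn_ge0.
have -> : 6400 * Lam%:R ^+ 2 * ell ^+ 2 * L%:R = Lam%:R * (6400 * (L%:R * Lam%:R * ell ^+ 2)) by ring.
apply: ler_wpM2l; first exact: ler0n.
move: h1 h2; set u := L%:R * Lam%:R * _ => h1 h2.
have -> : 216 * L%:R * Num.sqrt N%:R * (2 * ell) + Lam%:R * (5832 * ell ^+ 2) =
  432 * (L%:R * Num.sqrt N%:R * ell) + 5832 * (Lam%:R * ell ^+ 2) by ring.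
have u0 : 0 <= u by apply: le_trans h2; rewrite mulr_ge0// exprn_ge0.
move: (_ * ell) (_ * ell ^+ 2) h1 h2 => x y h1 h2; lra.
Qed.

End Improvement.

(** * The self-improving inequality *)

Section Bootstrap.
Variable R : realType.

Lemma energy_bound_mono N (B B' : R) : B <= B' -> energy_bound N B -> energy_bound N B'.
Proof.
move=> BB EB s L X h1 h2 h3 h4 h5; apply: (le_trans (EB s L X h1 h2 h3 h4 h5)).
by rewrite ler_wpM2r// ler_wpM2r.
Qed.

Lemma energy_trivial s L X : energy R s L X <= X%:R * L%:R ^+ 2.
Proof.
rewrite mulr_natl -[X in _ *+ X]card_ord -sumr_const; apply: ler_sum => h _.
rewrite ler_pXn2r ?nnegrE ?nrm_ge0//; apply: (le_trans (nrm_sum _ _ _)).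
rewrite (eq_bigr (fun=> 1)) => [|i _]; last by rewrite nrm_expi.
by rewrite sumr_const card_ord.
Qed.

Lemma max_sqr_below N M : (0 < N)%N ->
  exists2 K, (K ^ 2 * N <= M ^ 2)%N & (M ^ 2 < K.+1 ^ 2 * N)%N.
Proof.
move=> N0.
have exP : exists K, (K ^ 2 * N <= M ^ 2)%N by exists 0%N.
have ub K : (K ^ 2 * N <= M ^ 2)%N -> (K <= M)%N.
  move=> h; rewrite -(@leq_exp2r _ _ 2)//; apply: leq_trans h.
  by rewrite leq_pmulr.
exists (ex_maxn exP ub); case: ex_maxnP => K h1 h2 //.
by rewrite ltnNge; apply/negP => /h2; rewrite ltnn.
Qed.

Lemma min_sqr_above N M : (0 < N)%N -> (0 < M)%N ->
  exists2 V, (0 < V)%N && (V <= M)%N & (M ^ 2 <= V ^ 2 * N)%N && (V.-1 ^ 2 * N < M ^ 2)%N.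
Proof.
move=> N0 M0.
have ex : exists V, (M ^ 2 <= V ^ 2 * N)%N by exists M; rewrite leq_pmulr.
exists (ex_minn ex); case: ex_minnP => V h1 h2.
  rewrite lt0n h2 ?leq_pmulr// andbT; apply/eqP => V0.
  by move: h1; rewrite V0 mul0n leqn0 expn_eq0 -leqn0 leqNgt M0.
rewrite h1/= ltnNge; apply/negP; case: V h1 h2 => [|V] h1 h2 /=.
  by move: h1; rewrite mul0n leqn0 expn_eq0 -leqn0 leqNgt M0.
by move=> /h2; rewrite ltnn.
Qed.

(** Absorbs the terms in which the unknown appears to the first power. *)
Lemma quadratic_bound (x T Y : R) : x ^+ 2 <= 84 * (T * x) + Y ->
  x ^+ 2 <= 7056 * T ^+ 2 + 2 * Y.
Proof. by have := sqr_ge0 (x - 84 * T); nra. Qed.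

Lemma collect_mass (l tm La Om L x : R) : l * tm <= l * (La * L + La * x) ->
  l * (2 * (tm + La) + 2 * Om * L) <=
  2 * (l * (La * L)) + 2 * (l * La * x) + 2 * (l * La) + 2 * (Om * L * l).
Proof. lra. Qed.

Lemma collect_terms (z S oz ub tx lx W U c1 c2 c3 c4 c5 : R) :
  z <= 2 * c3 + 2 * lx + 2 * c2 + 2 * c1 -> S <= c5 + z + c4 + 8 * oz ->
  oz <= ub -> lx <= tx -> c1 <= U -> c2 <= W -> c3 <= W -> c4 <= U -> c5 <= W ->
  80 * tx + 2 * S <= 84 * tx + (10 * W + 6 * U + 16 * ub).
Proof. lra. Qed.

Lemma collect_powers (P t W U ub : R) : P <= 7056 * t + 2 * (10 * W + 6 * U + 16 * ub) ->
  t <= W -> U = 2256 * W -> 0 <= W -> P <= 32 * U + 32 * ub.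
Proof. lra. Qed.

Section Improve.
Variables (N s L H V K : nat) (B ell : R).
Hypotheses (N0 : (0 < N)%N) (L0 : (0 < L)%N) (H0 : (0 < H)%N) (B0 : 0 <= B).
Hypotheses (Ns : (N <= s)%N) (sL : (s + L <= 4 * N)%N) (LN : (6 * L <= N)%N).
Hypotheses (NH : (N <= H ^ 2)%N) (HN : (H <= 4 * N)%N).
Hypotheses (V0 : (0 < V)%N) (V1 : ((2 * H) ^ 2 <= V ^ 2 * N)%N).
Hypotheses (V2 : (V ^ 2 * N <= 4 * (2 * H) ^ 2)%N).
Hypotheses (K1 : (K ^ 2 * N <= L ^ 2)%N) (K2 : (L ^ 2 < K.+1 ^ 2 * N)%N).
Hypotheses (EB : energy_bound N B) (VK : (2 * V * K <= H)%N).

Let Lam := (2 * H)%N.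
Variable q : nat.
Hypotheses (Vq : (V <= q)%N) (Lq : (Lam <= q)%N) (Kq : (K <= q)%N).
Hypotheses (q1 : (8 * (V * L * Lam ^ 2) <= q)%N) (q2 : (4 * (V * K.*2.+1) <= q)%N).
Hypotheses (ell1 : 1 <= ell) (hq : harm R q <= ell).
Variable rr : nat.
Hypotheses (Lr : (L <= 2 ^ rr)%N) (rell : rr.+1%:R <= ell).

Let Om : R := 2256 * Lam%:R ^+ 2 * ell.

Let ell0 : 0 <= ell. Proof. exact: le_trans ler01 ell1. Qed.
Let Om0 : 0 <= Om.
Proof. by apply: mulr_ge0 ell0; apply: mulr_ge0; [exact: ler0n|exact: exprn_ge0]. Qed.

(** Q and q are so large that the discretisation errors, summed over the V dual
frequencies, do not exceed the main term. *)
Lemma dual_term_bound_balanced m : (m < V)%N -> nrm (dual_term R s L Lam q m.+1) <=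
  L%:R * Lam%:R / V%:R + (2 * (total_mass R s L Lam + Lam%:R) + 2 * Om * L%:R) / m.+1%:R
  + Om * L%:R / V%:R
  + 4 * Om * ((\sum_(k < K) rmax s L (2 * (m.+1 * k.+1))%:R) / m.+1%:R).
Proof.
move=> mV.
have VR : 0 < V%:R :> R by rewrite ltr0n.
have q0 : (0 < q)%N by exact: leq_trans Vq.
have qR : 0 < q%:R :> R by rewrite ltr0n.
have mR : 0 < m.+1%:R :> R by [].
have rN0 : 0 <= Num.sqrt N%:R :> R by rewrite sqrtr_ge0.
have mLam : m.+1%:R * Num.sqrt N%:R <= 2 * Lam%:R :> R.
  apply: (@le_trans _ _ (V%:R * Num.sqrt N%:R)); first by rewrite ler_wpM2r// ler_nat.
  rewrite -(ler_pXn2r (n := 2)) ?nnegrE ?mulr_ge0//.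
  rewrite !exprMn sqr_sqrtr// -!natrX -!natrM ler_nat; apply: (leq_trans V2).
  exact: leqnn.
have OmP := fejer_variation Lq q0 ell1 hq.
have D := dual_term_bound N0 Ns L0 LN K2 q0 (isT : (0 < m.+1)%N) (leq_trans mV Vq) mLam OmP.
apply: (le_trans D) => {D}; rewrite -/Om.
have q2R : (q.*2)%:R = 2 * q%:R :> R by rewrite -mul2n natrM.
pose Ad : R := 16 * Lam%:R ^+ 3 * ((q.*2)%:R)^-1.
have Ad0 : 0 <= Ad.
  by rewrite mulr_ge0 ?invr_ge0.
have AdL : V%:R * (L%:R * Ad) <= Lam%:R.
  have e : 8 * (V%:R * L%:R * Lam%:R ^+ 2) <= q%:R :> R.
    by rewrite -natrX -!natrM ler_nat.
  have -> : V%:R * (L%:R * Ad) = Lam%:R * ((8 * (V%:R * L%:R * Lam%:R ^+ 2)) / q%:R).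
    by rewrite /Ad q2R; field; rewrite gt_eqF.
  by rewrite -[leRHS]mulr1 ler_wpM2l// ler_pdivrMr// mul1r.
rewrite -/Ad.
have t1 : L%:R ^+ 2 * Ad <= L%:R * Lam%:R / V%:R.
  rewrite ler_pdivlMr//; have -> : L%:R ^+ 2 * Ad * V%:R = L%:R * (V%:R * (L%:R * Ad)) by ring.
  by rewrite ler_wpM2l.
have t2 : L%:R * Ad <= Lam%:R.
  by apply: le_trans AdL; rewrite ler_peMl ?mulr_ge0// ler1n.
have t3 : (2 * K%:R + 1) * (L%:R * (8 * m.+1%:R / (q.*2.+1)%:R)) <= m.+1%:R * (L%:R / V%:R) :> R.
  have e : 4 * (V%:R * (2 * K%:R + 1)) <= q%:R :> R.
    have -> : 2 * K%:R + 1 = (K.*2.+1)%:R :> R by rewrite -natrM mul2n natr1.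
    by rewrite -!natrM ler_nat.
  have e2 : (2 * q%:R <= (q.*2.+1)%:R :> R) by rewrite -q2R ler_nat.
  have e3 : 0 < (q.*2.+1)%:R :> R by [].
  set q' : R := (q.*2.+1)%:R in e2 e3 *.
  have -> : (2 * K%:R + 1) * (L%:R * (8 * m.+1%:R / q')) =
    m.+1%:R * (L%:R * ((8 * (2 * K%:R + 1)) / q')) by ring.
  rewrite ler_wpM2l// ler_wpM2l// ler_pdivrMr// ler_pdivlMl//.
  by move: e; rewrite mulrCA; lra.
have m1 : 0 <= (m.+1%:R)^-1 :> R by rewrite invr_ge0.
pose Sg : R := \sum_(k < K) rmax s L (2 * (m.+1 * k.+1))%:R.
have -> : \sum_(k < K) rmax s L (2 * m.+1%:R * k.+1%:R) = Sg.
  by apply: eq_bigr => k _; rewrite !natrM mulrA.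
rewrite -/Sg.
have -> : L%:R * Lam%:R / V%:R + (2 * (total_mass R s L Lam + Lam%:R) + 2 * Om * L%:R) / m.+1%:R
   + Om * L%:R / V%:R + 4 * Om * (Sg / m.+1%:R) = L%:R * Lam%:R / V%:R +
   (m.+1%:R)^-1 * (2 * (total_mass R s L Lam + Lam%:R) +
     Om * (m.+1%:R * (L%:R / V%:R) + 2 * (L%:R + 2 * Sg))).
  by field; rewrite !gt_eqF.
apply: lerD => //; apply: ler_wpM2l => //; apply: lerD.
  by rewrite ler_wpM2l// lerD2l.
by apply: ler_wpM2l => //; rewrite lerD2r.
Qed.

Lemma dual_sum_bound : \sum_(m < V) nrm (dual_term R s L Lam q m.+1) <=
  L%:R * Lam%:R + ell * (2 * (total_mass R s L Lam + Lam%:R) + 2 * Om * L%:R)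
  + Om * L%:R + 8 * Om * (ell ^+ 4 * L%:R * Num.sqrt B).
Proof.
have VR : V%:R != 0 :> R by rewrite pnatr_eq0 -lt0n.
have hV : harm R V <= ell by apply: le_trans hq; exact: harm_mono.
have hK : harm R K <= ell by apply: le_trans hq; exact: harm_mono.
have Z := grid_rmax_bound B0 EB N0 Ns sL LN NH HN K1 VK Lr ell1 rell hK hV.
apply: (le_trans (ler_sum _ (fun m _ => dual_term_bound_balanced (ltn_ord m)))).
rewrite !big_split/=.
have cst (c : R) : \sum_(m < V) c / V%:R = c.
  by rewrite sumr_const card_ord -[_ *+ _]mulr_natr divfK.
rewrite !cst -!mulr_sumr.
have T0 : 0 <= total_mass R s L Lam.
  by apply: sumr_ge0 => i _; apply: sumr_ge0 => j _; exact: nrm_ge0.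
apply: lerD; last first.
  apply: (@le_trans _ _ (4 * Om * (2 * ell ^+ 4 * L%:R * Num.sqrt B))).
    by rewrite ler_wpM2l// mulr_ge0.
  by rewrite le_eqVlt; apply/orP; left; apply/eqP; ring.
rewrite lerD2r lerD2l [leRHS]mulrC ler_wpM2l//.
by rewrite addr_ge0// mulr_ge0// ?addr_ge0// mulr_ge0.
Qed.

(** The error part is handled by Cauchy-Schwarz against the unknown itself, and
[total_mass] also contains its square root; both are absorbed by [quadratic_bound].
What remains is the diagonal contribution and the first moment over the products
2 nu k. *)
Lemma improved_energy :
  energy R s L H <= 64 * (2256 * ell ^+ 5) * (1 + Num.sqrt B) * H%:R * L%:R.
Proof.
have Vq' := Vq; have LL := Lq.
have N4 : (N <= Lam ^ 2)%N by apply: (leq_trans NH); rewrite leq_exp2r// leq_pmull.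
have LV : Lam%:R <= V%:R * Num.sqrt N%:R :> R.
  rewrite -(ler_pXn2r (n := 2)) ?nnegrE ?mulr_ge0 ?sqrtr_ge0//.
  by rewrite exprMn sqr_sqrtr// -!natrX -natrM ler_nat.
have EE := error_energy N0 Ns sL Vq Lq L0 N4 LV ell1 hq.
have DS := dual_sum_bound.
have TM := total_mass_le R s L Lam.
have EO := energy_offdiag R s L H; rewrite -/Lam in EO.
set P := offdiag R s L Lam in TM EO *.
have P0 : 0 <= P.
  by apply: sumr_ge0 => i _; apply: sumr_ge0 => j _; exact: sqr_ge0.
pose x := Num.sqrt P.
have x0 : 0 <= x by rewrite sqrtr_ge0.
have xE : x ^+ 2 = P by rewrite sqr_sqrtr.
have L1 : 1 <= Num.sqrt L%:R :> R by rewrite -[leLHS]sqrtr1; apply: ler_wsqrtr; rewrite ler1n.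
pose T := Lam%:R * ell * Num.sqrt L%:R.
have T0 : 0 <= T by rewrite !mulr_ge0// sqrtr_ge0.
have TE : T ^+ 2 = Lam%:R ^+ 2 * ell ^+ 2 * L%:R by rewrite !exprMn sqr_sqrtr.
have P1 : P <= x * (80 * T) + 2 * \sum_(m < V) nrm (dual_term R s L Lam q m.+1).
  rewrite -[leLHS]ger0_norm// -nrm_real /P (offdiag_split R s L Lam Vq).
  apply: (le_trans (nrmD _ _)); apply: lerD; last first.
    apply: (le_trans (nrm_sum _ _ _)); rewrite mulr_sumr; apply: ler_sum => m _.
    by apply: (le_trans (nrmD _ _)); rewrite dual_term_neg; lra.
  apply: (@le_trans _ _ (\sum_(i < Lam) \sum_(j < Lam | j != i)
     nrm (rsum s L (i%:R - j%:R : R)) * nrm (main_error s L q V (i%:R - j%:R : R)))).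
    apply: (le_trans (nrm_sum _ _ _)); apply: ler_sum => i _.
    apply: (le_trans (nrm_sum _ _ _)); apply: ler_sum => j _.
    by rewrite normcM nrm_conj.
  rewrite -(ler_pXn2r (n := 2)) ?nnegrE//; last 2 first.
  - by apply: sumr_ge0 => i _; apply: sumr_ge0 => j _; rewrite mulr_ge0// nrm_ge0.
  - by rewrite !mulr_ge0.
  apply: (le_trans (cauchy_schwarz_offdiag _ _)); rewrite exprMn xE.
  rewrite ler_wpM2l//; apply: (le_trans EE).
  by rewrite exprMn TE -natrX le_eqVlt; apply/orP; left; apply/eqP; ring.
have sB : 0 <= Num.sqrt B by rewrite sqrtr_ge0.
have Lam1 : 1 <= Lam%:R :> R by rewrite ler1n muln_gt0 H0.
have LR1 : 1 <= L%:R :> R by rewrite ler1n.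
have H1 : 1 <= H%:R :> R by rewrite ler1n.
have LamE : Lam%:R = 2 * H%:R :> R by rewrite /Lam natrM.
(* Every term below is a constant multiple of W, up to the factor sqrt B. *)
pose W : R := Lam%:R ^+ 2 * L%:R * ell ^+ 5.
pose U := 2256 * W.
have ellX k : 1 <= ell ^+ k by rewrite exprn_ege1.
have LL0 : 0 <= Lam%:R ^+ 2 * L%:R :> R by rewrite mulr_ge0// exprn_ge0.
have TW : T ^+ 2 <= W.
  rewrite TE /W mulrAC; apply: ler_wpM2l => //.
  by rewrite ler_weXn2l.
have W0 : 0 <= W by apply: le_trans TW; exact: sqr_ge0.
have w1 : Lam%:R * L%:R <= Lam%:R ^+ 2 * L%:R :> R.
  by rewrite ler_wpM2r// expr2 ler_peMl.
have w2 : L%:R * Lam%:R <= W.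
  rewrite mulrC; apply: (le_trans w1); rewrite /W -[leLHS]mulr1.
  by rewrite ler_wpM2l.
have w3 : ell * (Lam%:R * L%:R) <= W.
  rewrite /W mulrC; apply: ler_pM => //.
  by rewrite -[leLHS]expr1 ler_weXn2l.
have w4 : ell * Lam%:R <= W.
  by apply: le_trans w3; rewrite ler_wpM2l// ler_peMr.
have ol k : (k <= 4)%N -> Om * L%:R * ell ^+ k <= U.
  move=> k4; have -> : Om * L%:R * ell ^+ k = 2256 * (Lam%:R ^+ 2 * L%:R * ell ^+ k.+1).
    by rewrite /Om [ell ^+ k.+1]exprS; ring.
  by apply: ler_wpM2l; [exact: ler0n|rewrite /W ler_wpM2l// ler_weXn2l].
have Q1 : x ^+ 2 <= 84 * (T * x) + (10 * W + 6 * U + 16 * U * Num.sqrt B).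
  rewrite xE; apply: (le_trans P1).
  have xT : ell * Lam%:R * x <= T * x.
    rewrite ler_wpM2r// /T -[ell * _]mulr1 [ell * _]mulrC ler_wpM2l//.
    by rewrite mulr_ge0.
  have o1 := ol 0%N isT; have o2 := ol 1%N isT; have o3 := ol 4%N isT.
  rewrite expr0 mulr1 in o1; rewrite expr1 in o2.
  have o4 : Om * (ell ^+ 4 * L%:R * Num.sqrt B) <= U * Num.sqrt B.
    by rewrite mulrA ler_wpM2r// [ell ^+ 4 * _]mulrC mulrA.
  have t1 : ell * (2 * (total_mass R s L Lam + Lam%:R) + 2 * Om * L%:R) <=
      2 * (ell * (Lam%:R * L%:R)) + 2 * (ell * Lam%:R * x) + 2 * (ell * Lam%:R) + 2 * (Om * L%:R * ell).
    have := ler_wpM2l ell0 TM; rewrite -/x.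
    exact: collect_mass.
  have -> : x * (80 * T) = 80 * (T * x) by ring.
  have -> : 16 * U * Num.sqrt B = 16 * (U * Num.sqrt B) by rewrite mulrA.
  rewrite -(mulrA 8) in DS.
  exact: (collect_terms t1 DS o4 xT o2 w4 w3 o1 w2).
have Q2 := quadratic_bound Q1; rewrite xE in Q2.
have Q3 : P <= 32 * U * (1 + Num.sqrt B).
  have UW : U = 2256 * W by [].
  have U0 : 0 <= U by exact: mulr_ge0 (ler0n _ _) W0.
  have UB : 0 <= U * Num.sqrt B by exact: mulr_ge0.
  have E16 : 16 * U * Num.sqrt B = 16 * (U * Num.sqrt B) by rewrite mulrA.
  rewrite E16 in Q2; rewrite mulrDr mulr1 -(mulrA 32 U).
  exact: collect_powers Q2 TW UW W0.
have Lam0 : 0 < Lam%:R :> R by rewrite (lt_le_trans ltr01).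
rewrite -(ler_pM2l Lam0); apply: (le_trans EO); apply: (le_trans Q3).
rewrite le_eqVlt; apply/orP; left; apply/eqP; rewrite /U /W LamE.
by ring.
Qed.
End Improve.
(** A power of log N when 2^p is of the order of N. *)
Definition gain p : R := 64 * (2256 * (4 * p + 13)%:R ^+ 5).

Lemma gain_ge1 p : 1 <= gain p.
Proof.
have h : 1 <= (4 * p + 13)%:R ^+ 5 :> R by rewrite exprn_ege1// ler1n; lia.
by rewrite /gain; move: (_ ^+ 5) h => t h; lra.
Qed.

(** V sqrt N <= 2 H + sqrt N <= 3 H and K sqrt N <= L give 2 V K N <= 6 H L <= H N. *)
Lemma sizes_nat N H L V K p : (0 < N)%N -> (N <= 2 ^ p)%N -> (6 * L <= N)%N ->
  (N <= H ^ 2)%N -> (H <= 4 * N)%N -> (0 < V)%N ->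
  (V <= 2 * H)%N -> (V.-1 ^ 2 * N < (2 * H) ^ 2)%N -> (K ^ 2 * N <= L ^ 2)%N ->
  [/\ (V ^ 2 * N <= 4 * (2 * H) ^ 2)%N, (2 * V * K <= H)%N, (K <= L)%N &
      (8 * (V * L * (2 * H) ^ 2) <= 2 ^ (4 * p + 12))%N &&
      (4 * (V * K.*2.+1) <= 2 ^ (4 * p + 12))%N && (2 * H <= 2 ^ (p + 3))%N].
Proof.
move=> N0 Np LN NH HN V0 VH V1 K1.
have v1 : (V.-1 * N <= 2 * H ^ 2)%N.
  rewrite -(@leq_exp2r _ _ 2)// expnMn (expnS N 1) expn1 mulnA.
  apply: (@leq_trans ((2 * H) ^ 2 * H ^ 2)).
    by apply: leq_mul => //; exact: ltnW.
  by have -> : ((2 * H) ^ 2 * H ^ 2 = (2 * H ^ 2) ^ 2)%N by ring.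
have v2 : (V ^ 2 * N <= 9 * H ^ 2)%N.
  have -> : (V ^ 2 * N = V.-1 ^ 2 * N + 2 * (V.-1 * N) + N)%N.
    by rewrite -{1}(prednK V0) -addn1 sqrnD; ring.
  have -> : (9 * H ^ 2 = (2 * H) ^ 2 + 2 * (2 * H ^ 2) + H ^ 2)%N by ring.
  by rewrite leq_add// leq_add ?leq_mul2l ?v1 ?orbT// ltnW.
have KL : (K <= L)%N.
  rewrite -(@leq_exp2r _ _ 2)//; apply: leq_trans K1; exact: leq_pmulr.
have HR : (2 * H <= 2 ^ (p + 3))%N by rewrite expnD; lia.
split => //.
- by apply: (leq_trans v2); rewrite expnMn mulnA leq_mul2r orbT.
- have vk : (V * K * N <= 3 * (H * L))%N.
    rewrite -(@leq_exp2r _ _ 2)//.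
    have -> : ((V * K * N) ^ 2 = (V ^ 2 * N) * (K ^ 2 * N))%N by ring.
    have -> : ((3 * (H * L)) ^ 2 = (9 * H ^ 2) * L ^ 2)%N by ring.
    exact: leq_mul.
  rewrite -(leq_pmul2r N0) -mulnA -mulnA.
  apply: (@leq_trans (2 * (3 * (H * L)))); first by rewrite leq_mul2l /= mulnA.
  have -> : (2 * (3 * (H * L)) = H * (6 * L))%N by ring.
  by rewrite leq_mul2l LN orbT.
- have L2 : (L <= 2 ^ p)%N by lia.
  have V2 : (V <= 2 ^ (p + 3))%N by exact: leq_trans HR.
  rewrite HR andbT; apply/andP; split.
    have -> : (2 ^ (4 * p + 12) = 8 * (2 ^ (p + 3) * 2 ^ p * (2 ^ (p + 3)) ^ 2))%N.
      rewrite -expnM -!expnD -[X in (X * 2 ^ _)%N]/(2 ^ 3)%N -expnD; congr (_ ^ _)%N; lia.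
    by rewrite leq_mul2l /= leq_mul// ?leq_mul// leq_exp2r.
  have K2 : (K.*2.+1 <= 2 ^ (p + 2))%N.
    have : (0 < 2 ^ p)%N by rewrite expn_gt0.
    by rewrite expnD; lia.
  have -> : (2 ^ (4 * p + 12) = 4 * (2 ^ (p + 3) * 2 ^ (p + 2) * 2 ^ (2 * p + 5)))%N.
    rewrite -!expnD -[X in (X * 2 ^ _)%N]/(2 ^ 2)%N -expnD; congr (_ ^ _)%N; lia.
  rewrite leq_mul2l /=; apply: (@leq_trans (2 ^ (p + 3) * 2 ^ (p + 2))).
    exact: leq_mul.
  by rewrite leq_pmulr// expn_gt0.
Qed.

Lemma improve N p (B : R) : (0 < N)%N -> (N <= 2 ^ p)%N -> 0 <= B ->
  energy_bound N B -> energy_bound N (gain p * (1 + Num.sqrt B)).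
Proof.
move=> N0 Np B0 EB s L H Ns sL LN NH HN.
case: (posnP L) => [->|L0].
  by rewrite mulr0; have := energy_trivial s 0 H; rewrite expr0n/= mulr0.
have H0 : (0 < H)%N by rewrite lt0n; apply/eqP => h; move: NH; rewrite h leqNgt N0.
have HH : (0 < 2 * H)%N by rewrite muln_gt0.
have [V /andP[V0 VH] /andP[V1 V2]] := min_sqr_above N0 HH.
have [K K1 K2] := max_sqr_below L N0.
have [V3 VK KL /andP[/andP[q1 q2] HR]] := sizes_nat N0 Np LN NH HN V0 VH V2 K1.
have up : (2 ^ (p + 3) <= 2 ^ (4 * p + 12))%N by rewrite leq_exp2l//; lia.
have Lp : (L <= 2 ^ p)%N by lia.
have Lq : (2 * H <= 2 ^ (4 * p + 12))%N by exact: leq_trans up.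
have Vq : (V <= 2 ^ (4 * p + 12))%N by exact: leq_trans Lq.
have Kq : (K <= 2 ^ (4 * p + 12))%N.
  by apply: (leq_trans KL); apply: (leq_trans Lp); rewrite leq_exp2l//; lia.
have hq : harm R (2 ^ (4 * p + 12)) <= (4 * p + 13)%:R.
  by apply: (le_trans (harm_pow2 _ _)); rewrite ler_nat; lia.
apply: (improved_energy N0 L0 H0 B0 Ns sL LN NH HN V0 V1 V3 K1 K2 EB VK Vq Lq Kq q1 q2 _ hq Lp).
  by rewrite ler1n; lia.
by rewrite ler_nat; lia.
Qed.

(** With D = gain p, the map y -> D (1 + sqrt y) at least halves every y >= 16 D^2.
Starting from the trivial bound y = N, after N steps only the threshold 16 D^2
remains. *)
Lemma bootstrap N p : (0 < N)%N -> (N <= 2 ^ p)%N -> energy_bound N (16 * gain p ^+ 2).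
Proof.
move=> N0 Np.
have g1 := gain_ge1 p; set D := gain p in g1 *.
have D0 : 0 <= 16 * D ^+ 2 by rewrite mulr_ge0// exprn_ge0//; lra.
(* The bound reached after n steps. *)
pose y n : R := Num.max (16 * D ^+ 2) (N%:R / 2 ^+ n).
have y0 n : 0 <= y n by rewrite le_max D0.
suff H n : energy_bound N (y n).
  apply: energy_bound_mono (H N); rewrite ge_max lexx/=.
  rewrite ler_pdivrMr ?exprn_gt0//.
  have h1 : N%:R <= 2 ^+ N :> R by rewrite -natrX ler_nat ltnW// ltn_expl.
  have h2 : 0 <= 2 ^+ N :> R by rewrite exprn_ge0.
  have d1 : 1 <= D ^+ 2 by rewrite exprn_ege1.
  by apply: (le_trans h1); rewrite ler_peMl//; lra.
elim: n => [|n IH].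
  move=> s L X _ _ LN _ _; apply: (le_trans (energy_trivial s L X)).
  rewrite expr2 mulrA [y _ * _]mulrC -!mulrA ler_wpM2l//.
  rewrite ler_wpM2r// /y expr0 divr1 le_max; apply/orP; right; rewrite ler_nat; lia.
apply: energy_bound_mono (improve N0 Np (y0 n) IH).
have t0 : 4 * D <= Num.sqrt (y n).
  rewrite -(ler_pXn2r (n := 2)) ?nnegrE ?sqrtr_ge0//; last by lra.
  rewrite sqr_sqrtr// exprMn /y le_max; apply/orP; left.
  by rewrite -natrX.
have tE : Num.sqrt (y n) ^+ 2 = y n by rewrite sqr_sqrtr.
apply: (@le_trans _ _ (y n / 2)).
  rewrite -[X in _ <= X / 2]tE -/D; move: (Num.sqrt (y n)) t0 => t t0.
  have a1 : D * t <= t / 4 * t by rewrite ler_wpM2r//; lra.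
  have a2 : t * 4 <= t * t by rewrite ler_wpM2l//; lra.
  by rewrite expr2; lra.
rewrite ler_pdivrMr// {1}/y ge_max; apply/andP; split.
  have : 16 * D ^+ 2 <= y n.+1 by rewrite le_max lexx.
  by have := y0 n.+1; lra.
have : N%:R / 2 ^+ n.+1 <= y n.+1 by rewrite le_max lexx orbT.
by rewrite exprS invfM mulrCA mulrC ler_pdivrMr// mulrC.
Qed.

End Bootstrap.

(** * All interval lengths and all ranges of frequencies *)

Section LongSums.
Variable R : realType.

Lemma rsum_cat s a b (z : R) : rsum s (a + b) z = rsum s a z + rsum (s + a) b z.
Proof.
rewrite /rsum big_split_ord/=; congr (_ + _); apply: eq_bigr => i _.
by rewrite addnA.
Qed.

Lemma energy_cat s a b X :
  energy R s (a + b) X <= 2 * energy R s a X + 2 * energy R (s + a) b X.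
Proof.
rewrite /energy !mulr_sumr -big_split/=; apply: ler_sum => h _.
rewrite rsum_cat; have := nrmD (rsum s a (h.+1%:R : R)) (rsum (s + a) b h.+1%:R).
have := nrm_ge0 (rsum s a (h.+1%:R : R) + rsum (s + a) b h.+1%:R).
move: (nrm (_ + _)) (nrm (rsum s a _)) (nrm (rsum (s + a) _ _)) => x y z x0 xyz.
by have := sqr_ge0 (y - z); nra.
Qed.

(** For N >= 6 an interval of length N + 1 is covered by 14 intervals of length
floor(N / 6), and joining two intervals at most doubles the constant; for N < 6 the
trivial bound suffices. *)
Lemma energy_long N (c : R) L X : (0 < N)%N -> energy_bound N c -> 6 <= c ->
  (L <= N.+1)%N -> (N <= X ^ 2)%N -> (X <= 4 * N)%N ->
  energy R N L X <= 2 ^+ 14 * c * X%:R * L%:R.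
Proof.
move=> N0 EB c6 LN NX XN.
have c0 : 0 <= c by lra.
have [N6|N6] := ltnP N 6.
  apply: (le_trans (energy_trivial R N L X)).
  have h : 1 <= 2 ^+ 14 :> R by rewrite exprn_ege1// ler1n.
  have -> : 2 ^+ 14 * c * X%:R * L%:R = X%:R * (2 ^+ 14 * c * L%:R).
    by move: (2 ^+ 14) => G; ring.
  rewrite expr2 ler_wpM2l// ler_wpM2r//.
  apply: (@le_trans _ _ c); last by rewrite ler_peMl.
  by apply: le_trans c6; rewrite ler_nat; lia.
have step j : forall s L, (N <= s)%N -> (s + L <= 4 * N)%N -> (L <= j * (N %/ 6))%N ->
    energy R s L X <= 2 ^+ j * c * X%:R * L%:R.
  elim: j => [|j IH] s M Ns sM MN.
    move: MN; rewrite mul0n leqn0 => /eqP ->; rewrite mulr0.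
    by have := energy_trivial R s 0 X; rewrite expr0n/= mulr0.
  have h : 1 <= 2 ^+ j.+1 :> R by rewrite exprn_ege1// ler1n.
  have [Ms|Ms] := leqP M (N %/ 6).
    apply: (@le_trans _ _ (c * X%:R * M%:R)); first by apply: EB => //; lia.
    by rewrite -!mulrA ler_peMl// !mulr_ge0.
  rewrite -(subnKC (ltnW Ms)); apply: (le_trans (energy_cat _ _ _ _)).
  have e1 : energy R s (N %/ 6) X <= 2 ^+ j * c * X%:R * (N %/ 6)%:R.
    apply: (@le_trans _ _ (c * X%:R * (N %/ 6)%:R)); first by apply: EB => //; lia.
    by rewrite -!mulrA ler_peMl ?mulr_ge0// exprn_ege1// ler1n.
  have e2 : energy R (s + N %/ 6) (M - N %/ 6) X <= 2 ^+ j * c * X%:R * (M - N %/ 6)%:R.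
    by apply: IH; lia.
  apply: (le_trans (lerD (ler_wpM2l (ler0n R 2) e1) (ler_wpM2l (ler0n R 2) e2))).
  by rewrite exprS natrD le_eqVlt; apply/orP; left; apply/eqP; ring.
by apply: step => //; lia.
Qed.

Lemma exchange_big2 n L (F : nat -> nat -> nat -> R[i]) :
  \sum_(i < n) \sum_(a < L) \sum_(b < L) F i a b =
  \sum_(a < L) \sum_(b < L) \sum_(i < n) F i a b.
Proof.
rewrite exchange_big/=; apply: eq_bigr => a _.
by rewrite exchange_big.
Qed.

Lemma shifted_mass s L Lam (z : R) :
  ((\sum_(i < Lam) \sum_(j < Lam) nrm (rsum s L (z + (i%:R - j%:R))) ^+ 2)%:C)%C =
  \sum_(a < L) \sum_(b < L) e (z * (sqrtn R (s + a) - sqrtn R (s + b))) *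
     ((fejer Lam (sqrtn R (s + a) - sqrtn R (s + b)))%:C)%C.
Proof.
have sqE (y : R) : ((nrm (rsum s L y) ^+ 2)%:C)%C =
    \sum_(a < L) \sum_(b < L) e (y * (sqrtn R (s + a) - sqrtn R (s + b))).
  rewrite -mul_conj /rsum conj_sum big_distrlr/=; apply: eq_bigr => a _.
  by apply: eq_bigr => b _; rewrite -expiB mulrBr.
rewrite rmorph_sum/=.
under eq_bigr => i _ do rewrite rmorph_sum/=.
under eq_bigr => i _ do under eq_bigr => j _ do rewrite sqE.
under eq_bigr => i _ do rewrite (exchange_big2 Lam L (fun j a b =>
   e ((z + (i%:R - j%:R)) * (sqrtn R (s + a) - sqrtn R (s + b))))).
rewrite (exchange_big2 Lam L (fun i a b => \sum_(j < Lam)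
   e ((z + (i%:R - j%:R)) * (sqrtn R (s + a) - sqrtn R (s + b))))).
apply: eq_bigr => a _; apply: eq_bigr => b _; rewrite fejerE mulr_sumr.
apply: eq_bigr => i _; rewrite mulr_sumr; apply: eq_bigr => j _.
by rewrite -expiD mulrDl.
Qed.

(** A translation of all frequencies by z only introduces the phases
e(z (sqrt a - sqrt b)) in front of the nonnegative values of the Fejer kernel. *)
Lemma shifted_mass_le s L Lam (z : R) :
  \sum_(i < Lam) \sum_(j < Lam) nrm (rsum s L (z + (i%:R - j%:R))) ^+ 2 <=
  \sum_(i < Lam) \sum_(j < Lam) nrm (rsum s L (i%:R - j%:R : R)) ^+ 2.
Proof.
have E0 : \sum_(i < Lam) \sum_(j < Lam) nrm (rsum s L (i%:R - j%:R : R)) ^+ 2 =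
    \sum_(a < L) \sum_(b < L) fejer Lam (sqrtn R (s + a) - sqrtn R (s + b)).
  apply: (@complexI R); have := shifted_mass s L Lam 0.
  under eq_bigr => i _ do under eq_bigr => j _ do rewrite add0r.
  move=> ->; rewrite rmorph_sum/=; apply: eq_bigr => a _; rewrite rmorph_sum/=.
  by apply: eq_bigr => b _; rewrite mul0r expi0 mul1r.
rewrite E0 -[leLHS]ger0_norm; last first.
  by apply: sumr_ge0 => i _; apply: sumr_ge0 => j _; exact: sqr_ge0.
rewrite -nrm_real shifted_mass; apply: (le_trans (nrm_sum _ _ _)).
apply: ler_sum => a _; apply: (le_trans (nrm_sum _ _ _)); apply: ler_sum => b _.
by rewrite normcM nrm_expi mul1r nrm_real ger0_norm// sqr_ge0.
Qed.

Lemma sum_dist_energy s L n i : (i < n)%N ->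
  \sum_(j < n) nrm (rsum s L (i%:R - j%:R : R)) ^+ 2 =
  energy R s L i + (nrm (rsum s L (0 : R)) ^+ 2 + energy R s L (n - i).-1).
Proof.
move=> ni; rewrite -(subnKC (ltnW ni)) big_split_ord/= addKn; congr (_ + _).
  rewrite (reindex_inj rev_ord_inj)/=; apply: eq_bigr => j _.
  by rewrite natrB ?ltn_ord// subKr.
have : (0 < n - i)%N by rewrite subn_gt0.
case: (n - i)%N => // k _; rewrite big_ord_recl/= addn0 subrr; congr (_ + _).
apply: eq_bigr => j _; rewrite /bump/= add1n natrD opprD addrA subrr sub0r.
by rewrite rsum_conj nrm_conj.
Qed.

Lemma mass_le_energy s L Lam :
  \sum_(i < Lam) \sum_(j < Lam) nrm (rsum s L (i%:R - j%:R : R)) ^+ 2 <=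
  Lam%:R * (L%:R ^+ 2 + 2 * energy R s L Lam).
Proof.
rewrite mulr_natl -[X in _ *+ X]card_ord -sumr_const; apply: ler_sum => i _.
pose f (x : R) := nrm (rsum s L x) ^+ 2.
have iL := ltn_ord i.
have -> : \sum_(j < Lam) nrm (rsum s L (i%:R - j%:R : R)) ^+ 2 =
    energy R s L i + (f 0 + energy R s L (Lam - i).-1).
  exact: sum_dist_energy.
have f0 : f 0 <= L%:R ^+ 2.
  rewrite ler_pXn2r ?nnegrE ?nrm_ge0//.
  by apply: le_trans (rmax_ge s 0 (leqnn L)) (rmax0_le _ _ _).
have mono a : (a <= Lam)%N -> energy R s L a <= energy R s L Lam.
  move=> aL; apply: (sum_nat_mono (c := fun h => nrm (rsum s L h.+1%:R) ^+ 2)) => // h.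
  exact: sqr_ge0.
have m1 := mono i (ltnW iL).
have m2 : energy R s L (Lam - i).-1 <= energy R s L Lam by apply: mono; lia.
lra.
Qed.

(** In the square array of the z + i - j with i, j < 2 N, each of the N rows i >= N
contains the whole block z, ..., z + N - 1; so N times the block is at most the mass of
the array, which is largest for z = 0. *)
Lemma block_energy N s L (z : R) : (0 < N)%N ->
  \sum_(d < N) nrm (rsum s L (z + d%:R)) ^+ 2 <=
  2 * (L%:R ^+ 2 + 2 * energy R s L (2 * N)).
Proof.
move=> N0; have NR : 0 < N%:R :> R by rewrite ltr0n.
rewrite -(ler_pM2l NR).
have -> : N%:R * (2 * (L%:R ^+ 2 + 2 * energy R s L (2 * N))) =
    (2 * N)%:R * (L%:R ^+ 2 + 2 * energy R s L (2 * N)) by rewrite natrM; ring.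
apply: le_trans (mass_le_energy s L (2 * N)).
apply: le_trans (shifted_mass_le s L (2 * N) z).
pose f (i j : nat) := nrm (rsum s L (z + (i%:R - j%:R))) ^+ 2.
have f0 i j : 0 <= f i j by exact: sqr_ge0.
rewrite mulr_natl -[X in _ *+ X]card_ord -sumr_const.
apply: (@le_trans _ _ (\sum_(x < N) \sum_(j < 2 * N) f (N + x)%N j)); last first.
  apply: (sum_segment_le (G := fun i => \sum_(j < 2 * N) f i j) (P := xpredT)) => //; last by lia.
  by move=> i; apply: sumr_ge0.
apply: ler_sum => x _; have xN := ltn_ord x.
apply: le_trans (sum_segment_le (G := f (N + x)%N) (n := 2 * N) (a := x.+1) (H := N) (P := xpredT) _ _ _) => //; last by lia.
rewrite (reindex_inj rev_ord_inj)/=; apply: ler_sum => d _; have dN := ltn_ord d.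
rewrite /f; have -> : (N + x)%:R - (x.+1 + d)%:R = (N - d.+1)%:R :> R.
  by rewrite -natrB; [congr (_%:R)|]; lia.
exact: lexx.
Qed.

End LongSums.

(** * From nat-indexed sums to the dyadic moment *)

Section Final.
Variable R : realType.

Lemma dyadic_sum (V : nmodType) (X : R) (F : int -> V) : 0 <= X ->
  (\sum_(x \in dyadic X) F x)%classic =
  \sum_(0 <= k < (Num.truncn X).+1 | X / 2 <= k%:R) F (Posz k).
Proof.
move=> X0; pose s := [seq Posz k | k <- iota 0 (Num.truncn X).+1 & X / 2 <= k%:R].
have -> : dyadic X = [set` s]%classic.
  apply/seteqP; split => x /=.
    move=> /andP[h1 h2].
    have x0 : 0 <= x by rewrite -(ler0z R); apply: le_trans h1; rewrite divr_ge0.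
    case: x x0 h1 h2 => // k _ h1 h2.
    apply/mapP; exists k => //; rewrite mem_filter h1 mem_iota/= add0n ltnS.
    by rewrite truncn_ge_nat.
  move=> /mapP[k]; rewrite mem_filter mem_iota/= add0n ltnS => /andP[h1 h2] ->.
  by apply/andP; split => //; rewrite -truncn_ge_nat.
rewrite -fsbig_seq ?big_map ?big_filter; first by rewrite /index_iota subn0.
rewrite map_inj_uniq; first by rewrite filter_uniq// iota_uniq.
by move=> a b [].
Qed.

(** N is the least integer with n / 2 <= N. *)
Lemma expsum_rsum (n : R) : 1 <= n -> exists N L, [/\ (0 < N)%N, (L <= N.+1)%N,
  N%:R <= n & forall h, expsum h n = rsum N L (h%:~R : R)].
Proof.
move=> n1; have n0 : 0 <= n by lra.
have ex : exists k, n / 2 <= k%:R.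
  exists (Num.truncn (n / 2)).+1; apply: ltW.
  by have /andP[] := truncn_itv (x := n / 2) (divr_ge0 n0 (ler0n _ _)).
pose N := ex_minn ex.
have NP k : (n / 2 <= k%:R) = (N <= k)%N.
  rewrite /N; case: ex_minnP => m m1 m2; apply/idP/idP => [/m2//|mk].
  by apply: (le_trans m1); rewrite ler_nat.
have hN : n / 2 <= N%:R by rewrite NP.
have N0 : (0 < N)%N by rewrite lt0n; apply/eqP => h; rewrite h in hN; lra.
have hN1 : N.-1%:R < n / 2 by rewrite ltNge NP -ltnNge prednK.
have NE : N%:R = N.-1%:R + 1 :> R by rewrite natr1 prednK.
have /andP[T1 T2] := truncn_itv n0; set T := Num.truncn n in T1 T2 *.
exists N, (T.+1 - N)%N; split => //.
- have : (T <= 2 * N)%N by rewrite -(ler_nat R) natrM; lra.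
  lia.
- have [N1|N1] := leqP N 1.
    by apply: le_trans n1; rewrite lern1.
  have : (2 <= N)%N by [].
  rewrite -(ler_nat R) => h; lra.
move=> h; rewrite /expsum dyadic_sum// -/T.
rewrite (eq_bigl (fun k => true && (N <= k)%N)) => [|k]; last by rewrite NP.
rewrite -(big_nat_widenl N 0 T.+1 xpredT)// -{1}[N]add0n big_addn big_mkord.
by apply: eq_bigr => k _; rewrite /sqrtn addnC.
Qed.

Lemma M2_le_energy (n H : R) N L : 0 < H ->
  (forall h, expsum h n = rsum N L (h%:~R : R)) ->
  M2 H n <= energy R N L (Num.truncn H).
Proof.
move=> H0 E; rewrite /M2 (dyadic_sum _ (ltW H0)).
rewrite big_mkcond big_mkord big_ord_recl/=.
have -> : (H / 2 <= 0%:R) = false by apply/negbTE; rewrite -ltNge divr_gt0.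
rewrite add0r; apply: ler_sum => k _; rewrite /bump/= add1n E.
by case: ifP => // _; exact: sqr_ge0.
Qed.

(** Up to H = 2 N the energy bound applies directly; beyond, the range is cut into
blocks of N consecutive frequencies. *)
Lemma energy_any_range N L (G H : R) : (0 < N)%N -> (L <= N.+1)%N -> 1 <= G -> 1 <= H ->
  N%:R <= H ^+ 2 ->
  (forall X, (N <= X ^ 2)%N -> (X <= 4 * N)%N -> energy R N L X <= G * X%:R * L%:R) ->
  energy R N L (Num.truncn H) <= 24 * G * H * L%:R.
Proof.
move=> N0 LN G1 H1 NH EG; have H0 : 0 <= H by lra.
have NR : 0 < N%:R :> R by rewrite ltr0n.
have /andP[T1 T2] := truncn_itv H0; set T := Num.truncn H in T1 T2 *.
have L0 : 0 <= L%:R :> R by [].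
have GL0 : 0 <= G * L%:R by rewrite mulr_ge0//; lra.
have GHL0 : 0 <= G * H * L%:R by rewrite mulrAC mulr_ge0.
have [TN|TN] := leqP T (2 * N).
  have e1 : energy R N L T <= energy R N L T.+1.
    apply: (sum_nat_mono (c := fun h => nrm (rsum N L h.+1%:R) ^+ 2)) => // h.
    exact: sqr_ge0.
  apply: (le_trans e1); apply: (@le_trans _ _ (G * T.+1%:R * L%:R)).
    apply: EG; last by clear -TN N0; lia.
    rewrite -(ler_nat R) natrX; apply: (le_trans NH).
    by rewrite ler_pXn2r ?nnegrE// ltW.
  have T3 : T.+1%:R <= 2 * H by rewrite -natr1; lra.
  apply: (@le_trans _ _ (G * (2 * H) * L%:R)).
    by rewrite ler_wpM2r// ler_wpM2l//; lra.
  have -> : G * (2 * H) * L%:R = 2 * (G * H * L%:R) by ring.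
  have -> : 24 * G * H * L%:R = 24 * (G * H * L%:R) by ring.
  lra.
pose k := (T %/ N).+1.
have Tk : (T <= k * N)%N by rewrite ltnW// /k ltn_ceil.
pose f (h : nat) := nrm (rsum N L (h.+1%:R : R)) ^+ 2.
have EG2 : energy R N L (2 * N) <= G * (2 * N)%:R * L%:R by apply: EG; clear -N0; nia.
apply: (@le_trans _ _ (\sum_(h < k * N) f h)).
  by apply: sum_nat_mono => // h; exact: sqr_ge0.
rewrite sum_blocks.
apply: (@le_trans _ _ (\sum_(x < k) 12 * (G * N%:R * L%:R))).
  apply: ler_sum => x _.
  have E d : f (x * N + d)%N = nrm (rsum N L ((x * N).+1%:R + d%:R : R)) ^+ 2.
    by rewrite /f -natrD addSn.
  rewrite (eq_bigr _ (fun (d : 'I_N) _ => E d)); apply: (le_trans (block_energy _ _ _ N0)).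
  have L2 : L%:R ^+ 2 <= 2 * (G * N%:R * L%:R).
    rewrite expr2 mulrA ler_wpM2r//.
    apply: (@le_trans _ _ (2 * N%:R)); first by rewrite -natrM ler_nat; clear -LN N0; lia.
    by rewrite ler_wpM2l// ler_peMl// ltW.
  rewrite natrM in EG2; move: L2 EG2.
  have -> : G * (2 * N%:R) * L%:R = 2 * (G * N%:R * L%:R) by ring.
  move: (_ ^+ 2) (energy _ _ _ _) (G * N%:R * L%:R) => a b c L2 EG2; lra.
rewrite sumr_const card_ord -[_ *+ _]mulr_natl.
have kN : k%:R * N%:R <= 2 * H.
  have h1 : (k * N <= T + N)%N by rewrite /k mulSn addnC leq_add2r leq_trunc_div.
  have h2 : (k * N <= 2 * T)%N by clear -h1 TN; lia.
  rewrite -natrM; apply: (@le_trans _ _ (2 * T)%:R); first by rewrite ler_nat.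
  by rewrite natrM ler_wpM2l.
have -> : k%:R * (12 * (G * N%:R * L%:R)) = 12 * ((k%:R * N%:R) * (G * L%:R)) by ring.
have -> : 24 * G * H * L%:R = 12 * ((2 * H) * (G * L%:R)) by ring.
by rewrite ler_wpM2l// ler_wpM2r.
Qed.

(** If 2^(p - 1) <= n then p - 1 <= ln n / ln 2, and 1 + eta ln n <= n^eta. *)
Lemma log_le_power (eta : R) : 0 < eta ->
  exists2 A : R, 0 <= A & forall n N, 1 <= n -> (0 < N)%N -> N%:R <= n ->
    exists2 p, (N <= 2 ^ p)%N & (4 * p + 13)%:R <= A * n `^ eta.
Proof.
move=> eta0; have l2 : 0 < ln 2 :> R by rewrite ln_gt0// ltr1n.
exists (17 + 4 / (eta * ln 2)); first by rewrite addr_ge0// divr_ge0// mulr_ge0// ltW.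
move=> n N n1 N0 Nn; have n0 : 0 < n by lra.
have ex : exists p, (N <= 2 ^ p)%N by exists N; rewrite ltnW// ltn_expl.
exists (ex_minn ex); case: ex_minnP => p p1 p2 //.
have pn : (p%:R - 1) * ln 2 <= ln n.
  case: p p1 p2 => [|p] p1 p2.
    apply: (@le_trans _ _ 0); last by rewrite ln_ge0.
    by rewrite sub0r mulN1r oppr_le0 ltW.
  rewrite -natr1 addrK mulr_natl -lnXn// ler_ln ?posrE ?exprn_gt0//.
  apply: le_trans Nn; rewrite -natrX ler_nat ltnW// ltnNge; apply/negP => /p2.
  by rewrite ltnn.
have nE : 1 + eta * ln n <= n `^ eta.
  by rewrite /powR gt_eqF//; exact: expR_ge1Dx.
have n_eta : 1 <= n `^ eta.
  have : 0 <= eta * ln n by rewrite mulr_ge0 ?ln_ge0// ltW.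
  by lra.
set y := n `^ eta in nE n_eta *.
have pE : p%:R - 1 <= y / (eta * ln 2).
  rewrite ler_pdivlMr ?mulr_gt0//.
  have : eta * ((p%:R - 1) * ln 2) <= eta * ln n by rewrite ler_wpM2l// ltW.
  by rewrite mulrCA; lra.
rewrite natrD natrM.
have -> : (17 + 4 / (eta * ln 2)) * y = 17 * y + 4 * (y / (eta * ln 2)) by ring.
lra.
Qed.

Lemma gain_power : exists g : R, 0 <= g /\ forall p, gain R p = g * (4 * p + 13)%:R ^+ 5.
Proof.
exists (64 * 2256); split; first by apply: mulr_ge0; exact: ler0n.
by move=> p; rewrite /gain mulrA.
Qed.

End Final.

Theorem theorem1p1 (R : realType) (delta eps : R) (hdelta : 0 < delta) (heps : 0 < eps) :
  exists C : R, forall n H : R,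
    1 <= n -> n `^ (2^-1 + delta) <= H ->
    M2 H n <= C * H * n `^ (1 + eps).
Proof.
have eta0 : 0 < eps / 10 by rewrite divr_gt0.
have [A A0 AP] := log_le_power eta0.
have [g [g0 gE]] := gain_power R.
pose c0 : R := 2 ^+ 14 * (16 * g ^+ 2).
exists (48 * (c0 * A ^+ 10)) => n H n1 nH.
have n0 : 0 < n by lra.
have [N [L [N0 LN Nn E]]] := expsum_rsum n1.
have [p Np pA] := AP n N n1 N0 Nn.
have sH : Num.sqrt n <= H.
  apply: le_trans nH; rewrite -powR12_sqrt; last exact: ltW.
  by apply: ler_powR => //; lra.
have s1 : 1 <= Num.sqrt n by rewrite -[leLHS]sqrtr1; exact: ler_wsqrtr.
have H1 : 1 <= H by exact: le_trans sH.
have NH : N%:R <= H ^+ 2.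
  apply: (le_trans Nn); rewrite -[leLHS]sqr_sqrtr; last exact: ltW.
  by rewrite ler_pXn2r ?nnegrE//; lra.
pose c : R := 16 * gain R p ^+ 2.
have g1 := gain_ge1 R p.
have c6 : 6 <= c.
  have : 1 <= gain R p ^+ 2 by rewrite exprn_ege1.
  by rewrite /c; lra.
pose G := 2 ^+ 14 * c.
have G1 : 1 <= G.
  have h : 1 <= 2 ^+ 14 :> R by rewrite exprn_ege1// ler1n.
  rewrite /G; move: (2 ^+ 14) h => x h; nra.
have EG := energy_long N0 (bootstrap R N0 Np) c6 LN.
have H0 : 0 < H by lra.
apply: (le_trans (M2_le_energy H0 E)).
apply: (le_trans (energy_any_range N0 LN G1 H1 NH EG)).
have L2n : L%:R <= 2 * n.
  apply: (@le_trans _ _ (2 * N%:R)); first by rewrite -natrM ler_nat; clear -LN N0; lia.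
  by rewrite ler_wpM2l.
have GA : G <= c0 * A ^+ 10 * n `^ eps.
  have nE : n `^ eps = (n `^ (eps / 10)) ^+ 10.
    by rewrite -powR_mulrn ?powR_ge0// -powRrM divfK // pnatr_eq0.
  have GE : G = c0 * ((4 * p + 13)%:R ^+ 10).
    by rewrite /G /c /c0 gE; move: (2 ^+ 14) ((4 * p + 13)%:R) => a x; ring.
  apply: le_trans (_ : c0 * (4 * p + 13)%:R ^+ 10 <= _); first by rewrite -GE.
  rewrite -mulrA nE -exprMn; apply: ler_wpM2l.
    apply: mulr_ge0; first exact: exprn_ge0.
    by apply: mulr_ge0; [exact: ler0n|exact: exprn_ge0].
  by rewrite ler_pXn2r ?nnegrE// mulr_ge0 ?powR_ge0.
have -> : n `^ (1 + eps) = n * n `^ eps.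
  by rewrite powRD ?(gt_eqF n0) ?implybT// powRr1// ltW.
set y := n `^ eps in GA *.
have GH0 : 0 <= 24 * G * H.
  exact: mulr_ge0 (mulr_ge0 (ler0n _ _) (le_trans ler01 G1)) (ltW H0).
have GH : 24 * G * H <= 24 * (c0 * A ^+ 10 * y) * H.
  exact: ler_wpM2r (ltW H0) _ _ (ler_wpM2l (ler0n R 24) GA).
apply: (le_trans (ler_pM GH0 (ler0n _ _) GH L2n)).
by move: (c0 * A ^+ 10) => k; rewrite le_eqVlt; apply/orP; left; apply/eqP; ring.
Qed.
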